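(* Let $d\ge1$, $0<s<\min\{1,d/2\}$ and $1\le q<2^*=2d/(d-2s)$. Then there exists a constant $C_{q,d,s}>0$ such that for any domain $\Omega\subset\mathbb{R}^d$ with finite measure $|\Omega|$ one has $$\|u\|_q^2\le C_{q,d,s}\,|\Omega|^{2\left(\frac1q-\frac1{2^*}\right)}\,h_s[u]\qquad\text{for all }u\in C_0^\infty(\Omega).$$
   Context: Here $\|\cdot\|_q$ is the norm of $L^q(\mathbb{R}^d)$, functions in $C_0^\infty(\Omega)$ are extended by zero, and $$h_s[u]=\int_{\mathbb{R}^d}|\xi|^{2s}|\hat u(\xi)|^2\,d\xi-\mathcal{C}_{s,d}\int_{\mathbb{R}^d}|x|^{-2s}|u(x)|^2\,dx,\qquad \mathcal{C}_{s,d}=2^{2s}\,\frac{\Gamma((d+2s)/4)^2}{\Gamma((d-2s)/4)^2},$$ with $\hat u(\xi)=(2\pi)^{-d/2}\int_{\mathbb{R}^d}u(x)e^{-i\xi\cdot x}\,dx$. *)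

(* Defs.v *)
From HB Require Import structures.
From mathcomp Require Import all_boot all_order all_algebra.
From mathcomp Require Import all_classical all_reals all_analysis.
From mathcomp Require Import measurable_realfun.
From mathcomp.real_closed Require Import complex.

Set Implicit Arguments.
Unset Strict Implicit.
Unset Printing Implicit Defensive.

Import Order.TTheory GRing.Theory Num.Theory.
Import numFieldNormedType.Exports.

Local Open Scope classical_set_scope.
Local Open Scope ring_scope.

(* The sigma-algebra on row vectors is the one generated by the coordinates, as
   the library does for tuples; over the reals it is the Borel sigma-algebra
   (see [open_measurable_rV]). *)
Definition measure_rV_display : measure_display -> measure_display.
Proof. exact. Qed.

Section measurable_rV.
Context {d} {T : sigmaRingType d} (n : nat).

Let coord : 'I_n -> 'rV[T]_n -> T := fun i x => x 0 i.

Let rV_set0 : g_sigma_preimage coord set0.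
Proof. exact: sigma_algebra0. Qed.

Let rV_setC A : g_sigma_preimage coord A -> g_sigma_preimage coord (~` A).
Proof. exact: sigma_algebraC. Qed.

Let rV_bigcup (F : _^nat) : (forall i, g_sigma_preimage coord (F i)) ->
  g_sigma_preimage coord (\bigcup_i (F i)).
Proof. exact: sigma_algebra_bigcup. Qed.

HB.instance Definition _ := @isMeasurable.Build (measure_rV_display d)
  'rV[T]_n (g_sigma_preimage coord) rV_set0 rV_setC rV_bigcup.

End measurable_rV.

Lemma measurable_coord d (T : sigmaRingType d) n (i : 'I_n) :
  measurable_fun [set: 'rV[T]_n] (fun x => x 0 i).
Proof.
move=> _ Y mY; rewrite setTI; apply: sub_sigma_algebra => /=.
rewrite -bigcup_seq/=; exists i => /=; first by rewrite mem_index_enum.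
by exists Y => //; rewrite setTI.
Qed.

Lemma measurable_fun_coord d1 d2 (T1 : measurableType d1)
    (T2 : measurableType d2) n (f : T1 -> 'rV[T2]_n) :
  (forall i, measurable_fun [set: T1] (fun x => f x 0 i)) ->
  measurable_fun [set: T1] f.
Proof.
move=> mf.
apply: (@measurability _ _ _ _ setT f (\big[setU/set0]_(i < n)
  preimage_set_system setT (fun x : 'rV[T2]_n => x 0 i) measurable)) => //.
move=> _ [B + <-]; rewrite -bigcup_seq => -[i _ [Y mY <-]].
by rewrite !setTI; have := mf i measurableT Y mY; rewrite setTI.
Qed.

Section lebesgue_rV.
Context {R : realType}.

Definition cons_rV n (p : measurableTypeR R * 'rV[R]_n) : 'rV[R]_n.+1 :=
  \row_i oapp (p.2 0) p.1 (unlift ord0 i).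

Definition uncons_rV n (x : 'rV[R]_n.+1) : measurableTypeR R * 'rV[R]_n :=
  (x 0 ord0, \row_i x 0 (lift ord0 i)).

Lemma cons_rV0 n (p : measurableTypeR R * 'rV[R]_n) : cons_rV p 0 ord0 = p.1.
Proof. by rewrite mxE unlift_none. Qed.

Lemma cons_rVS n (p : measurableTypeR R * 'rV[R]_n) i :
  cons_rV p 0 (lift ord0 i) = p.2 0 i.
Proof. by rewrite mxE liftK. Qed.

Lemma measurable_cons_rV n :
  measurable_fun [set: measurableTypeR R * 'rV[R]_n] (@cons_rV n).
Proof.
apply: measurable_fun_coord => i; case: (unliftP ord0 i) => [k|] ->.
  under eq_fun do rewrite cons_rVS.
  exact: (measurableT_comp (@measurable_coord _ R n k) measurable_snd).
under eq_fun do rewrite cons_rV0.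
exact: measurable_fst.
Qed.

Lemma measurable_uncons_rV n : measurable_fun [set: 'rV[R]_n.+1] (@uncons_rV n).
Proof.
apply/measurable_fun_pair; first exact: measurable_coord.
apply: measurable_fun_coord => i; under eq_fun do rewrite mxE.
exact: measurable_coord.
Qed.

Lemma cons_rVK n : cancel (@cons_rV n) (@uncons_rV n).
Proof.
move=> p; rewrite /uncons_rV cons_rV0 [RHS]surjective_pairing; congr pair.
by apply/rowP => i; rewrite mxE cons_rVS.
Qed.

Section step.
Variables (n : nat) (mu : {sigma_finite_measure set 'rV[R]_n -> \bar R}).

Definition lebesgue_rV_step : set 'rV[R]_n.+1 -> \bar R :=
  pushforward (lebesgue_measure \x mu)%E (@cons_rV n).

Let step0 : lebesgue_rV_step set0 = 0%E.
Proof. by rewrite /lebesgue_rV_step /pushforward preimage_set0 measure0. Qed.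

Let step_ge0 A : (0 <= lebesgue_rV_step A)%E.
Proof. by rewrite /lebesgue_rV_step /pushforward measure_ge0. Qed.

Let step_sigma_additive : semi_sigma_additive lebesgue_rV_step.
Proof.
rewrite /lebesgue_rV_step; apply: measure_semi_sigma_additive.
exact: measurable_cons_rV.
Qed.

HB.instance Definition _ := isMeasure.Build _ _ _ lebesgue_rV_step
  step0 step_ge0 step_sigma_additive.

Let sigma_finite_step : sigma_finite setT lebesgue_rV_step.
Proof.
have /sigma_finiteP[F [FT ndF Foo]] :=
  sigma_finiteT (@lebesgue_measure R : {sigma_finite_measure set _ -> \bar R}).
have /sigma_finiteP[G [GT ndG Goo]] := sigma_finiteT mu.
exists (fun k => @uncons_rV n @^-1` (F k `*` G k)).
  rewrite -preimage_bigcup (_ : \bigcup_k _ = setT) ?preimage_setT//.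
  rewrite -setXTT FT GT predeqE => -[a x]; split.
    by move=> [k _ []/= ? ?]; split; exists k.
  move=> [/= [k _ Fka] [l _ Glx]]; exists (maxn k l) => //; split.
  - by move: a Fka; exact/subsetPset/ndF/leq_maxl.
  - by move: x Glx; exact/subsetPset/ndG/leq_maxr.
move=> k; have [mF Fk] := Foo k; have [mG Gk] := Goo k; split.
  rewrite -[X in measurable X]setTI; apply: measurable_uncons_rV => //.
  exact: measurableX.
rewrite /lebesgue_rV_step /pushforward -comp_preimage.
rewrite (_ : _ \o _ = id); last by apply/funext => p; exact: cons_rVK.
by rewrite /= product_measure1E// lte_mul_pinfty// ge0_fin_numE.
Qed.

HB.instance Definition _ := Measure_isSigmaFinite.Build _ _ _ lebesgue_rV_step
  sigma_finite_step.

End step.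

(* Lebesgue measure on R^n, as an iterated product; characterized by
   [lebesgue_rV_box] below. *)
Fixpoint lebesgue_rV n : {sigma_finite_measure set 'rV[R]_n -> \bar R} :=
  match n with
  | 0 => dirac (0 : 'rV[R]_0)
  | n'.+1 => lebesgue_rV_step (lebesgue_rV n')
  end.

Lemma measurable_box n (A : 'I_n -> set R) : (forall i, measurable (A i)) ->
  measurable [set x : 'rV[R]_n | forall i, A i (x 0 i)].
Proof.
move=> mA; rewrite (_ : mkset _ =
    \bigcap_(i in [set: 'I_n]) [set x : 'rV[R]_n | A i (x 0 i)]); last first.
  by apply/seteqP; split=> [x Ax i _|x Ax i]; exact: Ax.
apply: fin_bigcap_measurable; first exact: finite_finset.
move=> i _.
by have := @measurable_coord _ R _ i measurableT _ (mA i); rewrite setTI.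
Qed.

Lemma lebesgue_rV_box n (A : 'I_n -> set R) : (forall i, measurable (A i)) ->
  lebesgue_rV n [set x | forall i, A i (x 0 i)] =
  (\prod_(i < n) lebesgue_measure (A i))%E.
Proof.
elim: n A => [|n IHn] A mA.
  by rewrite big_ord0 /= diracE mem_set// => -[].
rewrite big_ord_recl -IHn//= /lebesgue_rV_step /pushforward.
rewrite -product_measure1E//; last 2 first.
- exact: mA.
- exact: (@measurable_box _ (fun i => A (lift ord0 i))).
apply: (congr1 (lebesgue_measure \x lebesgue_rV n)%E).
apply/seteqP; split=> -[a x] /=.
  move=> Aax; split=> [|i]; first by have := Aax ord0; rewrite cons_rV0.
  by have := Aax (lift ord0 i); rewrite cons_rVS.
move=> [Aa Ax] i; case: (unliftP ord0 i) => [k|] ->; first by rewrite cons_rVS.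
by rewrite cons_rV0.
Qed.

Lemma open_measurable_rV n (A : set 'rV[R]_n) : open A -> measurable A.
Proof.
move=> oA.
pose B (p : 'rV[rat]_n * nat) : set 'rV[R]_n :=
  [set x | forall i, ball (ratr (p.1 0 i) : R) p.2.+1%:R^-1 (x 0 i)].
have mB p : measurable (B p).
  apply: (@measurable_box _ (fun i => ball (ratr (p.1 0 i) : R) p.2.+1%:R^-1)).
  by move=> i; exact: measurable_ball.
rewrite (_ : A = \bigcup_(p in [set p | B p `<=` A]) B p).
  rewrite bigcup_mkcond; apply: countable_bigcupT_measurable => // p.
  by case: ifPn.
apply/seteqP; split=> [x Ax|x [p pA]]; last exact: pA.
have /nbhs_ballP[e /= e0 xeA] : nbhs x A by exact: open_nbhs_nbhs.
have [k ke] : exists k : nat, k.+1%:R^-1 < e / 2.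
  have /ltr_add_invr[k] : 0 < e / 2 by rewrite divr_gt0.
  by rewrite add0r => ?; exists k.
have k0 : 0 < k.+1%:R^-1 :> R by rewrite invr_gt0.
have qx i : exists r : rat, `|x 0 i - ratr r| < k.+1%:R^-1.
  have [|r] := @rat_in_itvoo R (x 0 i - k.+1%:R^-1) (x 0 i + k.+1%:R^-1).
    by rewrite ltrBlDr -addrA ltrDl addr_gt0.
  by rewrite in_itv => ?; exists r; rewrite distrC ltr_distl.
pose r i := projT1 (cid (qx i)).
have rP i : `|x 0 i - ratr (r i)| < k.+1%:R^-1 by rewrite /r; case: cid.
exists (\row_i r i, k) => /=; last by move=> i; rewrite /ball/= mxE distrC.
move=> y By; apply: xeA; split=> // a i; rewrite (ord1 a).
have := By i; rewrite /ball/= mxE => yr.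
rewrite -(subrKA (ratr (r i))) (le_lt_trans (ler_normD _ _))// (splitr e).
by rewrite ltrD// (lt_trans _ ke).
Qed.

End lebesgue_rV.

Section hardy.
Context {R : realType}.

(* The Euclidean norm: the library's [`|x|] on row vectors is the sup norm. *)
Definition enorm d (x : 'rV[R]_d) : R := Num.sqrt (\sum_i x 0 i ^+ 2).

Definition edot d (x y : 'rV[R]_d) : R := \sum_i x 0 i * y 0 i.

(* Euler's integral, meant for 0 < z. *)
Definition Gamma (z : R) : R :=
  \int[lebesgue_measure]_(t in `]0, +oo[) (t `^ (z - 1) * expR (- t)).

Definition Cintegral d (f : 'rV[R]_d -> R[i]) : R[i] :=
  Complex (\int[lebesgue_rV d]_x complex.Re (f x))
          (\int[lebesgue_rV d]_x complex.Im (f x)).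

(* Unitary convention, with kernel exp(- i xi.x). *)
Definition fourier d (u : 'rV[R]_d -> R[i]) (xi : 'rV[R]_d) : R[i] :=
  Complex ((2 * pi) `^ (- (d%:R / 2))) 0 *
  Cintegral (fun x => u x * Complex (cos (edot xi x)) (- sin (edot xi x))).

Definition hardy_const d (s : R) : R :=
  2 `^ (2 * s) * Gamma ((d%:R + 2 * s) / 4) ^+ 2 / Gamma ((d%:R - 2 * s) / 4) ^+ 2.

(* The value of the weight at the origin (powR 0 r = 0 for r != 0) is irrelevant,
   the origin being negligible. Both integrals are finite when u is a test
   function and 0 < s < d/2, so the difference in \bar R is the real one. *)
Definition hardy_form d (s : R) (u : 'rV[R]_d -> R[i]) : \bar R :=
  (\int[lebesgue_rV d]_xi (enorm xi `^ (2 * s) * Normc.normc (fourier u xi) ^+ 2)%:E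
   - (hardy_const d s)%:E *
     \int[lebesgue_rV d]_x (enorm x `^ (- (2 * s)) * Normc.normc (u x) ^+ 2)%:E)%E.

Definition sobolev_exponent d (s : R) : R := 2 * d%:R / (d%:R - 2 * s).

Definition is_domain d (Omega : set 'rV[R]_d) : Prop :=
  [/\ Omega !=set0, open Omega & connected Omega].

Definition iter_partial d (l : seq 'I_d) (f : 'rV[R]_d -> R) : 'rV[R]_d -> R :=
  foldr (fun i g x => 'D_(delta_mx 0 i) g x) f l.

Definition smooth d (f : 'rV[R]_d -> R) : Prop :=
  forall l : seq 'I_d, continuous (iter_partial l f) /\
    forall i x, derivable (iter_partial l f) x (delta_mx 0 i).

Definition tsupport d (u : 'rV[R]_d -> R[i]) : set 'rV[R]_d :=
  closure [set x | u x != 0].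

(* An element of C_0^oo(Omega) is identified with its extension by zero. *)
Definition test_function d (Omega : set 'rV[R]_d) (u : 'rV[R]_d -> R[i]) : Prop :=
  [/\ smooth (fun x => complex.Re (u x)), smooth (fun x => complex.Im (u x)),
      compact (tsupport u) & tsupport u `<=` Omega].

End hardy.

(* Main.v *)
(* The Hardy inequality is proved with a remainder, on the Fourier side. Since
   |x|^(-2s) is a superposition of Gaussians, the potential term is a quadratic
   form in |u^| with a positive kernel, and the Schur test applies with a weight
   which is a superposition of heat kernels p_tau: the one with density
   tau^b0 dtau/tau, b0 = (d - 2s)/4, gives the sharp constant, and subtracting a
   small multiple of the one with density tau^(b0 - e) on the scales tau > e^l
   gives a gain, because b |-> B(s, b) is strictly log-convex. With t = s - e and
   |u|_t the norm of |xi|^t u^, this reads, for all l,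
     eps e^(e l) |u|_t^2 <= h_s[u] + B e^(s l) |u|_0^2.
   Comparing u with its heat flow at a time of order |Omega|^(2/d) bounds |u|_0^2
   by C |Omega|^(2t/d) |u|_t^2, so the last term is absorbed for a suitable l and
   |u|_t^2 <= C |Omega|^(2e/d) h_s[u]. Comparing u with its heat flow at a time
   depending on the level gives the weak-type Sobolev inequality with exponent
   2d/(d - 2t), which exceeds q for small e; summing over dyadic levels ends the
   proof. *)
From HB Require Import structures.
Require Import Defs.
From mathcomp Require Import all_boot all_order all_algebra.
From mathcomp Require Import all_classical all_reals all_analysis.
From mathcomp Require Import measurable_realfun ring lra.
From mathcomp.real_closed Require Import complex.

Set Implicit Arguments.
Unset Strict Implicit.
Unset Printing Implicit Defensive.

Import Order.TTheory GRing.Theory Num.Theory.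
Import numFieldNormedType.Exports.

Local Open Scope classical_set_scope.
Local Open Scope ring_scope.

Local Notation measT := (measurable_fun setT).

(** The multiplier attached to the density [tau^b dtau/tau] is proportional to
    [Beta s b * Beta s (2 * b0 - b)]. It is symmetric about [b0], the value of [hardy_const] makes
    it 1 there, and it exceeds 1 at [b0 - e]. Removing a multiple of the second density therefore
    lowers the image of the weight by more than the weight itself, which is the gain. It cannot be
    removed on all scales: [tau^(b0 - e)] dominates [tau^b0] as [tau] tends to 0, and a Schur weight
    must stay positive. Hence the cut at [e^l], whose price is the term in |u|_0^2. Heat potentials
    are convenient weights because the semigroup law reduces each convolution to an integral over
    two scales, evaluated by Gamma and Beta functions. A complex function is a pair [a], [b] of real
    ones. *)

Lemma eq_lee disp (T : porderType disp) (x y : T) : x = y -> (x <= y)%O.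
Proof. by move=> ->. Qed.

Lemma exp2pi_gt0 (R : realType) n : 0 < (2 * pi) ^+ n :> R.
Proof. by rewrite exprn_gt0// mulr_gt0 ?pi_gt0. Qed.

(** * Fubini's theorem under a product bound *)

Section fubini_real.
Context d1 d2 (T1 : measurableType d1) (T2 : measurableType d2) (R : realType).
Variables (m1 : {sigma_finite_measure set T1 -> \bar R}).
Variables (m2 : {sigma_finite_measure set T2 -> \bar R}).
Variables (f : T1 * T2 -> R) (g : T1 -> R) (k : T2 -> R).
Hypothesis mf : measT f.
Hypothesis ig : m1.-integrable setT (EFin \o g).
Hypothesis ik : m2.-integrable setT (EFin \o k).
Hypothesis fgk : forall x y, `|f (x, y)| <= g x * k y.

Let mf1 x : measT (fun y => f (x, y)).
Proof. exact: measurable_fun_pair2. Qed.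

Let mf2 y : measT (fun x => f (x, y)).
Proof. exact: measurable_fun_pair1. Qed.

Let mabs d (T : measurableType d) (h : T -> R) : measT h ->
  measT (fun x => `|(h x)%:E|%E).
Proof. by move=> mh; apply: measurableT_comp => //; exact/measurable_EFinP. Qed.

Let if1 x : m2.-integrable setT (fun y => (f (x, y))%:E).
Proof.
apply: (@le_integrable _ _ _ _ _ measurableT _ (fun y => (g x)%:E * (k y)%:E)%E).
- exact/measurable_EFinP.
- by move=> y _ /=; rewrite lee_fin (le_trans (fgk _ _))// ler_norm.
- exact: (integrableZl measurableT (g x) ik).
Qed.

Let if2 y : m1.-integrable setT (fun x => (f (x, y))%:E).
Proof.
apply: (@le_integrable _ _ _ _ _ measurableT _ (fun x => (g x)%:E * (k y)%:E)%E).
- exact/measurable_EFinP.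
- by move=> x _ /=; rewrite lee_fin (le_trans (fgk _ _))// ler_norm.
- exact: (integrableZr measurableT (k y) ig).
Qed.

(** By Tonelli: the inner integral of [|f|] at [x] is at most [|g x|] times the finite integral of
    [|k|]. *)
Lemma integrable_prod_dominated : (m1 \x m2)%E.-integrable setT (EFin \o f).
Proof.
apply/integrable12ltyP; first exact/measurable_EFinP.
have [/measurable_EFinP mg fg] := integrableP _ _ _ ig.
have [/measurable_EFinP mk fk] := integrableP _ _ _ ik.
apply: (@le_lt_trans _ _ (\int[m1]_x (`|(g x)%:E| * \int[m2]_y `|(k y)%:E|)))%E.
  apply: ge0_le_integral => //.
  - by move=> x _; exact: integral_ge0.
  - apply: (measurable_fun_fubini_tonelli_F (m2 := m2) (fun z => `|(EFin \o f) z|%E)) => //.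
    exact: mabs.
  - by apply: emeasurable_funM; [exact: mabs|exact: measurable_cst].
  move=> x _; rewrite -ge0_integralZl//; last exact: mabs.
  apply: ge0_le_integral => //.
  - exact: mabs.
  - by apply: emeasurable_funM; [exact: measurable_cst|exact: mabs].
  by move=> y _ /=; rewrite lee_fin -normrM (le_trans (fgk _ _))// ler_norm.
have k_fin : (\int[m2]_y `|(k y)%:E| \is a fin_num)%E by rewrite ge0_fin_numE// integral_ge0.
rewrite ge0_integralZr//; last 2 first.
- exact: mabs.
- exact: integral_ge0.
by rewrite lte_mul_pinfty ?integral_ge0// ge0_fin_numE ?integral_ge0.
Qed.

Lemma Rintegral_fubini :
  \int[m1]_x \int[m2]_y f (x, y) = \int[m2]_y \int[m1]_x f (x, y).
Proof.
have If := integrable_prod_dominated.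
rewrite /Rintegral; congr fine.
transitivity (\int[m1]_x \int[m2]_y (EFin \o f) (x, y))%E.
  by apply: eq_integral => x _; rewrite fineK// integrable_fin_num.
rewrite (Fubini If); apply: eq_integral => y _.
by rewrite fineK// integrable_fin_num.
Qed.

Lemma integrable_Rintegral2 :
  m1.-integrable setT (fun x => (\int[m2]_y f (x, y))%:E).
Proof.
apply: eq_integrable (integrable_fubini_F integrable_prod_dominated) => // x _.
by rewrite /Rintegral fineK// integrable_fin_num.
Qed.

End fubini_real.

(** * Translation and reflection on the line *)

Section lebesgue_R.
Context {R : realType}.
Local Notation leb := (@lebesgue_measure R).
Local Open Scope ereal_scope.

(** The image of Lebesgue measure under a translation agrees with it on half-open intervals, which
    determine the measure. *)
Lemma ge0_integral_shift (f : R -> \bar R) (c : R) : measT f ->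
  (forall x, 0 <= f x) -> \int[leb]_x f (x + c)%R = \int[leb]_x f x.
Proof.
move=> mf f0.
have mc : measT (fun x : measurableTypeR R => (x + c)%R : measurableTypeR R).
  exact: measurable_funD.
rewrite -[LHS](@ge0_integral_pushforward _ _ _ _ _ _ mc leb setT f)//.
apply: eq_measure_integral => A mA _; apply/esym/lebesgue_measure_unique => //= _ [[a b]] _ <-.
rewrite /pushforward (_ : _ @^-1` _ = `](a - c)%R, (b - c)%R]%classic); last first.
  by apply/seteqP; split => x /=; rewrite !in_itv/= ltrBlDr lerBrDr.
rewrite !lebesgue_measure_itv/= !lte_fin ltrD2r.
by case: ifP => // _; rewrite -!EFinB; congr EFin; ring.
Qed.

Lemma ge0_integral_opp (f : R -> \bar R) : measT f ->
  (forall x, 0 <= f x) -> \int[leb]_x f (- x)%R = \int[leb]_x f x.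
Proof.
move=> mf f0.
have mc : measT (-%R : measurableTypeR R -> measurableTypeR R) by exact: measurable_funN.
rewrite -[LHS](@ge0_integral_pushforward _ _ _ _ _ _ mc leb setT f)//.
by apply: eq_measure_integral => A mA _; exact: lebesgue_measureN.
Qed.

End lebesgue_R.

(** * Integrability and measurability on the whole space *)

Section integralT.
Context d (T : measurableType d) (R : realType) (mu : {measure set T -> \bar R}).
Implicit Types f g : T -> \bar R.
Local Open Scope ereal_scope.

Lemma le_integralT f g : (forall x, 0 <= f x) -> measT f -> measT g ->
  (forall x, f x <= g x) -> \int[mu]_x f x <= \int[mu]_x g x.
Proof. by move=> f0 mf mg fg; apply: ge0_le_integral. Qed.

Lemma ge0_integralDT f g : (forall x, 0 <= f x) -> measT f ->
  (forall x, 0 <= g x) -> measT g ->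
  \int[mu]_x (f x + g x) = \int[mu]_x f x + \int[mu]_x g x.
Proof. by move=> f0 mf g0 mg; apply: ge0_integralD. Qed.

Lemma ge0_integralZlT f (r : R) : (forall x, 0 <= f x) -> measT f -> (0 <= r)%R ->
  \int[mu]_x (r%:E * f x) = r%:E * \int[mu]_x f x.
Proof. by move=> f0 mf r0; rewrite ge0_integralZl. Qed.

Lemma ge0_integralZrT f (r : R) : (forall x, 0 <= f x) -> measT f -> (0 <= r)%R ->
  \int[mu]_x (f x * r%:E) = \int[mu]_x f x * r%:E.
Proof. by move=> f0 mf r0; rewrite ge0_integralZr. Qed.

End integralT.

Section integrable_real.
Context d (T : measurableType d) (R : realType) (mu : {measure set T -> \bar R}).
Implicit Types f g : T -> R.
Local Notation int f := (mu.-integrable setT (fun x => (f x)%:E)).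

Lemma integrableRZ (k : R) f : int f -> int (fun x => k * f x).
Proof. by move=> h; under eq_fun do rewrite EFinM; exact: integrableZl. Qed.

Lemma integrableRD f g : int f -> int g -> int (fun x => f x + g x).
Proof. by move=> hf hg; under eq_fun do rewrite EFinD; exact: integrableD. Qed.

Lemma integrableRB f g : int f -> int g -> int (fun x => f x - g x).
Proof. by move=> hf hg; under eq_fun do rewrite EFinB; exact: integrableB. Qed.

Lemma integrable_dom f g : int g -> measT f -> (forall x, `|f x| <= g x) -> int f.
Proof.
move=> hg mf fg; apply: le_integrable hg => //; first exact/measurable_EFinP.
by move=> x _; rewrite /= lee_fin (le_trans (fg x))// ler_norm.
Qed.

Lemma integrable_abs f : int f -> int (fun x => `|f x|).
Proof. exact: integrable_abse. Qed.

Lemma integrable_mf f : int f -> measT f.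
Proof. by move=> /measurable_int/measurable_EFinP. Qed.

End integrable_real.

Section measurability.
Context d (T : measurableType d) (R : realType).
Implicit Types f g : T -> R.

Lemma mf_expR f : measT f -> measT (fun x => expR (f x)).
Proof. exact: measurableT_comp. Qed.

Lemma mf_ln f : measT f -> measT (fun x => ln (f x)).
Proof. exact: measurableT_comp. Qed.

Lemma mf_norm f : measT f -> measT (fun x => `|f x|).
Proof. exact: measurableT_comp. Qed.

Lemma mf_powR f (a : R) : measT f -> measT (fun x => f x `^ a).
Proof. move=> mf; exact: (measurableT_comp (measurable_powR a) mf). Qed.

Lemma mf_cos f : measT f -> measT (fun x => cos (f x)).
Proof. by apply: measurableT_comp; apply: continuous_measurable_fun; exact: continuous_cos. Qed.

Lemma mf_sin f : measT f -> measT (fun x => sin (f x)).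
Proof. by apply: measurableT_comp; apply: continuous_measurable_fun; exact: continuous_sin. Qed.

Lemma mf_sqrt f : measT f -> measT (fun x => Num.sqrt (f x)).
Proof. by apply: measurableT_comp; apply: continuous_measurable_fun; exact: sqrt_continuous. Qed.

Lemma mf_inv f : (forall x, 0 < f x) -> measT f ->
  measT (fun x => (f x)^-1).
Proof.
move=> f0 mf; rewrite (_ : (fun x => _) = fun x => expR (- ln (f x))).
  exact/mf_expR/measurable_funN/mf_ln.
by apply/funext => x; rewrite expRN lnK// posrE.
Qed.

Lemma mf_add f g : measT f -> measT g ->
  measT (fun x => f x + g x).
Proof. exact: measurable_funD. Qed.

Lemma mf_sub f g : measT f -> measT g ->
  measT (fun x => f x - g x).
Proof. exact: measurable_funB. Qed.

Lemma mf_opp f : measT f -> measT (fun x => - f x).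
Proof. exact: measurable_funN. Qed.

Lemma mf_mul f g : measT f -> measT g ->
  measT (fun x => f x * g x).
Proof. exact: measurable_funM. Qed.

Lemma mf_exp f n : measT f -> measT (fun x => f x ^+ n).
Proof. exact: measurable_funX. Qed.

Lemma mf_EFin f : measT f -> measT (fun x => (f x)%:E).
Proof. by move=> mf; exact/measurable_EFinP. Qed.

Lemma mf_if f (P : T -> bool) : measurable [set x | P x] -> measT f ->
  measT (fun x => if P x then f x else 0).
Proof.
move=> mP mf; rewrite (_ : (fun x => _) = f \_ [set x | P x]).
  by apply/(measurable_restrictT f) => //; exact: measurable_funTS.
apply/funext => x; rewrite patchE; have [Px|Px] := boolP (P x).
  by rewrite mem_set.
by rewrite memNset//; exact/negP.
Qed.

End measurability.

Ltac meas :=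
  repeat first
  [ done | assumption
  | apply: measurable_cst
  | apply: emeasurable_funM
  | apply: mf_EFin
  | apply: mf_if
  | apply: mf_expR | apply: mf_ln | apply: mf_cos | apply: mf_sin | apply: mf_norm | apply: mf_sqrt
  | apply: mf_powR
  | apply: mf_exp
  | apply: mf_sub | apply: mf_add | apply: mf_opp | apply: mf_mul
  | apply: mf_inv
  | apply: measurable_fst | apply: measurable_snd
  ].

(** * Gamma and Beta integrals in logarithmic scale *)

Section gamma.
Context {R : realType}.
Local Notation leb := (@lebesgue_measure R).

(* Euler's integral after the substitution [t = expR x]: scales are parametrized
   additively throughout, so that [dt/t] becomes [dx]. *)
Definition gamma_int (z : R) : \bar R := (\int[leb]_x (expR (z * x - expR x))%:E)%E.

Lemma gamma_int_ge0 z : (0 <= gamma_int z)%E.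
Proof. by apply: integral_ge0 => x _; rewrite lee_fin expR_ge0. Qed.

(** A two-sided exponential of rate [z] dominates the integrand: for [x >= 0], the maximum of
    [2 * z * x - expR x], attained at [x = ln (2 * z)], bounds [z * x - expR x] by a constant minus
    [z * x]. *)
Lemma gamma_int_fin z : 0 < z -> (gamma_int z < +oo)%E.
Proof.
move=> z0.
(* The division by [z] undoes the factor [z] of the exponential density; the summand 1 serves
   [x < 0], the other one [x >= 0]. *)
pose C := (1 + expR (2 * z * ln (2 * z) - 2 * z)) / z.
have C0 : 0 < C by rewrite divr_gt0// ltr_wpDr// expR_ge0.
pose e : R -> R := @exponential_pdf R z.
have me : measT e by exact: measurable_exponential_pdf.
have me1 : measT (fun x : R => (e x)%:E) by exact: mf_EFin.
have me2 : measT (fun x : R => (e (- x))%:E).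
  by apply/mf_EFin; apply: (measurableT_comp me); exact: measurable_funN.
have e0 x : 0 <= e x by apply: exponential_pdf_ge0; exact: ltW.
apply: (@le_lt_trans _ _ (\int[leb]_x (C%:E * ((e x)%:E + (e (- x))%:E)))%E).
  apply: le_integralT.
  - by move=> x; rewrite lee_fin expR_ge0.
  - by meas.
  - by apply: emeasurable_funM => //; exact: emeasurable_funD.
  move=> x; rewrite -EFinD -EFinM lee_fin.
  have [x0|x0] := leP 0 x.
    apply: (@le_trans _ _ (C * e x)); last by rewrite ler_wpM2l ?(ltW C0)// lerDl.
    rewrite /e exponential_pdfE// /C mulrA divfK ?gt_eqF//.
    apply: (@le_trans _ _ (expR (2 * z * ln (2 * z) - 2 * z) * expR (- z * x))); last first.
      by rewrite ler_wpM2r ?expR_ge0// lerDr.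
    rewrite -expRD ler_expR.
    have := expR_ge1Dx (x - ln (2 * z)); rewrite expRB lnK ?posrE ?mulr_gt0//.
    rewrite ler_pdivlMr ?mulr_gt0//; nra.
  apply: (@le_trans _ _ (C * e (- x))); last by rewrite ler_wpM2l ?(ltW C0)// lerDr.
  rewrite /e exponential_pdfE ?oppr_ge0 ?(ltW x0)// /C mulrA divfK ?gt_eqF//.
  rewrite -[leLHS]mul1r ler_pM ?expR_ge0//; first by rewrite lerDl expR_ge0.
  by rewrite ler_expR; have := expR_ge0 x; lra.
rewrite ge0_integralZlT; last 3 first.
- by move=> x; rewrite adde_ge0 ?lee_fin.
- exact: emeasurable_funD.
- exact: ltW.
rewrite ge0_integralDT; last 4 first.
- by move=> x; rewrite lee_fin.
- by [].
- by move=> x; rewrite lee_fin.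
- by [].
rewrite (@ge0_integral_opp _ (EFin \o e))//=.
by rewrite integral_exponential_pdf// -EFinD -EFinM ltry.
Qed.

Lemma integral_gt0_itv (f : R -> R) (a m : R) : measT f ->
  (forall x, 0 <= f x) -> 0 < m -> (forall x, a <= x <= a + 1 -> m <= f x) ->
  (0 < \int[leb]_x (f x)%:E)%E.
Proof.
move=> mf f0 m0 mfx.
apply: (@lt_le_trans _ _ (\int[leb]_(x in `[a, (a + 1)%R]) m%:E)%E).
  rewrite integral_cst//= lebesgue_measure_itv/= lte_fin ltrDl ltr01.
  by rewrite -EFinB -EFinM lte_fin addrAC subrr add0r mulr1.
apply: (@le_trans _ _ (\int[leb]_(x in `[a, (a + 1)%R]) (f x)%:E)%E).
  apply: ge0_le_integral.
  - exact: measurable_itv.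
  - by move=> x _; rewrite lee_fin ltW.
  - exact: measurable_cst.
  - by apply: measurable_funTS; meas.
  by move=> x; rewrite /= in_itv/= lee_fin; exact: mfx.
apply: ge0_subset_integral => //; first by meas.
by move=> x _; rewrite lee_fin.
Qed.

Lemma gamma_int_gt0 z : (0 < gamma_int z)%E.
Proof.
apply: (@integral_gt0_itv _ 0 (expR (- `|z| - expR 1))).
- by meas.
- by move=> x; exact: expR_ge0.
- exact: expR_gt0.
move=> x /andP[x0 x1]; rewrite ler_expR lerB ?ler_expR//; last by lra.
have := ler_norm (- z); rewrite normrN; have := normr_ge0 z; nra.
Qed.

(** The substitution is made on compact intervals; both sides are then limits along [[e^-n, e^n]]
    and [[-n, n]], by monotone convergence. *)
Lemma integral_expR_subst (G : R -> R) : (forall x, 0 < x -> {for x, continuous G}) ->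
  (forall x, 0 < x -> 0 <= G x) ->
  (\int[leb]_(x in `]0%R, +oo[) (G x)%:E = \int[leb]_x (G (expR x) * expR x)%:E)%E.
Proof.
move=> cG G0.
have mG : measurable_fun (`]0, +oo[ : set R) G.
  apply: open_continuous_measurable_fun; first exact: interval_open.
  by move=> x; rewrite inE/= in_itv/= andbT; exact: cG.
have dE : derive1 (expR : R -> R) = expR by apply/funext => x; rewrite derive1E; exact: derive_val.
pose A n := `[expR (- n%:R), expR n%:R]%classic : set R.
pose B n := `[(- n%:R : R), n%:R]%classic : set R.
have AU : \bigcup_n A n = `]0, +oo[%classic.
  apply/seteqP; split => [x [n _]|x]; rewrite /A/= !in_itv/= ?andbT.
    by move=> /andP[+ _]; apply: lt_le_trans; exact: expR_gt0.
  move=> x0; exists (Num.bound `|ln x|) => //=; rewrite /A/= in_itv/=.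
  have := archi_boundP (normr_ge0 (ln x)); rewrite ltr_norml => /andP[h1 h2].
  by rewrite -{2 3}(lnK x0) !ler_expR !ltW.
have BU : \bigcup_n B n = setT.
  apply/seteqP; split => // x _; exists (Num.bound `|x|) => //=; rewrite /B/= in_itv/=.
  by have := archi_boundP (normr_ge0 x); rewrite ltr_norml => /andP[h1 h2]; rewrite !ltW.
have AS n : A n `<=` `]0, +oo[.
  by rewrite -AU; exact: bigcup_sup.
have nA : nondecreasing_seq A.
  move=> m n mn; apply/subsetPset => x; rewrite /A/= !in_itv/= => /andP[h1 h2].
  by rewrite (le_trans _ h1) ?(le_trans h2)// ler_expR ?lerN2 ler_nat.
have nB : nondecreasing_seq B.
  move=> m n mn; apply/subsetPset => x; rewrite /B/= !in_itv/= => /andP[h1 h2].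
  by rewrite (le_trans _ h1) ?(le_trans h2)// ?lerN2 ler_nat.
have cvA : (\int[leb]_(x in A n) (G x)%:E @[n --> \oo] --> \int[leb]_(x in `]0%R, +oo[) (G x)%:E)%E.
  rewrite -AU; apply: ge0_nondecreasing_set_cvg_integral => //.
  - by move=> n; exact: measurable_itv.
  - move=> n; apply/measurable_EFinP; exact: measurable_funS mG.
  - by move=> n x /AS; rewrite /= in_itv/= andbT lee_fin; exact: G0.
have cvB : (\int[leb]_(x in B n) (G (expR x) * expR x)%:E @[n --> \oo] --> \int[leb]_x (G (expR x) * expR x)%:E)%E.
  rewrite -BU; apply: ge0_nondecreasing_set_cvg_integral => //.
  - by move=> n; exact: measurable_itv.
  - move=> n; apply/measurable_EFinP; apply: measurable_funTS.
    apply: measurable_funM => //; apply: (measurable_comp _ _ mG) => //.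
    by move=> _ [x _ <-]; rewrite /= in_itv/= expR_gt0.
  - by move=> n x _; rewrite lee_fin mulr_ge0 ?expR_ge0// G0 ?expR_gt0.
have AB n : (\int[leb]_(x in B n) (G (expR x) * expR x)%:E = \int[leb]_(x in A n) (G x)%:E)%E; last first.
  move: cvB; under eq_fun do rewrite AB.
  by move=> cvB; apply: (cvg_unique _ cvA cvB).
apply/esym; rewrite /A /B (@integration_by_substitution_increasing _ expR).
- by apply: eq_integral => x _; rewrite /= dE.
- by rewrite (@le_trans _ _ 0)// oppr_le0.
- by move=> x y _ _; rewrite ltr_expR.
- by rewrite dE => x _; exact: continuous_expR.
- by rewrite dE; apply/cvg_ex; exists (expR (- n%:R)); apply: cvg_at_right_filter; exact: continuous_expR.
- by rewrite dE; apply/cvg_ex; exists (expR n%:R); apply: cvg_at_left_filter; exact: continuous_expR.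
- split => [x _||]; first exact: derivable_expR.
    by apply: cvg_at_right_filter; exact: continuous_expR.
  by apply: cvg_at_left_filter; exact: continuous_expR.
- apply: continuous_in_subspaceT => x; rewrite inE/= in_itv/= => /andP[h _].
  by apply: cG; rewrite (lt_le_trans _ h)// expR_gt0.
Qed.

Lemma GammaE (z : R) : 0 < z -> gamma_int z = (Gamma z)%:E.
Proof.
move=> z0.
have h : (gamma_int z = \int[leb]_(t in `]0%R, +oo[) (t `^ (z - 1) * expR (- t))%:E)%E.
  rewrite (@integral_expR_subst (fun t => t `^ (z - 1) * expR (- t)))//.
  - apply: eq_integral => x _; congr EFin.
    by rewrite -expRM mulrAC -!expRD; congr expR; ring.
  - move=> x x0; apply: continuousM.
      apply: differentiable_continuous; apply/derivable1_diffP.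
      by apply: derivable_powR; rewrite in_itv/= x0.
    by apply: continuous_comp; [exact: opp_continuous|exact: continuous_expR].
  - by move=> x x0; rewrite mulr_ge0 ?powR_ge0 ?expR_ge0.
by rewrite /Gamma /Rintegral -h fineK// ge0_fin_numE ?gamma_int_ge0// gamma_int_fin.
Qed.

Lemma Gamma_gt0 (z : R) : 0 < z -> 0 < Gamma z.
Proof. by move=> z0; rewrite -lte_fin -(GammaE z0) gamma_int_gt0. Qed.

(** Euler's Beta integral of [t^b (1 + t)^(-(s + b)) dt/t] at [t = expR r]. *)
Definition beta_int (s b : R) : \bar R :=
  (\int[leb]_r (expR (b * r - (s + b) * ln (1 + expR r)))%:E)%E.

Lemma beta_int_ge0 s b : (0 <= beta_int s b)%E.
Proof. by apply: integral_ge0 => x _; rewrite lee_fin expR_ge0. Qed.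

(* The substitution [y = x + r] turns [expR x + expR y] into [expR (x + ln (1 + expR r))]. *)
Lemma integral_expR_add (F : R -> \bar R) (s b : R) :
  measT F -> (forall x, 0 <= F x)%E ->
  (\int[leb]_x \int[leb]_y ((expR (s * x + b * y))%:E * F (expR x + expR y)%R) =
   beta_int s b * \int[leb]_x ((expR ((s + b) * x))%:E * F (expR x)))%E.
Proof.
move=> mF F0.
have c0 (r : R) : 0 < 1 + expR r by rewrite ltr_pwDl// expR_ge0.
pose I := (\int[leb]_x ((expR ((s + b) * x))%:E * F (expR x)))%E.
transitivity (\int[leb]_x \int[leb]_r ((expR (s * x + b * (r + x)))%:E *
    F (expR (x + ln (1 + expR r)))))%E.
  apply: eq_integral => x _.
  rewrite -[LHS](ge0_integral_shift x); last 2 first.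
  - apply: emeasurable_funM; first by meas.
    by apply: measurableT_comp => //; meas.
  - by move=> y; rewrite mule_ge0 ?lee_fin ?expR_ge0.
  apply: eq_integral => r _; congr (_ * F _)%E.
  by rewrite [RHS]expRD lnK ?posrE// expRD; ring.
rewrite (@fubini_tonelli _ _ _ _ _ leb leb (fun z => ((expR (s * z.1 + b * (z.2 + z.1)))%:E *
    F (expR (z.1 + ln (1 + expR z.2)))%R)%E))/=; last 2 first.
- apply: emeasurable_funM; first by meas.
  by apply: measurableT_comp => //; meas.
- by move=> z; rewrite mule_ge0 ?lee_fin ?expR_ge0.
transitivity (\int[leb]_r ((expR (b * r - (s + b) * ln (1 + expR r)))%:E * I))%E; last first.
  rewrite ge0_integralZr//=; first by meas.
  by apply: integral_ge0 => x _; rewrite mule_ge0 ?lee_fin ?expR_ge0.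
apply: eq_integral => r _.
rewrite -ge0_integralZlT ?expR_ge0//; last 2 first.
- by move=> x; rewrite mule_ge0 ?lee_fin ?expR_ge0.
- apply: emeasurable_funM; first by meas.
  by apply: measurableT_comp => //; meas.
rewrite -[RHS](ge0_integral_shift (ln (1 + expR r))); last 2 first.
- apply: emeasurable_funM => //; apply: emeasurable_funM; first by meas.
  by apply: measurableT_comp => //; meas.
- by move=> x; rewrite !mule_ge0 ?lee_fin ?expR_ge0.
apply: eq_integral => x _; rewrite muleA -EFinM -expRD; congr ((expR _)%:E * _)%E; ring.
Qed.

(** This is [integral_expR_add] for [F T = expR (- T)], which splits over the sum of the two
    scales. *)
Lemma gamma_intM s b : (gamma_int s * gamma_int b = beta_int s b * gamma_int (s + b))%E.
Proof.
have /= := @integral_expR_add (fun t => (expR (- t))%:E) s b _ _.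
move=> h.
rewrite {3}/gamma_int; under [in RHS]eq_integral do rewrite expRD EFinM.
rewrite -h; [|by meas|by move=> x; rewrite lee_fin expR_ge0].
rewrite /gamma_int -ge0_integralZr//=; last 2 first.
- by meas.
- exact: gamma_int_ge0.
apply: eq_integral => x _; rewrite -ge0_integralZlT//; last by meas.
apply: eq_integral => y _; rewrite -!EFinM -!expRD; congr (expR _)%:E; ring.
Qed.

Definition Beta (s b : R) : R := Gamma s * Gamma b / Gamma (s + b).

Lemma beta_intE s b : 0 < s -> 0 < b -> beta_int s b = (Beta s b)%:E.
Proof.
move=> s0 b0; have sb0 : 0 < s + b by rewrite addr_gt0.
have := gamma_intM s b; rewrite !GammaE// -EFinM.
have G0 := Gamma_gt0 sb0.
case: (beta_int s b) (beta_int_ge0 s b) => [r _|_|//].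
  by rewrite -EFinM => -[h]; congr EFin; rewrite /Beta h mulfK ?gt_eqF.
by rewrite gt0_mulye ?lte_fin.
Qed.

Lemma Beta_gt0 s b : 0 < s -> 0 < b -> 0 < Beta s b.
Proof. by move=> s0 b0; rewrite divr_gt0 ?mulr_gt0 ?Gamma_gt0 ?addr_gt0. Qed.

(** Strict Cauchy-Schwarz for the Beta integrals: [X - 2 * l * Z + l ^+ 2 * Y] is the integral of a
    square against a positive density, positive because the square is bounded below on an interval,
    and [l = Z / Y] is its minimizer. *)
Lemma Beta_strict_logconvex s b e : 0 < s -> 0 < e < b ->
  Beta s b ^+ 2 < Beta s (b - e) * Beta s (b + e).
Proof.
move=> s0 /andP[e0 eb].
have b0 : 0 < b by lra.
have b1 : 0 < b - e by lra.
have b2 : 0 < b + e by lra.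
set X := Beta s (b - e); set Y := Beta s (b + e); set Z := Beta s b.
have [X0 Y0 Z0] : [/\ 0 < X, 0 < Y & 0 < Z] by split; exact: Beta_gt0.
pose l := Z / Y; have l0 : 0 < l by rewrite divr_gt0.
suff : 2 * l * Z < X + l ^+ 2 * Y.
  have lY : l * Y = Z by rewrite /l divfK ?gt_eqF.
  have -> : l ^+ 2 * Y = l * Z by rewrite expr2 -mulrA lY.
  move=> h.
  have : l * Z < X by lra.
  by rewrite -(ltr_pM2r Y0) mulrAC lY -expr2.
pose c (r : R) := ln (1 + expR r).
pose D (b r : R) := expR (b * r - (s + b) * c r).
have c0 (r : R) : 0 < 1 + expR r by rewrite ltr_pwDl// expR_ge0.
have mc : measT c by rewrite /c; meas.
have mD a : measT (D a) by rewrite /D; meas.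
pose f r := D (b - e) r * (1 - l * expR (e * (r - c r))) ^+ 2.
have fE r : D (b - e) r + l ^+ 2 * D (b + e) r = 2 * l * D b r + f r.
  rewrite /f; set w := expR (e * (r - c r)).
  have -> : D (b + e) r = D (b - e) r * w ^+ 2.
    by rewrite /D /w -expRM_natr -expRD; congr expR; ring.
  have -> : D b r = D (b - e) r * w by rewrite /D /w -expRD; congr expR; ring.
  ring.
have f0 r : 0 <= f r by rewrite mulr_ge0 ?expR_ge0 ?sqr_ge0.
have mf : measT f by rewrite /f; meas.
have fpos : (0 < \int[leb]_r (f r)%:E)%E.
  (* For [r <= r0] the quantity [l * expR (e * r)] is at most 1/2, so the square is at least 1/4 on
     the unit interval ending at [r0]. *)
  pose r0 := ln ((2 * l)^-1) / e.
  pose m := (b - e) * (r0 - 1) - (s + (b - e)) * c r0.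
  apply: (@integral_gt0_itv _ (r0 - 1) (expR m / 4)) => //.
    by rewrite divr_gt0 ?expR_gt0.
  move=> r /andP[r1 r2].
  have rr0 : r <= r0 by lra.
  have cr : c r <= c r0 by rewrite ler_ln ?posrE// lerD2l ler_expR.
  rewrite /f ler_pM ?expR_ge0 ?invr_ge0//.
    rewrite /D ler_expR /m; apply: lerB; first by rewrite ler_wpM2l ?(ltW b1).
    by rewrite ler_wpM2l// ltW// addr_gt0.
  have cr0 : 0 <= c r by rewrite ln_ge0// lerDl expR_ge0.
  have : l * expR (e * (r - c r)) <= 1 / 2.
    apply: (@le_trans _ _ (l * expR (e * r0))).
      by rewrite ler_wpM2l ?(ltW l0)// ler_expR ler_wpM2l ?(ltW e0)//; lra.
    have -> : e * r0 = ln ((2 * l)^-1) by rewrite /r0 mulrC divfK ?gt_eqF.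
    have l20 : 0 < (2 * l)^-1 by rewrite invr_gt0 mulr_gt0.
    have -> : expR (ln ((2 * l)^-1)) = (2 * l)^-1 by rewrite lnK// posrE.
    have -> : (2 * l)^-1 = 2^-1 * l^-1 by rewrite invfM.
    by rewrite mulrCA divff ?gt_eqF//; lra.
  have := mulr_gt0 l0 (expR_gt0 (e * (r - c r))).
  by set y := l * _ => ? ?; rewrite expr2; nra.
have D0 a r : (0 <= (D a r)%:E)%E by rewrite lee_fin expR_ge0.
have : (\int[leb]_r ((D (b - e) r)%:E + (l ^+ 2)%:E * (D (b + e) r)%:E) =
  \int[leb]_r ((2 * l)%:E * (D b r)%:E + (f r)%:E))%E.
  by apply: eq_integral => r _; rewrite -!EFinM -!EFinD fE.
have [l0' ll0] : 0 <= 2 * l /\ 0 <= l ^+ 2 by rewrite sqr_ge0 mulr_ge0// ltW.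
rewrite !ge0_integralDT ?ge0_integralZlT//; try by meas.
2-3: by move=> x; rewrite mule_ge0// lee_fin.
rewrite -!/(beta_int _ _) !beta_intE// -/X -/Y -/Z => h.
rewrite -lte_fin EFinD 2!EFinM h lteDl//.
Qed.

End gamma.

(** * Gaussians on the line and their Fourier transform *)

Section gauss_R.
Context {R : realType}.
Local Notation leb := (@lebesgue_measure R).
Variable t : R.
Hypothesis t0 : 0 < t.

(** A rescaling of the normal density of mean [m] and variance [1 / (2 * t)], whose integral is
    1. *)
Lemma integral_gauss (m : R) :
  (\int[leb]_x (expR (- (t * (x - m) ^+ 2)))%:E = (Num.sqrt (pi / t))%:E)%E.
Proof.
pose s := Num.sqrt (2 * t)^-1.
have t2 : 0 < (2 * t)^-1 by rewrite invr_gt0 mulr_gt0.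
have s0 : s != 0 by rewrite gt_eqF// sqrtr_gt0.
have s2 : s ^+ 2 = (2 * t)^-1 by rewrite sqr_sqrtr ?ltW.
have := integral_normal_pdf m s.
have K : 0 < Num.sqrt (pi / t) by rewrite sqrtr_gt0 divr_gt0 ?pi_gt0.
under eq_integral => x _.
  rewrite normal_pdfE// /normal_peak s2 /normal_fun s2.
  rewrite (_ : (2 * t)^-1 * pi *+ 2 = pi / t); last first.
    by rewrite -mulr_natl; field; rewrite gt_eqF.
  rewrite (_ : - (x - m) ^+ 2 / ((2 * t)^-1 *+ 2) = - (t * (x - m) ^+ 2)); last first.
    by rewrite -mulr_natl; field; rewrite gt_eqF.
  rewrite EFinM; over.
rewrite ge0_integralZlT; last 3 first.
- by move=> x; rewrite lee_fin expR_ge0.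
- by meas.
- by rewrite invr_ge0 ltW.
case: (\int[leb]_x _)%E => [r|/=|/=].
- rewrite -EFinM => -[h]; congr EFin.
  have K1 : Num.sqrt (pi / t) != 0 by rewrite gt_eqF.
  by rewrite -[r](mulKf (invr_neq0 K1)) h mulr1 invrK.
- by rewrite gt0_muley ?lte_fin ?invr_gt0.
- by rewrite gt0_muleNy ?lte_fin ?invr_gt0.
Qed.

Lemma integral_gauss0 :
  (\int[leb]_x (expR (- (t * x ^+ 2)))%:E = (Num.sqrt (pi / t))%:E)%E.
Proof.
by rewrite -(integral_gauss 0); apply: eq_integral => x _; rewrite subr0.
Qed.

Lemma integrable_gauss : leb.-integrable setT (fun x => (expR (- (t * x ^+ 2)))%:E).
Proof.
apply/integrableP; split; first by meas.
under eq_integral => x _ do rewrite /= ger0_norm ?expR_ge0//.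
by rewrite integral_gauss0 ltry.
Qed.

End gauss_R.

Section gauss_fourier_R.
Context {R : realType}.
Local Notation leb := (@lebesgue_measure R).
Variable t : R.
Hypothesis t0 : 0 < t.

Let g x := expR (- (t * x ^+ 2)) : R.
Let G (x : R) := (1 + 2 / t) * expR (- (t / 2 * x ^+ 2)).

Let t20 : 0 < t / 2. Proof. by rewrite divr_gt0. Qed.

Let G_ge0 x : 0 <= G x.
Proof. by rewrite mulr_ge0 ?expR_ge0// addr_ge0// divr_ge0// ltW. Qed.

Let iG (K : R) : leb.-integrable setT (fun x => (K * G x)%:E).
Proof.
rewrite /G; under eq_fun do rewrite mulrA EFinM.
by apply: integrableZl => //; exact: integrable_gauss.
Qed.

(** Half of the exponent is spent on the factor [|x|], by [1 + y <= expR y] at [y = t / 2 * x ^+ 2].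
    The result is the majorant for differentiation under the integral sign. *)
Let gG x : (1 + `|x|) * g x <= 2 * G x.
Proof.
have gE : g x = expR (- (t / 2 * x ^+ 2)) * expR (- (t / 2 * x ^+ 2)).
  by rewrite -expRD /g; congr expR; field.
rewrite gE /G mulrA mulrA ler_wpM2r ?expR_ge0// expRN.
set y := t / 2 * x ^+ 2.
rewrite ler_pdivrMr ?expR_gt0//.
have h1 := expR_ge1Dx y.
have y0 : 0 <= y by rewrite mulr_ge0 ?sqr_ge0 ?ltW.
have h2 : x ^+ 2 = 2 / t * y by rewrite /y; field; rewrite gt_eqF.
have h3 : 2 * `|x| <= 1 + x ^+ 2.
  by rewrite -real_normK ?num_real//; have := sqr_ge0 (1 - `|x|); rewrite !expr2; nra.
have t2 : 0 < 2 / t by rewrite divr_gt0.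
apply: (@le_trans _ _ (2 * (1 + 2 / t) * (1 + y))); first by nra.
by rewrite ler_wpM2l//; nra.
Qed.

Let C z := \int[leb]_x (g x * cos (x * z)).
Let S z := \int[leb]_x (- (x * g x * sin (x * z))).

Let mul_norm1 (a b : R) : 0 <= a -> `|b| <= 1 -> `|a * b| <= a.
Proof. by move=> a0 b1; rewrite normrM ger0_norm// ler_piMr. Qed.

Let cos1 x : `|cos x : R| <= 1.
Proof. by rewrite ler_norml cos_geN1 cos_le1. Qed.
Let sin1 x : `|sin x : R| <= 1.
Proof. by rewrite ler_norml sin_geN1 sin_le1. Qed.

Let icos z : leb.-integrable setT (fun x => (g x * cos (x * z))%:E).
Proof.
apply: le_integrable (integrable_gauss t0) => //; first by rewrite /g; meas.
move=> x _ /=; rewrite lee_fin [leRHS]ger0_norm ?expR_ge0//.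
by rewrite mul_norm1 ?expR_ge0.
Qed.

Let bsin z x : `|- (x * g x * sin (x * z))| <= 2 * G x.
Proof.
rewrite normrN -mulrA mulrCA normrM ger0_norm ?expR_ge0// normrM.
apply: le_trans (gG x); rewrite mulrC ler_wpM2r ?expR_ge0//.
by rewrite (@le_trans _ _ `|x|) ?lerDr// ler_piMr.
Qed.

Let isin z : leb.-integrable setT (fun x => (- (x * g x * sin (x * z)))%:E).
Proof.
apply: le_integrable (iG 2) => //; first by rewrite /g; meas.
by move=> x _ /=; rewrite lee_fin (le_trans (bsin z x))// ler_norm.
Qed.

Let dC (z : R) : is_derive z (1 : R) C (S z).
Proof.
pose f (z x : R) : R := g x * cos (x * z).
have df (y x : R) : is_derive y (1 : R) (f ^~ x) (- (x * g x * sin (x * y))).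
  rewrite /f; have h : is_derive y (1 : R) (fun y : R => x * y) x.
    have := is_deriveZ x (is_derive_id y (1 : R)).
    by move/is_derive_eq; apply; rewrite /GRing.scale/= mulr1.
  have h2 := is_derive1_comp (is_derive_cos (x * y)) h.
  have := is_deriveZ (g x) h2.
  by move/is_derive_eq; apply; rewrite /GRing.scale/=; ring.
have h1 (x : R) : `](z - 1), (z + 1)[%classic x -> leb.-integrable setT (EFin \o f x).
  by move=> _; exact: icos.
have Iz : (`](z - 1), (z + 1)[%classic : set R) z by rewrite /= in_itv/=; apply/andP; split; lra.
have h2 (x y : R) : `](z - 1), (z + 1)[%classic x -> setT y -> derivable (f ^~ y) x 1.
  by move=> _ _; have [] := df x y.
have d1 x y : partial1of2 f x y = - (y * g y * sin (y * x)).
  by rewrite partial1of2E; have := df x y => h; rewrite derive_val.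
have h3 (x y : R) : `](z - 1), (z + 1)[%classic x -> setT y -> `|partial1of2 f x y| <= 2 * G y.
  by move=> _ _; rewrite d1.
have G0 y : 0 <= 2 * G y by rewrite mulr_ge0.
split.
  exact: (derivable_under_integral measurableT Iz h1 h2 G0 (iG 2) h3).
rewrite -derive1E (differentiation_under_integral measurableT Iz h1 h2 G0 (iG 2) h3).
by apply: eq_Rintegral => y _; exact: d1.
Qed.

(** The left side is the integral of the derivative of [g x * sin (x * z)], which vanishes at both
    infinities. Together with [C' = S] it is the differential equation satisfied by
    [expR (- (z ^+ 2 / (4 * t)))]. *)
Let SC z : 2 * t * S z + z * C z = 0.
Proof.
pose f x := g x * sin (x * z).
pose f' x := 2 * t * - (x * g x * sin (x * z)) + z * (g x * cos (x * z)).
have df (x : R) : is_derive x (1 : R) f (f' x).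
  have h : is_derive x (1 : R) (fun y : R => y * z) z.
    have := is_deriveM (is_derive_id x (1 : R)) (is_derive_cst (z : R) x (1 : R)).
    by move/is_derive_eq; apply; rewrite /GRing.scale/=; ring.
  have h2 := @is_derive1_comp R (@sin R) _ x _ _ (is_derive_sin (x * z)) h.
  have h3 : is_derive x (1 : R) (fun x : R => - (t * x ^+ 2)) (- (t * (2 * x))).
    have := is_deriveN (is_deriveZ t (is_deriveX 2 (is_derive_id x (1 : R)))).
    by move/is_derive_eq; apply; rewrite /GRing.scale/= expr1; ring.
  have h4 := @is_derive1_comp R expR (fun x : R => - (t * x ^+ 2)) x _ _ (is_derive_expR _) h3.
  have := is_deriveM h4 h2.
  by move/is_derive_eq; apply; rewrite /GRing.scale/= /f' /g; ring.
have if' : leb.-integrable setT (fun x => (f' x)%:E).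
  exact: (integrableRD (integrableRZ (2 * t) (isin z)) (integrableRZ z (icos z))).
have If' : \int[leb]_x f' x = 2 * t * S z + z * C z.
  rewrite /f' RintegralD//; [by rewrite (RintegralZl _ measurableT (isin z)) (RintegralZl _ measurableT (icos z))| exact: (integrableRZ (2 * t) (isin z))|exact: (integrableRZ z (icos z))].
rewrite -If'.
(* The successor keeps the interval nondegenerate at [n = 0], as [continuous_FTC2] requires, and
   gives [1 <= m] in the decay estimate below. *)
pose A n := `[(- n.+1%:R : R), n.+1%:R]%classic : set R.
have mA n : measurable (A n) by exact: measurable_itv.
have mf' : measT f' by apply/measurable_EFinP; exact: measurable_int if'.
have cvA : (\int[leb]_(x in A n) (f' x)%:E @[n --> \oo] --> \int[leb]_x (f' x)%:E)%E.
  under eq_fun do rewrite integral_mkcond/=.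
  have absf' : leb.-integrable setT (fun x => `|f' x|%:E) by exact: integrable_abse if'.
  apply: (@dominated_cvg _ _ _ leb setT measurableT (fun n => (EFin \o f') \_ (A n)) (EFin \o f') (fun x => `|f' x|%:E)) => //.
  - by move=> n; apply/(measurable_restrictT _ (mA n)); apply: measurable_funTS; exact/measurable_EFinP.
  - move=> x _; apply: cvg_near_cst; near=> n; rewrite patchE mem_set// /A/= in_itv/=.
    rewrite -ler_norml (@le_trans _ _ n%:R) ?ler_nat//.
    by near: n; exact: nbhs_infty_ger.
  - move=> n x _ ; rewrite patchE; case: ifPn => _ //=; by rewrite normr0 lee_fin.
have cf' x : {for x, continuous f'}.
  have cg : continuous g.
    move=> y; apply: continuous_comp; last exact: continuous_expR.
    apply: continuousN; apply: continuousM; first exact: cvg_cst.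
    exact: exprn_continuous.
  have cxz (y : R) : {for y, continuous (fun x : R => x * z)} by exact: mulrr_continuous.
  apply: continuousD; (apply: continuousM; first exact: cvg_cst).
    apply: continuousN; apply: continuousM.
      by apply: continuousM; [exact: cvg_id|exact: cg].
    by apply: continuous_comp; [exact: cxz|exact: continuous_sin].
  apply: continuousM; first exact: cg.
  by apply: continuous_comp; [exact: cxz|exact: continuous_cos].
have intA n : (\int[leb]_(x in A n) (f' x)%:E = (f n.+1%:R - f (- n.+1%:R))%:E)%E.
  rewrite /A (@continuous_FTC2 _ f' f) ?EFinB//.
  - by rewrite -subr_gt0 opprK addr_gt0.
  - apply: continuous_subspaceT => x; exact: cf'.
  - have cf x : {for x, continuous f}.
      by apply: differentiable_continuous; apply/derivable1_diffP; have [] := df x.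
    split => [x _||]; first by have [] := df x.
      exact: cvg_at_right_filter (cf _).
    exact: cvg_at_left_filter (cf _).
  - by move=> x _; rewrite derive1E; have := df x => h; exact: derive_val.
have cv0 : ((f n.+1%:R - f (- n.+1%:R))%:E @[n --> \oo] --> 0)%E.
  apply/fine_cvgP; split; first by near=> n.
  rewrite [X in X @ _](_ : _ = fun n : nat => f n.+1%:R - f (- n.+1%:R)); last by apply/funext.
  apply/norm_cvg0P; apply: (@squeeze_cvgr _ _ _ _ (cst 0) (fun n => 2 / t * harmonic n)).
  - near=> n; rewrite normr_ge0/= /f /g.
    rewrite sqrrN -mulrBr; set m : R := n.+1%:R.
    have m0 : 1 <= m by rewrite ler1n.
    have h : expR (- (t * m ^+ 2)) <= t^-1 * m^-1.
      rewrite -invfM expRN lef_pV2 ?posrE ?expR_gt0 ?mulr_gt0 ?(lt_le_trans _ m0)//.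
      have m1 : 0 <= t * m * (m - 1) by rewrite mulr_ge0 ?mulr_ge0 ?subr_ge0 ?(ltW t0)// (le_trans _ m0).
      have := expR_ge1Dx (t * m ^+ 2); have -> : t * m ^+ 2 = t * m * (m - 1) + t * m by ring.
      lra.
    have h2 : `|sin (m * z) - sin (- m * z)| <= 2.
      by rewrite (le_trans (ler_normB _ _))// (_ : 2 = 1 + 1)// lerD.
    rewrite normrM ger0_norm ?expR_ge0// mulrC -mulrA ler_pM ?expR_ge0//.
  - exact: cvg_cst.
  - by rewrite -[X in _ --> X](mulr0 (2 / t)); apply: cvgM; [exact: cvg_cst|exact: cvg_harmonic].
rewrite /Rintegral; move: cvA; under eq_fun do rewrite intA.
by move=> cvA; rewrite (cvg_unique _ cvA cv0).
Unshelve. all: by end_near.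
Qed.

Lemma integral_gauss_cos z :
  \int[leb]_x (expR (- (t * x ^+ 2)) * cos (x * z)) = Num.sqrt (pi / t) * expR (- (z ^+ 2 / (4 * t))).
Proof.
pose h y := C y * expR (y ^+ 2 / (4 * t)).
have : h z = h 0.
  apply: is_derive_0_is_cst => y.
  have h3 : is_derive y (1 : R) (fun x : R => x ^+ 2 / (4 * t)) (2 * y / (4 * t)).
    have := is_deriveM (is_deriveX 2 (is_derive_id y (1 : R))) (is_derive_cst ((4 * t)^-1 : R) y (1 : R)).
    by move/is_derive_eq; apply; rewrite /GRing.scale/= expr1; ring.
  have h4 := @is_derive1_comp R expR (fun x : R => x ^+ 2 / (4 * t)) y _ _ (is_derive_expR _) h3.
  have := is_deriveM (dC y) h4.
  move/is_derive_eq; apply; rewrite /GRing.scale/=.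
  have := SC y; set e := expR _ => hS.
  transitivity (e / (2 * t) * (2 * t * S y + y * C y)); last by rewrite hS mulr0.
  by field; rewrite gt_eqF.
rewrite /h expr0n/= mul0r expR0 mulr1.
have -> : C 0 = Num.sqrt (pi / t).
  rewrite /C /Rintegral; under eq_integral do rewrite mulr0 cos0 mulr1.
  by rewrite integral_gauss0.
by rewrite expRN => <-; rewrite mulfK ?gt_eqF ?expR_gt0.
Qed.

(** Oddness of the integrand; as [ge0_integral_opp] is for nonnegative functions, it is applied to
    the Gaussian times [1 + sin]. *)
Lemma integral_gauss_sin z : \int[leb]_x (expR (- (t * x ^+ 2)) * sin (x * z)) = 0.
Proof.
have aux (a b : R) : a - b = a + b -> b = 0 by lra.
pose f x := g x * (1 + sin (x * z)).
have if_ : leb.-integrable setT (fun x => (g x * sin (x * z))%:E).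
  apply: le_integrable (integrable_gauss t0) => //; first by rewrite /g; meas.
  move=> x _ /=; rewrite lee_fin [leRHS]ger0_norm ?expR_ge0//.
  by rewrite mul_norm1 ?expR_ge0.
have f0 x : (0 <= (f x)%:E)%E.
  by rewrite lee_fin mulr_ge0 ?expR_ge0//; have := sin_geN1 (x * z); lra.
have mf : measT (fun x => (f x)%:E) by rewrite /f /g; meas.
have h : \int[leb]_x f (- x) = \int[leb]_x f x.
  by rewrite /Rintegral (@ge0_integral_opp _ (EFin \o f)).
have i1 : leb.-integrable setT (fun x => (g x)%:E) by exact: integrable_gauss.
have h1 : \int[leb]_x f x = \int[leb]_x g x + \int[leb]_x (g x * sin (x * z)).
  by rewrite -RintegralD//; apply: eq_Rintegral => x _; rewrite /f mulrDr mulr1.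
have h2 : \int[leb]_x f (- x) = \int[leb]_x g x - \int[leb]_x (g x * sin (x * z)).
  rewrite -RintegralB//; apply: eq_Rintegral => x _.
  by rewrite /f mulNr sinN /g sqrrN mulrDr mulr1 mulrN.
by apply: (aux (\int[leb]_x g x)); rewrite -h1 -h2.
Qed.

End gauss_fourier_R.

(** * Integration over row vectors, one coordinate at a time *)

Section measurability_rV.
Context {R : realType} (n : nat) d (T : measurableType d).
Implicit Types f g : T -> 'rV[R]_n.

Lemma mf_sum (I : Type) (r : seq I) (h : I -> T -> R) :
  (forall i, measT (h i)) -> measT (fun x => \sum_(i <- r) h i x).
Proof. by move=> mh; exact: measurable_sum. Qed.

Lemma mf_coord f i : measT f -> measT (fun x => f x 0 i).
Proof. by move=> mf; exact: (measurableT_comp (@measurable_coord _ R n i) mf). Qed.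

Lemma mf_subv f g : measT f -> measT g ->
  measT (fun x => f x - g x).
Proof.
move=> mf mg; apply: measurable_fun_coord => i.
under eq_fun do rewrite !mxE.
by apply: measurable_funB; exact: mf_coord.
Qed.

Definition sqn (x : 'rV[R]_n) : R := \sum_i x 0 i ^+ 2.

Lemma mf_sqn f : measT f -> measT (fun x => sqn (f x)).
Proof. by move=> mf; apply: mf_sum => i; apply: mf_exp; exact: mf_coord. Qed.

Lemma mf_edot f g : measT f -> measT g ->
  measT (fun x => edot (f x) (g x)).
Proof. by move=> mf mg; apply: mf_sum => i; apply: mf_mul; exact: mf_coord. Qed.

Lemma sqn_ge0 x : 0 <= sqn x.
Proof. by apply: sumr_ge0 => i _; exact: sqr_ge0. Qed.

Lemma sqnN x : sqn (- x) = sqn x.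
Proof. by apply: eq_bigr => i _; rewrite mxE sqrrN. Qed.

Lemma enormE x : enorm x = Num.sqrt (sqn x). Proof. by []. Qed.

End measurability_rV.
Arguments sqn {R n} x.

Ltac measv := repeat (progress meas ||
  first [apply: mf_sqn | apply: mf_edot | apply: mf_subv]).

Section cons_rV_integral.
Context {R : realType} (n : nat).
Local Notation leb := (@lebesgue_measure R).

Lemma ge0_integral_rVS (f : 'rV[R]_n.+1 -> \bar R) : measT f ->
  (forall x, 0 <= f x)%E ->
  (\int[lebesgue_rV n.+1]_x f x = \int[leb]_a \int[lebesgue_rV n]_x f (cons_rV (a, x)))%E.
Proof.
move=> mf f0.
rewrite (@ge0_integral_pushforward _ _ _ _ _ _ (@measurable_cons_rV R n)
  (leb \x lebesgue_rV n)%E setT f)//.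
have mfc : measT (f \o @cons_rV R n) by apply: measurableT_comp => //; exact: measurable_cons_rV.
rewrite preimage_setT.
exact: (@fubini_tonelli1 _ _ _ _ _ leb (lebesgue_rV n) (f \o @cons_rV R n) mfc (fun z => f0 (cons_rV z))).
Qed.

Lemma Rintegral_rVS (f : 'rV[R]_n.+1 -> R) (g : R -> R) (k : 'rV[R]_n -> R) :
  measT f ->
  leb.-integrable setT (EFin \o g) ->
  (lebesgue_rV n).-integrable setT (EFin \o k) ->
  (forall a x, `|f (cons_rV (a, x))| <= g a * k x) ->
  \int[lebesgue_rV n.+1]_x f x = \int[leb]_a \int[lebesgue_rV n]_x f (cons_rV (a, x)).
Proof.
move=> mf ig ik fgk.
have mfc : measT (f \o @cons_rV R n) by apply: measurableT_comp => //; exact: measurable_cons_rV.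
have If := integrable_prod_dominated mfc ig ik fgk.
rewrite /Rintegral; congr fine.
have mfE : measT (EFin \o f) by exact/measurable_EFinP.
have ifE : (leb \x lebesgue_rV n)%E.-integrable (@cons_rV R n @^-1` setT) ((EFin \o f) \o @cons_rV R n).
  by rewrite preimage_setT.
rewrite (integral_pushforward (@measurable_cons_rV R n) mfE ifE measurableT) preimage_setT.
rewrite -integral12_prod_meas1//; apply: eq_integral => a _.
rewrite fineK// integrable_fin_num//.
apply: (integrable_dom (g := fun x => g a * k x)) => //; first exact: integrableRZ.
exact: measurable_fun_pair2 mfc.
Qed.

Definition tail_rV (x : 'rV[R]_n.+1) : 'rV[R]_n := \row_i x 0 (lift ord0 i).

Lemma sqn_rVS (x : 'rV[R]_n.+1) : sqn x = x 0 ord0 ^+ 2 + sqn (tail_rV x).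
Proof. by rewrite /sqn big_ord_recl; congr (_ + _); apply: eq_bigr => i _; rewrite mxE. Qed.

Lemma sqn_cons a (x : 'rV[R]_n) : sqn (cons_rV (a, x)) = a ^+ 2 + sqn x.
Proof.
rewrite sqn_rVS cons_rV0; congr (_ + sqn _).
by apply/rowP => i; rewrite mxE cons_rVS.
Qed.

Lemma sqn_consB a (x : 'rV[R]_n) (m : 'rV[R]_n.+1) :
  sqn (cons_rV (a, x) - m) = (a - m 0 ord0) ^+ 2 + sqn (x - tail_rV m).
Proof.
rewrite sqn_rVS !mxE unlift_none; congr (_ + sqn _).
by apply/rowP => i; rewrite !mxE liftK.
Qed.

Lemma edot_cons a (x : 'rV[R]_n) (z : 'rV[R]_n.+1) :
  edot (cons_rV (a, x)) z = a * z 0 ord0 + edot x (tail_rV z).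
Proof.
rewrite /edot big_ord_recl cons_rV0; congr (_ + _).
by apply: eq_bigr => i _; rewrite cons_rVS mxE.
Qed.

End cons_rV_integral.

Section gauss_rV.
Context {R : realType}.
Local Notation leb := (@lebesgue_measure R).

Lemma powR_half_S (x : R) (n : nat) : 0 < x -> x `^ (n.+1%:R / 2) = Num.sqrt x * x `^ (n%:R / 2).
Proof.
move=> x0; rewrite -powR12_sqrt ?ltW// -powRD; last by rewrite (gt_eqF x0) implybT.
by congr (_ `^ _); rewrite -natr1; field.
Qed.

Lemma integral_gauss_rV n (t : R) (m : 'rV[R]_n) : 0 < t ->
  (\int[lebesgue_rV n]_x (expR (- (t * sqn (x - m))))%:E = ((pi / t) `^ (n%:R / 2))%:E)%E.
Proof.
move=> t0; elim: n m => [|n IHn] m.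
  rewrite integral_dirac//=; last by measv.
  by rewrite diracT mul1e /sqn big_ord0 mulr0 oppr0 expR0 mul0r powRr0.
rewrite ge0_integral_rVS; [|by measv|by move=> x; rewrite lee_fin expR_ge0].
under eq_integral => a _.
  under eq_integral => x _ do rewrite sqn_consB mulrDr opprD expRD EFinM.
  rewrite ge0_integralZlT ?expR_ge0//; [|by measv].
  rewrite IHn muleC; over.
rewrite ge0_integralZlT ?powR_ge0//; [|by measv].
by rewrite integral_gauss// -EFinM powR_half_S ?divr_gt0 ?pi_gt0// mulrC.
Qed.

Lemma integral_gauss_rV0 n (t : R) : 0 < t ->
  (\int[lebesgue_rV n]_x (expR (- (t * sqn x)))%:E = ((pi / t) `^ (n%:R / 2))%:E)%E.
Proof.
move=> t0; rewrite -(@integral_gauss_rV n t 0)//.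
by apply: eq_integral => x _; rewrite subr0.
Qed.

Lemma integrable_gauss_rV n (t : R) (m : 'rV[R]_n) : 0 < t ->
  (lebesgue_rV n).-integrable setT (fun x => (expR (- (t * sqn (x - m))))%:E).
Proof.
move=> t0; apply/integrableP; split; first by measv.
under eq_integral => x _ do rewrite /= ger0_norm ?expR_ge0//.
by rewrite integral_gauss_rV// ltry.
Qed.

Lemma integrable_gauss_rV0 n (t : R) : 0 < t ->
  (lebesgue_rV n).-integrable setT (fun x : 'rV[R]_n => (expR (- (t * sqn x)))%:E).
Proof.
move=> t0; apply: eq_integrable (integrable_gauss_rV 0 t0) => // x _.
by rewrite subr0.
Qed.

Lemma Rintegral_rV0 (f : 'rV[R]_0 -> R) : measT f ->
  \int[lebesgue_rV 0]_x f x = f 0.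
Proof.
move=> mf; rewrite /Rintegral (_ : (\int[_]_x _)%E = (f 0)%:E)//.
rewrite integral_dirac//=; last exact/measurable_EFinP.
by rewrite diracT mul1e.
Qed.

(** Cosine and sine are treated in one induction because the addition formulas that split off a
    coordinate mix them; every term containing a sine integrates to 0. *)
Lemma integral_gauss_trig n (t : R) (z : 'rV[R]_n) : 0 < t ->
  \int[lebesgue_rV n]_x (expR (- (t * sqn x)) * cos (edot x z)) =
    (pi / t) `^ (n%:R / 2) * expR (- (sqn z / (4 * t))) /\
  \int[lebesgue_rV n]_x (expR (- (t * sqn x)) * sin (edot x z)) = 0.
Proof.
move=> t0; elim: n z => [|n IHn] z.
  rewrite !Rintegral_rV0; [|by measv..].
  by rewrite /sqn /edot !big_ord0 !(mulr0, oppr0, mul0r, expR0, powRr0, cos0, sin0).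
have [IHc IHs] := IHn (tail_rV z).
have icos1 (y : R) : `|cos y| <= 1 by rewrite ler_norml cos_geN1 cos_le1.
have isin1 (y : R) : `|sin y| <= 1 by rewrite ler_norml sin_geN1 sin_le1.
have b1 (a b : R) : 0 <= a -> `|b| <= 1 -> `|a * b| <= a.
  by move=> a0 bb; rewrite normrM ger0_norm// ler_piMr.
have e0 (y : R) : 0 <= expR y by exact: expR_ge0.
pose E (x : 'rV[R]_n) := expR (- (t * sqn x)).
have iE : (lebesgue_rV n).-integrable setT (fun x => (E x)%:E) by exact: integrable_gauss_rV0.
have ic : (lebesgue_rV n).-integrable setT (fun x => (E x * cos (edot x (tail_rV z)))%:E).
  by apply: (integrable_dom iE); [rewrite /E; measv|move=> x; exact: (b1 _ _ (e0 _) (icos1 _))].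
have is_ : (lebesgue_rV n).-integrable setT (fun x => (E x * sin (edot x (tail_rV z)))%:E).
  by apply: (integrable_dom iE); [rewrite /E; measv|move=> x; exact: (b1 _ _ (e0 _) (isin1 _))].
have ie := integrable_gauss t0.
have ic1 : leb.-integrable setT (fun a => (expR (- (t * a ^+ 2)) * cos (a * z 0 ord0))%:E).
  by apply: (integrable_dom ie); [meas|move=> x; exact: (b1 _ _ (e0 _) (icos1 _))].
have is1 : leb.-integrable setT (fun a => (expR (- (t * a ^+ 2)) * sin (a * z 0 ord0))%:E).
  by apply: (integrable_dom ie); [meas|move=> x; exact: (b1 _ _ (e0 _) (isin1 _))].
split.
- rewrite (Rintegral_rVS (g := fun a => expR (- (t * a ^+ 2))) (k := E))//; last 2 first.
  + by measv.
  + move=> a x; rewrite sqn_cons mulrDr opprD -expRD; exact: (b1 _ _ (e0 _) (icos1 _)).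
  transitivity (\int[leb]_a (expR (- (t * a ^+ 2)) * cos (a * z 0 ord0) *
     ((pi / t) `^ (n%:R / 2) * expR (- (sqn (tail_rV z) / (4 * t)))))).
    apply: eq_Rintegral => a _; rewrite -IHc.
    transitivity (\int[lebesgue_rV n]_x
      (expR (- (t * a ^+ 2)) * cos (a * z 0 ord0) * (E x * cos (edot x (tail_rV z))) -
       expR (- (t * a ^+ 2)) * sin (a * z 0 ord0) * (E x * sin (edot x (tail_rV z))))).
      apply: eq_Rintegral => x _; rewrite sqn_cons edot_cons mulrDr opprD expRD cosD /E; ring.
    rewrite RintegralB//; [|exact: integrableRZ|exact: integrableRZ].
    by rewrite !RintegralZl// IHs mulr0 subr0.
  rewrite RintegralZr// integral_gauss_cos// powR_half_S ?divr_gt0 ?pi_gt0//.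
  have -> : - (sqn z / (4 * t)) = - (z 0 ord0 ^+ 2 / (4 * t)) + - (sqn (tail_rV z) / (4 * t)).
    by rewrite (sqn_rVS z) mulrDl opprD.
  by rewrite expRD mulrACA.
- rewrite (Rintegral_rVS (g := fun a => expR (- (t * a ^+ 2))) (k := E))//; last 2 first.
  + by measv.
  + move=> a x; rewrite sqn_cons mulrDr opprD -expRD; exact: (b1 _ _ (e0 _) (isin1 _)).
  transitivity (\int[leb]_a (expR (- (t * a ^+ 2)) * sin (a * z 0 ord0) *
     ((pi / t) `^ (n%:R / 2) * expR (- (sqn (tail_rV z) / (4 * t)))))).
    apply: eq_Rintegral => a _; rewrite -IHc.
    transitivity (\int[lebesgue_rV n]_x
      (expR (- (t * a ^+ 2)) * sin (a * z 0 ord0) * (E x * cos (edot x (tail_rV z))) +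
       expR (- (t * a ^+ 2)) * cos (a * z 0 ord0) * (E x * sin (edot x (tail_rV z))))).
      apply: eq_Rintegral => x _; rewrite sqn_cons edot_cons mulrDr opprD expRD sinD /E; ring.
    rewrite RintegralD//; [|exact: integrableRZ|exact: integrableRZ].
    by rewrite !RintegralZl// IHs mulr0 addr0.
  by rewrite RintegralZr// integral_gauss_sin// mul0r.
Qed.

End gauss_rV.

(** * The heat kernel and its semigroup law *)

Section heat_kernel.
Context {R : realType} (n : nat).
Local Notation mu := (@lebesgue_rV R n).

Definition hk (t : R) (z : 'rV[R]_n) : R :=
  (4 * pi * t) `^ (- (n%:R / 2)) * expR (- (sqn z / (4 * t))).

Lemma hk_ge0 t z : 0 <= hk t z.
Proof. by rewrite mulr_ge0 ?powR_ge0 ?expR_ge0. Qed.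

Lemma hkN t z : hk t (- z) = hk t z. Proof. by rewrite /hk sqnN. Qed.

Lemma hkB t x y : hk t (x - y) = hk t (y - x). Proof. by rewrite -hkN opprB. Qed.

Lemma integral_hk t x : 0 < t -> (\int[mu]_y (hk t (y - x))%:E = 1)%E.
Proof.
move=> t0; have t4 : 0 < (4 * t)^-1 by rewrite invr_gt0 mulr_gt0.
rewrite /hk; under eq_integral do rewrite mulrC (mulrC (sqn _)) EFinM.
rewrite ge0_integralZrT ?powR_ge0//; [|by measv].
have X0 : 0 < 4 * pi * t by rewrite !mulr_gt0 ?pi_gt0.
rewrite integral_gauss_rV// -EFinM (_ : pi / (4 * t)^-1 = 4 * pi * t); last by rewrite invrK; ring.
rewrite -powRD; last by rewrite (gt_eqF X0) implybT.
by rewrite subrr powRr0.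
Qed.

(* Completing the square in the exponent. *)
Lemma integral_hkM t r (x : 'rV[R]_n) : 0 < t -> 0 < r ->
  (\int[mu]_y (hk t (x - y) * hk r y)%:E = (hk (t + r) x)%:E)%E.
Proof.
move=> t0 r0; have tr : 0 < t + r by rewrite addr_gt0.
pose k := (t + r) / (4 * t * r).
have k0 : 0 < k by rewrite divr_gt0 ?mulr_gt0.
pose c := r / (t + r).
have sq (y : 'rV[R]_n) : sqn (x - y) / (4 * t) + sqn y / (4 * r) =
    sqn x / (4 * (t + r)) + k * sqn (y - c *: x).
  rewrite /sqn !mulr_suml mulr_sumr -!big_split/=; apply: eq_bigr => i _.
  rewrite !mxE /k /c; field.
  by rewrite !gt_eqF.
pose A := (4 * pi * t) `^ (- (n%:R / 2)) * (4 * pi * r) `^ (- (n%:R / 2)) * expR (- (sqn x / (4 * (t + r)))).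
have A0 : 0 <= A by rewrite !mulr_ge0 ?powR_ge0 ?expR_ge0.
transitivity (\int[mu]_y (A%:E * (expR (- (k * sqn (y - c *: x))))%:E))%E.
  apply: eq_integral => y _; rewrite -EFinM; congr EFin.
  by rewrite /hk mulrACA -expRD -opprD sq opprD expRD mulrA.
rewrite ge0_integralZlT//; [|by measv].
rewrite integral_gauss_rV// -EFinM; congr EFin.
rewrite /A /hk mulrAC; congr (_ * _).
have p0 := @pi_gt0 R.
rewrite -powRM ?mulr_ge0 ?ltW//.
have -> : pi / k = (4 * pi * t) * (4 * pi * r) / (4 * pi * (t + r)).
  rewrite /k; move: (pi) p0 => p p0.
  by field; rewrite !gt_eqF.
set X := (4 * pi * t) * _; set Y := 4 * pi * (t + r).
have X0 : 0 < X by rewrite !mulr_gt0.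
have Y0 : 0 < Y by rewrite !mulr_gt0.
rewrite powRM ?(ltW X0) ?invr_ge0 ?(ltW Y0)// mulrA -powRD; last by rewrite (gt_eqF X0) implybT.
by rewrite addrC subrr powRr0 mul1r -(powR_inv1 (ltW Y0)) -powRrM mulN1r.
Qed.

End heat_kernel.

(** * The Fourier transform against Gaussians *)

Section trig.
Context {R : realType}.

Lemma cos_norm_le1 (x : R) : `|cos x| <= 1.
Proof. by rewrite ler_norml cos_geN1 cos_le1. Qed.

Lemma sin_norm_le1 (x : R) : `|sin x| <= 1.
Proof. by rewrite ler_norml sin_geN1 sin_le1. Qed.

Lemma norm_trig_le (a b x : R) : `|a * cos x + b * sin x| <= `|a| + `|b|.
Proof.
rewrite (le_trans (ler_normD _ _))// !normrM lerD// ler_piMr//.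
  exact: cos_norm_le1.
exact: sin_norm_le1.
Qed.

End trig.

Section edot_theory.
Context {R : realType} (n : nat).
Implicit Types x y z : 'rV[R]_n.

Lemma edotC x y : edot x y = edot y x.
Proof. by apply: eq_bigr => i _; rewrite mulrC. Qed.

Lemma edotBr x y z : edot x (y - z) = edot x y - edot x z.
Proof. by rewrite /edot -sumrB; apply: eq_bigr => i _; rewrite !mxE mulrBr. Qed.

End edot_theory.

Section trig_transform.
Context {R : realType} (n : nat).
Local Notation mu := (@lebesgue_rV R n).
Local Notation int f := (mu.-integrable setT (fun x => (f x)%:E)).

(* For [u = a + i b], the real part of the unnormalized Fourier transform of [u] is
   [ftc a b] and its imaginary part is [ftc b (- a)]. *)
Definition ftc (a b : 'rV[R]_n -> R) (xi : 'rV[R]_n) : R :=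
  \int[mu]_x (a x * cos (edot xi x) + b x * sin (edot xi x)).

(* The Fourier transform of [expR (- t |xi|^2)], without normalization. *)
Definition gk (t : R) (z : 'rV[R]_n) : R :=
  (pi / t) `^ (n%:R / 2) * expR (- (sqn z / (4 * t))).

Lemma gk_ge0 t z : 0 <= gk t z.
Proof. by rewrite mulr_ge0 ?powR_ge0 ?expR_ge0. Qed.

Lemma gkE t z : 0 < t -> gk t z = (2 * pi) ^+ n * hk t z.
Proof.
move=> t0; rewrite /gk /hk mulrA; congr (_ * _).
have p0 := @pi_gt0 R.
have p2 : 0 < 2 * pi :> R by rewrite mulr_gt0.
have X0 : 0 < 4 * pi * t by rewrite !mulr_gt0.
have -> : pi / t = (2 * pi) ^+ 2 * (4 * pi * t)^-1.
  by rewrite expr2; move: (pi) p0 => p p0; field; rewrite !gt_eqF.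
rewrite powRM ?exprn_ge0 ?invr_ge0 ?(ltW p2) ?(ltW X0)//; congr (_ * _).
  by rewrite -!powR_mulrn ?(ltW p2)// -powRrM; congr (_ `^ _); field.
by rewrite -(powR_inv1 (ltW X0)) -powRrM mulN1r.
Qed.

Lemma integrable_ftc a b xi : int a -> int b ->
  int (fun x => a x * cos (edot xi x) + b x * sin (edot xi x)).
Proof.
move=> ia ib; have ma := integrable_mf ia; have mb := integrable_mf ib.
apply: (integrable_dom (g := fun x => `|a x| + `|b x|)).
- by apply: integrableRD; exact: integrable_abs.
- by measv.
- by move=> x; exact: norm_trig_le.
Qed.

Lemma ftc_le a b xi : int a -> int b ->
  `|ftc a b xi| <= \int[mu]_x (`|a x| + `|b x|).
Proof.
move=> ia ib.
rewrite (le_trans (le_normr_Rintegral _ _))//; first exact: integrable_ftc.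
apply: le_Rintegral => //.
- by apply: integrable_abs; exact: integrable_ftc.
- by apply: integrableRD; exact: integrable_abs.
- by move=> x _; exact: norm_trig_le.
Qed.

Lemma integrable_gauss_ftc t a b : 0 < t -> int a -> int b ->
  int (fun xi => expR (- (t * sqn xi)) * ftc a b xi).
Proof.
move=> t0 ia ib; have ma := integrable_mf ia; have mb := integrable_mf ib.
have := @integrable_Rintegral2 _ _ _ _ R mu mu
  (fun z => expR (- (t * sqn z.1)) * (a z.2 * cos (edot z.1 z.2) + b z.2 * sin (edot z.1 z.2)))
  (fun xi => expR (- (t * sqn xi))) (fun x => `|a x| + `|b x|).
have ma2 : measT (fun z : 'rV[R]_n * 'rV[R]_n => a z.2) by apply: measurableT_comp.
have mb2 : measT (fun z : 'rV[R]_n * 'rV[R]_n => b z.2) by apply: measurableT_comp.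
move=> /(_ _ (integrable_gauss_rV0 _ t0) (integrableRD (integrable_abs ia) (integrable_abs ib)))/= H.
apply: eq_integrable (H _ _) => //=.
- by move=> xi _; rewrite RintegralZl//; exact: integrable_ftc.
- by measv.
- by move=> x y; rewrite normrM ger0_norm ?expR_ge0// ler_wpM2l ?expR_ge0// norm_trig_le.
Qed.

(** After multiplication by a Gaussian in [xi] the double integrand is integrable, so Fubini yields
    an integrable, hence measurable, function of [xi]; the Gaussian is then divided out. *)
Lemma mf_ftc a b : int a -> int b -> measT (ftc a b).
Proof.
move=> ia ib; have := integrable_mf (integrable_gauss_ftc ltr01 ia ib) => h.
rewrite (_ : ftc a b = fun xi => expR (sqn xi) * (expR (- (1 * sqn xi)) * ftc a b xi)).
  by apply: mf_mul => //; measv.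
by apply/funext => xi; rewrite mulrA -expRD mul1r subrr expR0 mul1r.
Qed.

Lemma ftcN a b xi : int a -> int b ->
  ftc (fun x => - a x) (fun x => - b x) xi = - ftc a b xi.
Proof.
move=> ia ib; rewrite -mulN1r /ftc -RintegralZl//; last exact: integrable_ftc.
by apply: eq_Rintegral => x _; ring.
Qed.

(** Real part of the inversion of the damped transform. After Fubini the frequency integral is the
    Gaussian cosine integral, and its sine part vanishes. No power of [2 * pi] is divided out, so
    [gk] appears rather than [hk]. *)
Lemma ftc_gauss_inversion t a b z : 0 < t -> int a -> int b ->
  \int[mu]_xi (expR (- (t * sqn xi)) * (ftc a b xi * cos (edot xi z) - ftc b (fun x => - a x) xi * sin (edot xi z)))
  = \int[mu]_y (a y * gk t (z - y)).
Proof.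
move=> t0 ia ib; have ma := integrable_mf ia; have mb := integrable_mf ib.
have iNa : int (fun x => - a x) by under eq_fun do rewrite -mulN1r; exact: integrableRZ.
pose f (u : 'rV[R]_n * 'rV[R]_n) := expR (- (t * sqn u.1)) *
  (a u.2 * cos (edot u.1 (z - u.2)) + - b u.2 * sin (edot u.1 (z - u.2))).
have ma2 : measT (fun z : 'rV[R]_n * 'rV[R]_n => a z.2) by apply: measurableT_comp.
have mb2 : measT (fun z : 'rV[R]_n * 'rV[R]_n => b z.2) by apply: measurableT_comp.
have mf : measT f by rewrite /f; measv.
have fb (x y : 'rV[R]_n) : `|f (x, y)| <= expR (- (t * sqn x)) * (`|a y| + `|b y|).
  rewrite /f/= normrM ger0_norm ?expR_ge0// ler_wpM2l ?expR_ge0//.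
  by rewrite (le_trans (norm_trig_le _ _ _))// normrN.
have ig := @integrable_gauss_rV0 R n t t0.
transitivity (\int[mu]_xi \int[mu]_y f (xi, y)).
  apply: eq_Rintegral => xi _.
  transitivity (\int[mu]_y (expR (- (t * sqn xi)) * cos (edot xi z) * (a y * cos (edot xi y) + b y * sin (edot xi y)) -
     expR (- (t * sqn xi)) * sin (edot xi z) * (b y * cos (edot xi y) + - a y * sin (edot xi y)))).
    rewrite RintegralB//; [|apply: integrableRZ; exact: integrable_ftc|apply: integrableRZ; exact: integrable_ftc].
    rewrite !RintegralZl//; [|exact: integrable_ftc|exact: integrable_ftc].
    by rewrite /ftc; ring.
  apply: eq_Rintegral => y _; rewrite /f/= edotBr cosB sinB; ring.
rewrite (Rintegral_fubini mf ig (integrableRD (integrable_abs ia) (integrable_abs ib)) fb).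
apply: eq_Rintegral => y _; rewrite /f/=.
have [hc hs] := integral_gauss_trig (z - y) t0.
rewrite /gk -hc.
transitivity (\int[mu]_x (a y * (expR (- (t * sqn x)) * cos (edot x (z - y))) +
   - b y * (expR (- (t * sqn x)) * sin (edot x (z - y))))).
  by apply: eq_Rintegral => x _; ring.
have [ic is_] : int (fun x => expR (- (t * sqn x)) * cos (edot x (z - y))) /\
     int (fun x => expR (- (t * sqn x)) * sin (edot x (z - y))).
  split; apply: (integrable_dom ig); [by measv| |by measv|].
    by move=> x; rewrite normrM ger0_norm ?expR_ge0// ler_piMr ?expR_ge0// cos_norm_le1.
  by move=> x; rewrite normrM ger0_norm ?expR_ge0// ler_piMr ?expR_ge0// sin_norm_le1.
rewrite RintegralD//; [|exact: integrableRZ|exact: integrableRZ].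
by rewrite !RintegralZl// hs mulr0 addr0.
Qed.

End trig_transform.

(** * Quadratic forms with a Gaussian kernel *)

Lemma cauchy2 (R : realDomainType) (x1 x2 y1 y2 : R) :
  (x1 * y1 + x2 * y2) ^+ 2 <= (x1 ^+ 2 + x2 ^+ 2) * (y1 ^+ 2 + y2 ^+ 2).
Proof.
rewrite -subr_ge0 (_ : _ - _ = (x1 * y2 - x2 * y1) ^+ 2) ?sqr_ge0//; ring.
Qed.

Section gauss_form.
Context {R : realType} (n : nat).
Local Notation mu := (@lebesgue_rV R n).
Local Notation int f := (mu.-integrable setT (fun x => (f x)%:E)).

(** The heat flow of [a] at time [t] multiplied by [(2 * pi) ^+ n] (see [gconv_hconv]), which is
    what unnormalized inversion produces. *)
Definition gconv (t : R) (a : 'rV[R]_n -> R) (z : 'rV[R]_n) : R :=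
  \int[mu]_y (a y * gk t (z - y)).

(* [(2 pi)^n |u^|^2] for [u = a + i b]. *)
Definition ftsq (a b : 'rV[R]_n -> R) (xi : 'rV[R]_n) : R :=
  ftc a b xi ^+ 2 + ftc b (fun x => - a x) xi ^+ 2.

Lemma ftsq_ge0 a b xi : 0 <= ftsq a b xi.
Proof. by rewrite addr_ge0 ?sqr_ge0. Qed.

Lemma integrableRN a : int a -> int (fun x => - a x).
Proof. by move=> ia; under eq_fun do rewrite -mulN1r; exact: integrableRZ. Qed.

Lemma mf_ftsq a b : int a -> int b -> measT (ftsq a b).
Proof. by move=> ia ib; apply: mf_add; apply: mf_exp; apply: mf_ftc => //; exact: integrableRN. Qed.

Lemma integrable_gauss_mul t (h : 'rV[R]_n -> R) (C : R) : 0 < t -> measT h ->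
  (forall x, `|h x| <= C) -> int (fun x => expR (- (t * sqn x)) * h x).
Proof.
move=> t0 mh hC; apply: (integrable_dom (integrableRZ C (integrable_gauss_rV0 n t0))); first by measv.
by move=> x; rewrite normrM ger0_norm ?expR_ge0// mulrC ler_wpM2r ?expR_ge0.
Qed.

Lemma ftsq_bounded a b : int a -> int b -> exists C, forall xi, ftsq a b xi <= C.
Proof.
move=> ia ib.
exists ((\int[mu]_x (`|a x| + `|b x|)) ^+ 2 + (\int[mu]_x (`|b x| + `|- a x|)) ^+ 2) => xi.
have sq (x y : R) : `|x| <= y -> x ^+ 2 <= y ^+ 2.
  by move=> h; rewrite -real_normK ?num_real// lerXn2r ?nnegrE ?(le_trans _ h).
by rewrite lerD// sq// ftc_le//; exact: integrableRN.
Qed.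

Lemma gk_le t (z : 'rV[R]_n) : 0 < t -> gk t z <= (pi / t) `^ (n%:R / 2).
Proof.
move=> t0; rewrite /gk ler_piMr ?powR_ge0// -expR0 ler_expR oppr_le0.
by rewrite divr_ge0 ?sqn_ge0// mulr_ge0// ltW.
Qed.

Lemma integrable_gconv t a z : 0 < t -> int a -> int (fun y => a y * gk t (z - y)).
Proof.
move=> t0 ia; have ma := integrable_mf ia.
apply: (integrable_dom (integrableRZ ((pi / t) `^ (n%:R / 2)) (integrable_abs ia))); first by rewrite /gk; measv.
by move=> y; rewrite normrM (ger0_norm (gk_ge0 _ _)) mulrC ler_wpM2r// gk_le.
Qed.

(** The device of [mf_ftc]: integrability after a Gaussian factor, which is then divided out. *)
Lemma mf_gconv t a : 0 < t -> int a -> measT (gconv t a).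
Proof.
move=> t0 ia; have ma := integrable_mf ia.
have ma2 : measT (fun z : 'rV[R]_n * 'rV[R]_n => a z.2) by apply: measurableT_comp.
have := @integrable_Rintegral2 _ _ _ _ R mu mu
  (fun z => expR (- (1 * sqn z.1)) * (a z.2 * gk t (z.1 - z.2)))
  (fun x => expR (- (1 * sqn x))) (fun y => (pi / t) `^ (n%:R / 2) * `|a y|).
move=> /(_ _ (integrable_gauss_rV0 _ ltr01) (integrableRZ _ (integrable_abs ia)))/= H.
have {}H : int (fun x => expR (- (1 * sqn x)) * gconv t a x).
  apply: eq_integrable (H _ _) => //=.
  - by move=> x _; rewrite RintegralZl//; exact: integrable_gconv.
  - by rewrite /gk; measv.
  - move=> x y; rewrite normrM ger0_norm ?expR_ge0// ler_wpM2l ?expR_ge0//.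
    by rewrite normrM (ger0_norm (gk_ge0 _ _)) mulrC ler_wpM2r// gk_le.
rewrite (_ : gconv t a = fun x => expR (sqn x) * (expR (- (1 * sqn x)) * gconv t a x)).
  by apply: mf_mul; [measv|exact: integrable_mf H].
by apply/funext => x; rewrite mulrA -expRD mul1r subrr expR0 mul1r.
Qed.

Lemma integrable_gauss_ftsq t a b : 0 < t -> int a -> int b ->
  int (fun xi => expR (- (t * sqn xi)) * ftsq a b xi).
Proof.
move=> t0 ia ib; have [C hC] := ftsq_bounded ia ib.
apply: (integrable_gauss_mul (C := C)) => //; first exact: mf_ftsq.
by move=> x; rewrite ger0_norm ?ftsq_ge0.
Qed.

(** The real inversion formula applied to [- i u], that is to the pair [b], [- a]. *)
Lemma ftc_gauss_inversion2 t a b z : 0 < t -> int a -> int b ->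
  \int[mu]_xi (expR (- (t * sqn xi)) * (ftc a b xi * sin (edot xi z) + ftc b (fun x => - a x) xi * cos (edot xi z)))
  = gconv t b z.
Proof.
move=> t0 ia ib; rewrite /gconv -(ftc_gauss_inversion z t0 ib (integrableRN ia)).
by apply: eq_Rintegral => xi _; rewrite ftcN//; ring.
Qed.

(** One factor of |u^|^2 is written as an integral over [x]; exchanging the integrals leaves the
    inverted damped transform of the other factor. *)
Lemma gauss_ftsq t a b : 0 < t -> int a -> int b ->
  \int[mu]_xi (expR (- (t * sqn xi)) * ftsq a b xi) =
  \int[mu]_x (a x * gconv t a x + b x * gconv t b x).
Proof.
move=> t0 ia ib; have ma := integrable_mf ia; have mb := integrable_mf ib.
have iNa := integrableRN ia.
pose P := ftc a b; pose Q := ftc b (fun x => - a x).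
have mP : measT P by exact: mf_ftc.
have mQ : measT Q by exact: mf_ftc.
pose K := \int[mu]_x (`|a x| + `|b x|) + \int[mu]_x (`|b x| + `|- a x|).
have PQ xi : `|P xi| + `|Q xi| <= K by rewrite lerD// ftc_le.
pose f (u : 'rV[R]_n * 'rV[R]_n) := expR (- (t * sqn u.1)) *
  (a u.2 * (P u.1 * cos (edot u.1 u.2) + - Q u.1 * sin (edot u.1 u.2)) +
   b u.2 * (Q u.1 * cos (edot u.1 u.2) + P u.1 * sin (edot u.1 u.2))).
have m1 (h : 'rV[R]_n -> R) : measT h ->
    measT (fun z : 'rV[R]_n * 'rV[R]_n => h z.1) by move=> mh; apply: measurableT_comp.
have m2 (h : 'rV[R]_n -> R) : measT h ->
    measT (fun z : 'rV[R]_n * 'rV[R]_n => h z.2) by move=> mh; apply: measurableT_comp.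
have [ma2 mb2 mP1 mQ1] := And4 (m2 _ ma) (m2 _ mb) (m1 _ mP) (m1 _ mQ).
have mf : measT f by rewrite /f; measv.
have fb (x y : 'rV[R]_n) : `|f (x, y)| <= K * expR (- (t * sqn x)) * (`|a y| + `|b y|).
  rewrite /f/= normrM ger0_norm ?expR_ge0// (mulrC K) -mulrA ler_wpM2l ?expR_ge0//.
  rewrite (le_trans (ler_normD _ _))// !normrM mulrDr (mulrC K) (mulrC K).
  by apply: lerD; rewrite ler_wpM2l// (le_trans (norm_trig_le _ _ _))// ?normrN// addrC.
have ig := @integrable_gauss_rV0 R n t t0.
transitivity (\int[mu]_xi \int[mu]_x f (xi, x)).
  apply: eq_Rintegral => xi _.
  transitivity (\int[mu]_x (expR (- (t * sqn xi)) * P xi * (a x * cos (edot xi x) + b x * sin (edot xi x)) +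
     expR (- (t * sqn xi)) * Q xi * (b x * cos (edot xi x) + - a x * sin (edot xi x)))).
    rewrite RintegralD//; [|apply: integrableRZ; exact: integrable_ftc|apply: integrableRZ; exact: integrable_ftc].
    rewrite !RintegralZl//; [|exact: integrable_ftc|exact: integrable_ftc].
    by rewrite -/(ftc _ _ _) -/(ftc _ _ _) /ftsq /P /Q; ring.
  by apply: eq_Rintegral => y _; rewrite /f/=; ring.
rewrite (Rintegral_fubini mf (integrableRZ K ig) (integrableRD (integrable_abs ia) (integrable_abs ib)) fb).
apply: eq_Rintegral => x _; rewrite /f/=.
transitivity (\int[mu]_xi
   (a x * (expR (- (t * sqn xi)) * (P xi * cos (edot xi x) - Q xi * sin (edot xi x))) +
    b x * (expR (- (t * sqn xi)) * (P xi * sin (edot xi x) + Q xi * cos (edot xi x))))).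
  by apply: eq_Rintegral => xi _; ring.
have i2 (S C : R -> R) : measT S -> measT C ->
    (forall x, `|S x| <= 1) -> (forall x, `|C x| <= 1) ->
    int (fun xi => expR (- (t * sqn xi)) * (P xi * C (edot xi x) + Q xi * S (edot xi x))).
  move=> mS mC S1 C1; apply: (integrable_gauss_mul (C := K)) => //.
    have me : measT (fun xi : 'rV[R]_n => edot xi x) by measv.
    by apply: mf_add; apply: mf_mul => //; apply: measurableT_comp.
  move=> xi; rewrite (le_trans _ (PQ xi))// (le_trans (ler_normD _ _))// !normrM.
  by rewrite lerD// ler_piMr.
have mcos : measT (@cos R) by apply: continuous_measurable_fun; exact: continuous_cos.
have msin : measT (@sin R) by apply: continuous_measurable_fun; exact: continuous_sin.
have iA : int (fun xi => expR (- (t * sqn xi)) * (P xi * cos (edot xi x) - Q xi * sin (edot xi x))).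
  have h := i2 (fun x => - sin x) cos (mf_opp msin) mcos _ cos_norm_le1.
  apply: eq_integrable (h _) => //; first by move=> xi _; congr EFin; ring.
  by move=> y; rewrite normrN sin_norm_le1.
have iC := i2 cos sin mcos msin cos_norm_le1 sin_norm_le1.
rewrite RintegralD//; [|exact: integrableRZ|exact: integrableRZ].
rewrite !RintegralZl//.
by rewrite ftc_gauss_inversion2// ftc_gauss_inversion.
Qed.

(* The modulus of the unnormalized Fourier transform of the heat flow of [a + i b] at time [dl]. *)
Definition ftphi dl a b xi := expR (- (dl * sqn xi)) * Num.sqrt (ftsq a b xi).

Lemma ftphi_ge0 dl a b xi : 0 <= ftphi dl a b xi.
Proof. by rewrite mulr_ge0 ?expR_ge0 ?sqrtr_ge0. Qed.

Lemma mf_ftphi dl a b : int a -> int b -> measT (ftphi dl a b).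
Proof. by move=> ia ib; apply: mf_mul; [measv|apply: mf_sqrt; exact: mf_ftsq]. Qed.

(** The heat flow is itself the transform of a damped transform, so [gauss_ftsq] applies with [x]
    and [xi] exchanged. The resulting form has the positive kernel [gk], so its entries may be
    replaced by their moduli. *)
Lemma gauss_gconv_le t dl a b : 0 < t -> 0 < dl -> int a -> int b ->
  (\int[mu]_x (expR (- (t * sqn x)) * (gconv dl a x ^+ 2 + gconv dl b x ^+ 2))%:E <=
   \int[mu]_xi \int[mu]_eta (ftphi dl a b xi * ftphi dl a b eta * gk t (xi - eta))%:E)%E.
Proof.
move=> t0 d0 ia ib; pose phi := ftphi dl a b; rewrite -/phi; have iNa := integrableRN ia.
pose a' xi := expR (- (dl * sqn xi)) * ftc a b xi.
(* With this sign [a' + i b'] is the conjugate of the damped transform, so that [ftc], a forward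
   transform, inverts it up to conjugation. *)
pose b' xi := - (expR (- (dl * sqn xi)) * ftc b (fun x => - a x) xi).
have ia' : int a' by exact: integrable_gauss_ftc.
have ib' : int b' by apply: integrableRN; exact: integrable_gauss_ftc.
have ma' := integrable_mf ia'; have mb' := integrable_mf ib'.
have mphi : measT phi by exact: mf_ftphi.
have E x : ftsq a' b' x = gconv dl a x ^+ 2 + gconv dl b x ^+ 2.
  have h1 : ftc a' b' x = gconv dl a x.
    rewrite -[RHS](ftc_gauss_inversion x d0 ia ib).
    by apply: eq_Rintegral => xi _; rewrite (edotC x xi) /a' /b'; ring.
  have h2 : ftc b' (fun x => - a' x) x = - gconv dl b x.
    rewrite -(ftc_gauss_inversion2 x d0 ia ib) -mulN1r -RintegralZl//.
      by apply: eq_Rintegral => xi _; rewrite (edotC x xi) /a' /b'; ring.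
    have h := integrable_ftc x (integrableRN ib') ia'.
    by apply: eq_integrable h => // xi _; congr EFin; rewrite (edotC x xi) /a' /b'; ring.
  by rewrite /ftsq h1 h2 sqrrN.
under eq_integral do rewrite -E.
have -> : (\int[mu]_x (expR (- (t * sqn x)) * ftsq a' b' x)%:E =
   (\int[mu]_xi (a' xi * gconv t a' xi + b' xi * gconv t b' xi))%:E)%E.
  by rewrite -gauss_ftsq// fineK// integrable_fin_num//; exact: integrable_gauss_ftsq.
have ab xi eta : `|a' xi * a' eta + b' xi * b' eta| <= phi xi * phi eta.
  set p := expR (- (dl * sqn xi)); set q := expR (- (dl * sqn eta)).
  set x1 := ftc a b xi; set x2 := ftc b (fun x => - a x) xi.
  set y1 := ftc a b eta; set y2 := ftc b (fun x => - a x) eta.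
  have -> : a' xi * a' eta + b' xi * b' eta = p * q * (x1 * y1 + x2 * y2).
    by rewrite /a' /b' -/p -/q -/x1 -/x2 -/y1 -/y2; ring.
  rewrite /phi /ftphi -/p -/q mulrACA normrM ger0_norm ?mulr_ge0 ?expR_ge0//.
  rewrite ler_wpM2l ?mulr_ge0 ?expR_ge0// -sqrtrM ?ftsq_ge0// -sqrtr_sqr ler_wsqrtr//.
  rewrite /ftsq -/x1 -/x2 -/y1 -/y2.
  exact: cauchy2.
have mgk (xi : 'rV[R]_n) : measT (fun eta : 'rV[R]_n => gk t (xi - eta)) by rewrite /gk; measv.
pose h xi := a' xi * gconv t a' xi + b' xi * gconv t b' xi.
have mh : measT h.
  by apply: mf_add; apply: mf_mul => //; exact: mf_gconv.
apply: (@le_trans _ _ (\int[mu]_xi `|(h xi)%:E|)%E).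
  apply: (@le_trans _ _ `|\int[mu]_xi (h xi)%:E|%E); last first.
    by apply: le_abse_integral => //; exact: mf_EFin.
  (* [fine] sends an infinite integral to 0; the bound by the absolute value holds in that case
     too. *)
  rewrite /Rintegral; case: (\int[mu]_xi _)%E => [r| |]/=; rewrite ?leey//.
  by rewrite lee_fin ler_norm.
apply: le_integralT => //.
- by apply: measurableT_comp => //; exact: mf_EFin.
- apply: (measurable_fun_fubini_tonelli_F (m2 := mu) (fun z => (phi z.1 * phi z.2 * gk t (z.1 - z.2))%:E)).
    have p1 : measT (fun z : 'rV[R]_n * 'rV[R]_n => phi z.1) by apply: measurableT_comp.
    have p2 : measT (fun z : 'rV[R]_n * 'rV[R]_n => phi z.2) by apply: measurableT_comp.
    by rewrite /gk; apply: mf_EFin; apply: mf_mul; [exact: mf_mul|measv].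
  by move=> z; rewrite lee_fin; apply: mulr_ge0; [apply: mulr_ge0; exact: ftphi_ge0|exact: gk_ge0].
move=> xi.
have i1 := integrableRZ (a' xi) (integrable_gconv xi t0 ia'); have i2 := integrableRZ (b' xi) (integrable_gconv xi t0 ib').
have -> : h xi = \int[mu]_eta ((a' xi * a' eta + b' xi * b' eta) * gk t (xi - eta)).
  rewrite /h /gconv -!RintegralZl//; [|exact: integrable_gconv..].
  by rewrite -RintegralD//; apply: eq_Rintegral => eta _; ring.
have iF : int (fun eta => (a' xi * a' eta + b' xi * b' eta) * gk t (xi - eta)).
  by apply: eq_integrable (integrableRD i1 i2) => // eta _; congr EFin; ring.
rewrite /Rintegral fineK ?integrable_fin_num//.
rewrite (le_trans (le_abse_integral _ _ _))//; first exact: measurable_int iF.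
apply: le_integralT => //.
- by apply: measurableT_comp => //; exact: measurable_int iF.
- by apply: mf_EFin; apply: mf_mul => //; apply: mf_mul.
by move=> eta; rewrite lee_fin normrM (ger0_norm (gk_ge0 _ _)) ler_wpM2r ?gk_ge0.
Qed.

End gauss_form.

(** * Radial computation: the Riesz weight acting on heat potentials *)

Lemma exponent_bounds (R : realType) (N s e : R) : 0 < s -> 0 < e -> 0 < (N - 2 * s) / 4 ->
  [/\ (N - 2 * s) / 4 < N / 2, s + (N - 2 * s) / 4 < N / 2,
    (N - 2 * s) / 4 - e < N / 2 & s + ((N - 2 * s) / 4 - e) < N / 2].
Proof. by move=> s0 e0 h; split; lra. Qed.

Section radial.
Context {R : realType} (N s e : R).
Local Notation leb := (@lebesgue_measure R).
Local Notation RR := (measurableTypeR R * measurableTypeR R)%type.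
Hypothesis s0 : 0 < s.
Let b0 := (N - 2 * s) / 4.
Hypothesis e0 : 0 < e.
Hypothesis eb : e < b0.
Hypothesis es : e < s.
Let b1 := b0 - e.
Let b1_gt0 : 0 < b1. Proof. by rewrite subr_gt0. Qed.
Let b0_gt0 : 0 < b0. Proof. exact: lt_trans eb. Qed.

(* The heat kernel at time [T] and squared distance [rho], see [hkE]. *)
Definition heat_scale (rho T : R) : R := expR (- (N / 2) * ln (4 * pi * T) - rho / 4 * expR (- ln T)).

Lemma mf_heat_scale d (T : measurableType d) (f : T -> R) rho :
  measT f -> measT (fun x => heat_scale rho (f x)).
Proof. by move=> mf; rewrite /heat_scale; meas. Qed.

(* The integral of [T^b p_T dT/T], by [integral_heat_power]. *)
Definition heat_power (b rho : R) : R :=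
  expR (- (N / 2) * ln (4 * pi)) * expR ((b - N / 2) * ln (rho / 4)) * Gamma (N / 2 - b).

Lemma heat_power_gt0 b rho : b < N / 2 -> 0 < heat_power b rho.
Proof. by move=> bN; rewrite !mulr_gt0 ?expR_gt0// Gamma_gt0// subr_gt0. Qed.

Lemma integral_heat_power b rho : b < N / 2 -> 0 < rho ->
  (\int[leb]_y (expR (b * y) * heat_scale rho (expR y))%:E = (heat_power b rho)%:E)%E.
Proof.
move=> bN r0; have r4 : 0 < rho / 4 by rewrite divr_gt0.
have p4 : 0 < 4 * pi :> R by rewrite mulr_gt0// pi_gt0.
transitivity (\int[leb]_y (expR ((b - N / 2) * y - rho / 4 * expR (- y) - N / 2 * ln (4 * pi)))%:E)%E.
  apply: eq_integral => y _; rewrite /heat_scale lnM ?posrE ?expR_gt0// expRK -expRD; congr (expR _)%:E.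
  ring.
pose c := expR (- (N / 2) * ln (4 * pi)) * expR ((b - N / 2) * ln (rho / 4)).
rewrite -(@ge0_integral_opp _ (fun y => (expR ((b - N / 2) * y - rho / 4 * expR (- y) - N / 2 * ln (4 * pi)))%:E)); [|by meas|by move=> x; rewrite lee_fin expR_ge0].
rewrite -(@ge0_integral_shift _ _ (- ln (rho / 4))); [|by meas|by move=> x; rewrite lee_fin expR_ge0].
rewrite /heat_power EFinM -GammaE ?subr_gt0// /gamma_int -ge0_integralZlT//; try by [meas|rewrite mulr_ge0 ?expR_ge0].
apply: eq_integral => y _; rewrite -EFinM -!expRD opprK (expRD y) expRN lnK ?posrE//.
rewrite (mulrC (rho / 4)) divfK ?gt_eqF//; congr (expR _)%:E; ring.
Qed.

(* By the semigroup property, [|x|^(-2s)] acts on the heat potential of [k] by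
   adding up the scales. *)
Definition riesz_heat (rho : R) (k : R -> R) : \bar R :=
  (\int[leb \x leb]_u (k u.2 * (expR (s * u.1) * heat_scale rho (expR u.1 + expR u.2)))%:E)%E.

Lemma riesz_heat_iter rho (k : R -> R) : measT k -> (forall z, 0 <= k z) ->
  riesz_heat rho k = (\int[leb]_y \int[leb]_z (k z * (expR (s * y) * heat_scale rho (expR y + expR z)))%:E)%E.
Proof.
move=> mk k0; have mk2 : measT (fun u : R * R => k u.2) by apply: measurableT_comp.
rewrite /riesz_heat fubini_tonelli1//=.
- by apply: mf_EFin; apply: mf_mul => //; apply: mf_mul; [meas|apply: mf_heat_scale; meas].
- by move=> u; rewrite lee_fin !mulr_ge0 ?expR_ge0.
Qed.

(** The integrand of [riesz_heat] for the density [tau^b], with an extra power [c] of the total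
    scale; that power is what the error terms of [weight_pointwise] call for. *)
Definition riesz_power rho b c (u : RR) : \bar R :=
  (expR (b * u.2) * expR (c * ln (expR u.1 + expR u.2)) *
     (expR (s * u.1) * heat_scale rho (expR u.1 + expR u.2)))%:E.

Lemma mf_riesz_power rho b c : measT (riesz_power rho b c).
Proof.
apply: mf_EFin; apply: mf_mul; first by meas.
by apply: mf_mul; [meas|apply: mf_heat_scale; meas].
Qed.

Lemma riesz_power_ge0 rho b c u : (0 <= riesz_power rho b c u)%E.
Proof. by rewrite lee_fin !mulr_ge0 ?expR_ge0. Qed.

(** The kernel sees the two scales only through their sum, so [integral_expR_add] splits off a Beta
    function and the three exponents add up. *)
Lemma integral_riesz_power rho b c : 0 < rho -> 0 < b -> s + b + c < N / 2 ->
  (\int[leb \x leb]_u riesz_power rho b c u = (Beta s b * heat_power (s + b + c) rho)%:E)%E.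
Proof.
move=> r0 b0' sb.
have h := @integral_expR_add R (fun T => (expR (c * ln T) * heat_scale rho T)%:E) s b.
have mF : measT (fun T : R => (expR (c * ln T) * heat_scale rho T)%:E).
  by apply: mf_EFin; apply: mf_mul; [meas|exact: mf_heat_scale].
transitivity (\int[leb]_x \int[leb]_y riesz_power rho b c (x, y))%E.
  exact: (@fubini_tonelli1 _ _ _ _ _ leb leb (riesz_power rho b c) (mf_riesz_power rho b c) (riesz_power_ge0 rho b c)).
transitivity (\int[leb]_x \int[leb]_y ((expR (s * x + b * y))%:E * (fun T : R => (expR (c * ln T) * heat_scale rho T)%:E) (expR x + expR y)%R))%E.
  by apply: eq_integral => x _; apply: eq_integral => y _; rewrite /riesz_power/= -EFinM expRD; congr EFin; ring.
rewrite h//; last by move=> x; rewrite lee_fin mulr_ge0 ?expR_ge0.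
rewrite beta_intE// [RHS]EFinM; congr (_ * _)%E; rewrite -integral_heat_power//.
by apply: eq_integral => x _; rewrite -EFinM mulrA -expRD expRK -mulrDl.
Qed.

Section two_power_weight.
Variable l : R.
(** The half makes the subtracted part at most [tau^b0 / 2] on the scales [tau > e^l], so the weight
    stays comparable to [tau^b0]. *)
Let lam := expR (e * l) / 2.

(* The density [tau^b0 - lam tau^b1 1_(tau > e^l)] at [tau = e^z]. *)
Definition weight (z : R) : R := expR (b0 * z) - (if l < z then lam * expR (b1 * z) else 0).

Lemma mf_weight : measT weight.
Proof.
rewrite /weight; apply: mf_sub; first by meas.
apply: mf_if; last by meas.
by rewrite (_ : [set x | l < x] = `]l, +oo[%classic)// set_itvoy.
Qed.

Lemma weight_ge z : expR (b0 * z) / 2 <= weight z.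
Proof.
rewrite /weight; case: ifPn => lz; last by have := expR_ge0 (b0 * z); lra.
have : lam * expR (b1 * z) <= expR (b0 * z) / 2.
  rewrite /lam mulrAC ler_pM2r ?invr_gt0// -expRD ler_expR /b1.
  rewrite mulrBl addrCA gerDl subr_le0 ler_wpM2l ?(ltW e0)//.
  exact: ltW.
lra.
Qed.

Lemma weight_ge0 z : 0 <= weight z.
Proof. by rewrite (le_trans _ (weight_ge z))// divr_ge0// expR_ge0. Qed.

Lemma weight_le z : weight z <= expR (b0 * z).
Proof.
rewrite /weight; case: ifPn => _; last by rewrite subr0.
by rewrite lerBlDr lerDl mulr_ge0 ?expR_ge0// divr_ge0 ?expR_ge0.
Qed.

Definition weight_heat (rho : R) : \bar R := (\int[leb]_z (weight z * heat_scale rho (expR z))%:E)%E.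

Let mwt2 : measT (fun u : RR => weight u.2).
Proof. by apply: measurableT_comp => //; exact: mf_weight. Qed.

Let lam_gt0 : 0 < lam. Proof. by rewrite divr_gt0// expR_gt0. Qed.

Let N2 : [/\ b0 < N / 2, s + b0 < N / 2, b1 < N / 2 & s + b1 < N / 2].
Proof. exact: exponent_bounds s0 e0 b0_gt0. Qed.

(** Pointwise bounds on [weight], integrated. The last one records what was subtracted, and the cut
    can only help it. *)
Lemma weight_heat_bounds rho : 0 < rho ->
  exists2 H, weight_heat rho = H%:E & [/\ heat_power b0 rho / 2 <= H, H <= heat_power b0 rho & heat_power b0 rho <= H + lam * heat_power b1 rho].
Proof.
move=> r0; have [n1 n2 n3 n4] := N2.
have mh d (T : measurableType d) (f : T -> R) := @mf_heat_scale d T f rho.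
have m1 : measT (fun z => (weight z * heat_scale rho (expR z))%:E).
  by apply: mf_EFin; apply: mf_mul; [exact: mf_weight|apply: mf_heat_scale; meas].
have m2 b : measT (fun z : R => (expR (b * z) * heat_scale rho (expR z))%:E).
  by apply: mf_EFin; apply: mf_mul; [meas|apply: mf_heat_scale; meas].
have p1 z : (0 <= (weight z * heat_scale rho (expR z))%:E)%E by rewrite lee_fin mulr_ge0 ?weight_ge0 ?expR_ge0.
have p2 b z : (0 <= (expR (b * z) * heat_scale rho (expR z))%:E)%E by rewrite lee_fin mulr_ge0 ?expR_ge0.
have h2 : (weight_heat rho <= (heat_power b0 rho)%:E)%E.
  rewrite /weight_heat -(integral_heat_power n1 r0). apply: le_integralT; [exact: p1|exact: m1|exact: m2|move=> z].
  by rewrite lee_fin ler_wpM2r ?expR_ge0// weight_le.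
have h1 : ((heat_power b0 rho / 2)%:E <= weight_heat rho)%E.
  rewrite /weight_heat mulrC EFinM -(integral_heat_power n1 r0) -ge0_integralZlT; [|exact: p2|exact: m2|by rewrite invr_ge0].
  apply: le_integralT.
  - by move=> z; apply: mule_ge0 => //; rewrite lee_fin.
  - by apply: emeasurable_funM; [exact: measurable_cst|exact: m2].
  - exact: m1.
  - by move=> z; rewrite -EFinM lee_fin mulrA ler_wpM2r ?expR_ge0// mulrC weight_ge.
have h3 : ((heat_power b0 rho)%:E <= weight_heat rho + lam%:E * (heat_power b1 rho)%:E)%E.
  rewrite /weight_heat -(integral_heat_power n1 r0) -(integral_heat_power n3 r0).
  rewrite -ge0_integralZlT; [|exact: p2|exact: m2|exact: ltW].
  rewrite -ge0_integralDT; [|exact: p1|exact: m1| |]; last 2 first.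
  - by move=> z; apply: mule_ge0 => //; rewrite lee_fin ltW.
  - by apply: emeasurable_funM; [exact: measurable_cst|exact: m2].
  apply: le_integralT; [exact: p2|exact: m2| |].
    by apply: emeasurable_funD; [exact: m1|apply: emeasurable_funM; [exact: measurable_cst|exact: m2]].
  move=> z; rewrite -EFinM -EFinD lee_fin mulrA -mulrDl ler_wpM2r ?expR_ge0// /weight.
  by case: ifPn => _; [lra|rewrite subr0 lerDl mulr_ge0 ?expR_ge0// ltW].
case: (weight_heat rho) h1 h2 h3 => [H| |].
- by rewrite !lee_fin => *; exists H.
- by rewrite leye_eq.
- by rewrite leeNy_eq.
Qed.

(** Below the cut nothing was subtracted, and [lam * expR (b1 * z)] has to be paid for. If
    [T > kap + l], then [T - z > kap], and moving half of the power from [z] to [T] gains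
    [expR (- (kap * (b1 / 2)))]; otherwise a negative power of the total scale is inserted. *)
Let weight_pointwise kap T z :
  weight z + lam * (expR (b1 * z) * expR (0 * T)) <=
  expR (b0 * z) * expR (0 * T) + lam * (expR (- (kap * (b1 / 2))) * (expR (b1 / 2 * z) * expR (b1 / 2 * T)) +
    expR ((s - e) * (kap + l)) * (expR (b1 * z) * expR ((e - s) * T))).
Proof.
rewrite mul0r expR0 !mulr1 /weight.
have l0' := ltW lam_gt0.
have A0 : 0 <= expR (- (kap * (b1 / 2))) * (expR (b1 / 2 * z) * expR (b1 / 2 * T)).
  by rewrite !mulr_ge0 ?expR_ge0.
have B0 : 0 <= expR ((s - e) * (kap + l)) * (expR (b1 * z) * expR ((e - s) * T)).
  by rewrite !mulr_ge0 ?expR_ge0.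
case: ifPn => lz.
  by rewrite subrK lerDl mulr_ge0// addr_ge0.
rewrite subr0 lerD2l ler_wpM2l//.
rewrite -leNgt in lz.
have [TK|TK] := leP T (kap + l).
  apply: le_trans (_ : _ <= expR ((s - e) * (kap + l)) * (expR (b1 * z) * expR ((e - s) * T))) _.
    rewrite -!expRD ler_expR addrCA lerDl.
    by rewrite -(opprB s e) mulNr subr_ge0 ler_wpM2l// subr_ge0 ltW.
  by rewrite lerDr.
apply: le_trans (_ : _ <= expR (- (kap * (b1 / 2))) * (expR (b1 / 2 * z) * expR (b1 / 2 * T))) _.
  rewrite -!expRD ler_expR.
  have -> : - (kap * (b1 / 2)) + (b1 / 2 * z + b1 / 2 * T) = b1 * z + b1 / 2 * (T - kap - z) by field.
  rewrite lerDl mulr_ge0 ?divr_ge0 ?(ltW b1_gt0)//.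
  by rewrite subr_ge0 lerBrDl (le_trans _ (ltW TK))// lerD2l.
by rewrite lerDl.
Qed.

(** [weight_pointwise] integrated at [T = ln (expR y + expR z)]. The first error has total exponent
    [s + b1], like the gain; the second has [s + b1 + (e - s) = b0], like the weight itself. *)
Lemma riesz_heat_weight rho kap : 0 < rho ->
  exists2 J, riesz_heat rho weight = J%:E & J + lam * (Beta s b1 * heat_power (s + b1) rho) <=
    Beta s b0 * heat_power (s + b0) rho +
    lam * (expR (- (kap * (b1 / 2))) * (Beta s (b1 / 2) * heat_power (s + b1) rho) +
           expR ((s - e) * (kap + l)) * (Beta s b1 * heat_power b0 rho)).
Proof.
move=> r0; have [n1 n2 n3 n4] := N2.
have I1 : (\int[leb \x leb]_u riesz_power rho b1 0 u = (Beta s b1 * heat_power (s + b1) rho)%:E)%E.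
  by rewrite -[s + b1]addr0; apply: integral_riesz_power => //; rewrite addr0.
have I0 : (\int[leb \x leb]_u riesz_power rho b0 0 u = (Beta s b0 * heat_power (s + b0) rho)%:E)%E.
  by rewrite -[s + b0]addr0; apply: integral_riesz_power => //; rewrite addr0.
have I2 : (\int[leb \x leb]_u riesz_power rho (b1 / 2) (b1 / 2) u = (Beta s (b1 / 2) * heat_power (s + b1) rho)%:E)%E.
  have eq : s + b1 / 2 + b1 / 2 = s + b1 by field.
  by rewrite -eq; apply: integral_riesz_power; rewrite ?eq// divr_gt0.
have I3 : (\int[leb \x leb]_u riesz_power rho b1 (e - s) u = (Beta s b1 * heat_power b0 rho)%:E)%E.
  have eq : s + b1 + (e - s) = b0 by rewrite /b1; ring.
  by rewrite -[in RHS]eq; apply: integral_riesz_power; rewrite ?eq.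
have m b c : measT (riesz_power rho b c) by exact: mf_riesz_power.
have p b c u : (0 <= riesz_power rho b c u)%E by exact: riesz_power_ge0.
pose w (u : RR) := (weight u.2 * (expR (s * u.1) * heat_scale rho (expR u.1 + expR u.2)))%:E.
have mw : measT w.
  by apply: mf_EFin; apply: mf_mul; [exact: mwt2|apply: mf_mul; [meas|apply: mf_heat_scale; meas]].
have w0 u : (0 <= w u)%E by rewrite lee_fin !mulr_ge0 ?weight_ge0 ?expR_ge0.
pose C1 := expR (- (kap * (b1 / 2))); pose C2 := expR ((s - e) * (kap + l)).
have C10 : 0 <= C1 by exact: expR_ge0.
have C20 : 0 <= C2 by exact: expR_ge0.
have l0' := ltW lam_gt0.
have mZ r b c : measT (fun u : RR => r%:E * riesz_power rho b c u)%E.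
  by apply: emeasurable_funM; [exact: measurable_cst|exact: m].
have pZ r b c u : 0 <= r -> (0 <= r%:E * riesz_power rho b c u)%E.
  by move=> rr; apply: mule_ge0; [rewrite lee_fin|exact: p].
have key : (\int[leb \x leb]_u w u + lam%:E * \int[leb \x leb]_u riesz_power rho b1 0 u <=
   \int[leb \x leb]_u riesz_power rho b0 0 u +
    lam%:E * (C1%:E * \int[leb \x leb]_u riesz_power rho (b1 / 2) (b1 / 2) u +
              C2%:E * \int[leb \x leb]_u riesz_power rho b1 (e - s) u))%E.
  rewrite -(ge0_integralZlT _ (p _ _) (m _ _) l0') -(ge0_integralZlT _ (p _ _) (m _ _) C10) -(ge0_integralZlT _ (p _ _) (m _ _) C20).
  rewrite -(ge0_integralDT _ (fun u => pZ _ _ _ u C10) (mZ _ _ _) (fun u => pZ _ _ _ u C20) (mZ _ _ _)).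
  have p3 u : (0 <= C1%:E * riesz_power rho (b1 / 2) (b1 / 2) u + C2%:E * riesz_power rho b1 (e - s) u)%E.
    by apply: adde_ge0; exact: pZ.
  have m3 := emeasurable_funD (mZ C1 (b1 / 2) (b1 / 2)) (mZ C2 b1 (e - s)).
  rewrite -(ge0_integralZlT _ p3 m3 l0').
  rewrite -(ge0_integralDT _ w0 mw (fun u => pZ _ _ _ u l0') (mZ _ _ _)).
  have p4 u : (0 <= lam%:E * (C1%:E * riesz_power rho (b1 / 2) (b1 / 2) u + C2%:E * riesz_power rho b1 (e - s) u))%E.
    by apply: mule_ge0; [rewrite lee_fin|exact: p3].
  have m4 : measT (fun u : RR => lam%:E * (C1%:E * riesz_power rho (b1 / 2) (b1 / 2) u + C2%:E * riesz_power rho b1 (e - s) u))%E.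
    by apply: emeasurable_funM; [exact: measurable_cst|exact: m3].
  rewrite -(ge0_integralDT _ (p _ _) (m _ _) p4 m4).
  apply: le_integralT.
  - by move=> u; apply: adde_ge0; [exact: w0|exact: pZ].
  - by apply: emeasurable_funD; [exact: mw|exact: mZ].
  - by apply: emeasurable_funD; [exact: m|exact: m4].
  move=> [y z]; rewrite /w /riesz_power -!EFinM -!EFinD -?EFinM -?EFinD lee_fin /=.
  have E0 : 0 <= expR (s * y) * heat_scale rho (expR y + expR z) by rewrite mulr_ge0 ?expR_ge0.
  have h := ler_wpM2r E0 (weight_pointwise kap (ln (expR y + expR z)) z).
  rewrite -/C1 -/C2 -subr_ge0 in h; rewrite -subr_ge0; apply: (le_trans h).
  apply: eq_lee; ring.
rewrite I0 I1 I2 I3 -/(riesz_heat rho weight) in key.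
have D0 : (0 <= riesz_heat rho weight)%E by apply: integral_ge0 => u _; exact: w0.
case E : (riesz_heat rho weight) key D0 => [J| |] // key _.
by exists J => //; move: key; rewrite -!EFinM -!EFinD -?EFinM -?EFinD lee_fin.
Qed.

End two_power_weight.
End radial.

(** Half of the excess [K - 1] absorbs the first error and the other half yields the term in [t1];
    the second error becomes a multiple of [H] through [p0 <= 2 * H]. *)
Lemma radial_arith (R : realType) (X J H lam r p0 p1 K c1 c2 k1 k2 t1 : R) :
  0 <= lam -> 0 <= k2 -> 0 <= c2 -> 0 <= r -> 0 <= p1 -> 0 <= t1 ->
  X * J + lam * (K * (r * p1)) <= r * p0 + lam * (k1 * (c1 * (r * p1)) + k2 * (c2 * p0)) ->
  k1 * c1 <= (K - 1) / 2 -> 1 < K ->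
  p0 / 2 <= H -> H <= p0 -> p0 <= H + lam * p1 ->
  t1 * p0 <= lam * ((K - 1) / 2 * (r * p1)) ->
  X * J + t1 * H <= r * H + 2 * lam * k2 * c2 * H.
Proof.
move=> l0 k20 c20 r0 p10 t10 hJ hk K1 h1 h2 h3 ht.
have a1 : lam * (k1 * (c1 * (r * p1))) <= lam * ((K - 1) / 2 * (r * p1)).
  by rewrite ler_wpM2l// mulrA ler_wpM2r ?mulr_ge0.
have a2 : t1 * H <= t1 * p0 by rewrite ler_wpM2l.
have a3 : r * p0 <= r * H + r * (lam * p1) by rewrite -mulrDr ler_wpM2l.
have a4 : lam * (k2 * (c2 * p0)) <= lam * (k2 * (c2 * (2 * H))).
  by rewrite !ler_wpM2l//; lra.
have -> : 2 * lam * k2 * c2 * H = lam * (k2 * (c2 * (2 * H))) by ring.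
have e1 : r * (lam * p1) = lam * (r * p1) by ring.
rewrite mulrDr in hJ; rewrite e1 in a3.
have e2 : lam * (K * (r * p1)) = lam * (r * p1) + lam * ((K - 1) / 2 * (r * p1)) + lam * ((K - 1) / 2 * (r * p1)) by field.
rewrite e2 in hJ; lra.
Qed.

Lemma riesz_ratio_arith (R : fieldType) (X B G G1 G2 E1 E2 E3 c : R) : G != 0 -> G1 != 0 ->
  X * (B * (c * (E1 * E2 * E3) * G2)) = X * B * (G * G2 / G1) / G * E1 * (E2 * (c * E3 * G1)).
Proof. by move=> G0 G10; field; rewrite G0. Qed.

Lemma hardy_ratio_arith (R : fieldType) (E g0 g1 gs : R) : E != 0 -> g0 != 0 -> g1 != 0 -> gs != 0 ->
  E * g1 ^+ 2 / g0 ^+ 2 / gs * (gs * g0 / g1) * (gs * g0 / g1) / gs * E^-1 = 1.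
Proof. by move=> E0 g00 g10 gs0; field; rewrite ?E0 ?g00 ?g10 ?gs0. Qed.

Lemma beta_gain_arith (R : realFieldType) (X B B1 B2 G E : R) : 0 < X -> 0 < G -> 0 < E ->
  B ^+ 2 < B1 * B2 -> X * B * B / G * E < X * B1 * B2 / G * E.
Proof.
move=> X0 G0 E0 h; rewrite ltr_pM2r// ltr_pM2r ?invr_gt0// -!mulrA ltr_pM2l//.

Qed.

(** The point is uniformity: [eps] and [B] are fixed before the cut [l] and the frequency [r]. In
    the second error the exponents combine as [e * l + (s - e) * (kp + l) = (s - e) * kp + s * l],
    so [B] does not involve [l]. *)
Lemma radial_constants (R : realType) (e s b1 X K c3 B1 B2 : R) :
  0 < b1 -> 0 < X -> 1 < K -> 0 < c3 -> 0 < B1 -> 0 < B2 ->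
  exists eps B : R, [/\ 0 < eps, 0 < B & forall l r, exists kp,
    forall BB0 H J p0 p1 q0 q1 : R, 0 < p0 -> 0 < p1 ->
    X * (BB0 * q0) = expR (s * r) * p0 -> X * (B1 * q1) = K * (expR (s * r) * p1) ->
    expR (s * r) * p1 = c3 * expR ((s - e) * r) * p0 ->
    J + expR (e * l) / 2 * (B1 * q1) <= BB0 * q0 +
      expR (e * l) / 2 * (expR (- (kp * (b1 / 2))) * (B2 * q1) + expR ((s - e) * (kp + l)) * (B1 * p0)) ->
    p0 / 2 <= H -> H <= p0 -> p0 <= H + expR (e * l) / 2 * p1 ->
    X * J + eps * expR (e * l) * expR ((s - e) * r) * H <=
    expR (s * r) * H + B * expR (s * l) * H].
Proof.
move=> b10 X0 K1 c30 B10 B20.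
have K10 : 0 < K - 1 by rewrite subr_gt0.
have K0 : 0 < K by apply: lt_trans K1.
pose c1 := K * B2 / B1; have c10 : 0 < c1 by rewrite divr_gt0// mulr_gt0.
pose c2 := X * B1; have c20 : 0 < c2 by rewrite mulr_gt0.
(* The solution of [expR (- (kp * (b1 / 2))) * c1 = (K - 1) / 2]. *)
pose kp := 2 / b1 * ln (2 * c1 / (K - 1)).
exists ((K - 1) * c3 / 4), (expR ((s - e) * kp) * c2); split.
- by rewrite divr_gt0// mulr_gt0.
- by rewrite mulr_gt0// expR_gt0.
move=> l r; exists kp => BB0 H J p0 p1 q0 q1 p00 p10 E0 E1 E2 hJ H1 H2 H3.
set lam := expR (e * l) / 2 in hJ H3 *.
have lam0 : 0 < lam by rewrite divr_gt0 ?expR_gt0.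
rewrite (_ : expR ((s - e) * kp) * c2 * expR (s * l) * H = 2 * lam * expR ((s - e) * (kp + l)) * c2 * H); last first.
  rewrite (_ : 2 * lam = expR (e * l)); last by rewrite /lam; field.
  rewrite -expRD (_ : e * l + (s - e) * (kp + l) = (s - e) * kp + s * l); last by ring.
  by rewrite expRD; ring.
have rs : 0 <= expR (s * r) by exact: expR_ge0.
apply: (@radial_arith _ _ _ _ lam _ p0 p1 K c1 c2 (expR (- (kp * (b1 / 2))))) => //; try exact: ltW.
- by rewrite !mulr_ge0 ?expR_ge0// ltW// ?subr_gt0.
- rewrite -E0 -E1.
  have -> : c1 * (expR (s * r) * p1) = X * (B2 * q1).
    have : c1 * (expR (s * r) * p1) = B2 / B1 * (K * (expR (s * r) * p1)) by rewrite /c1; ring.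
    by rewrite -E1 => ->; field; rewrite gt_eqF.
  rewrite /c2; move: hJ; rewrite -(ler_pM2l X0) => hJ.
  rewrite -subr_ge0 in hJ; rewrite -subr_ge0; apply: (le_trans hJ).
  apply: eq_lee; ring.
- have -> : kp * (b1 / 2) = ln (2 * c1 / (K - 1)) by rewrite /kp; field; rewrite gt_eqF.
  have pos : 0 < 2 * c1 / (K - 1) by rewrite divr_gt0// mulr_gt0.
  have -> : expR (- ln (2 * c1 / (K - 1))) = (K - 1) / (2 * c1) by rewrite expRN lnK ?posrE// invf_div.
  apply: eq_lee; field.
  by rewrite gt_eqF.
rewrite E2; apply: eq_lee; rewrite /lam; by field.
Qed.

Section radial_hardy.
Context {R : realType} (d : nat) (s e : R).
Hypothesis s0 : 0 < s.
Let N : R := d%:R.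
Let b0 := (N - 2 * s) / 4.
Hypothesis e0 : 0 < e.
Hypothesis eb : e < b0.
Hypothesis es : e < s.
Let b1 := b0 - e.
Let b1_gt0 : 0 < b1. Proof. by rewrite subr_gt0. Qed.
Let b0_gt0 : 0 < b0. Proof. exact: lt_trans eb. Qed.
Let X := hardy_const d s / Gamma s.
Let Gs : 0 < Gamma s. Proof. exact: Gamma_gt0. Qed.

Let sb0 : (N + 2 * s) / 4 = s + b0. Proof. by rewrite /b0; field. Qed.

Lemma hardy_const_gt0 : 0 < hardy_const d s.
Proof.
have g0 : 0 < Gamma b0 by exact: Gamma_gt0.
have g1 : 0 < Gamma (s + b0) by apply: Gamma_gt0; exact: addr_gt0.
rewrite /hardy_const -/N sb0 -/b0; apply: divr_gt0; last exact: exprn_gt0.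
by apply: mulr_gt0; [exact: powR_gt0|exact: exprn_gt0].
Qed.

(** The factor between the image of [tau^b] under the normalized Riesz weight and [rho^s] times its
    heat potential, see [kapE]; the form shows the symmetry [b -> 2 * b0 - b]. *)
Let kap b := X * Beta s b * Beta s (2 * b0 - b) / Gamma s * expR (- (s * ln 4)).

Let two_b0 : 2 * b0 = N / 2 - s. Proof. by rewrite /b0; field. Qed.

Let kapE b rho : 0 < b -> b < 2 * b0 -> 0 < rho ->
  X * (Beta s b * heat_power N (s + b) rho) = kap b * (expR (s * ln rho) * heat_power N b rho).
Proof.
move=> b0' bb r0; rewrite /kap /heat_power.
have g1 : 0 < 2 * b0 - b by rewrite subr_gt0.
have -> : Beta s (2 * b0 - b) = Gamma s * Gamma (2 * b0 - b) / Gamma (N / 2 - b).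
  by rewrite /Beta two_b0; congr (_ / Gamma _); ring.
have -> : N / 2 - (s + b) = 2 * b0 - b by rewrite two_b0; ring.
have G1 : 0 < Gamma (N / 2 - b).
  apply: Gamma_gt0; have -> : N / 2 - b = (2 * b0 - b) + s by rewrite two_b0; ring.
  exact: addr_gt0.
have -> : expR ((s + b - N / 2) * ln (rho / 4)) =
    expR (- (s * ln 4)) * expR (s * ln rho) * expR ((b - N / 2) * ln (rho / 4)).
  by rewrite -!expRD ln_div ?posrE//; congr expR; ring.
by apply: riesz_ratio_arith; rewrite gt_eqF.
Qed.

(** This is where the sharp constant enters: at the centre of symmetry the two Beta factors
    coincide, and their square cancels the Gamma quotient of [hardy_const]. *)
Let kap0 : kap b0 = 1.
Proof.
rewrite /kap (_ : 2 * b0 - b0 = b0); last by ring.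
rewrite /X /hardy_const -/N sb0 -/b0 /Beta.
have g0 : 0 < Gamma b0 by exact: Gamma_gt0.
have g1 : 0 < Gamma (s + b0) by apply: Gamma_gt0; exact: addr_gt0.
have -> : 2 `^ (2 * s) = expR (s * ln 4).
  rewrite powRrM (_ : 2 `^ 2 = 4); last by rewrite powR_mulrn//; ring.
  by rewrite /powR gt_eqF.
rewrite expRN; have := expR_gt0 (s * ln 4); move: (expR _) (Gamma s) (Gamma b0) (Gamma (s + b0)) Gs g0 g1 => E gs g0 g1 gs_ g0_ g1_ E_.
by apply: hardy_ratio_arith; rewrite gt_eqF.
Qed.

(** The reflection of [b1 = b0 - e] is [b0 + e], so strict log-convexity of [Beta s] compares the
    product with its value at [b0]. *)
Let kap1 : 1 < kap b1.
Proof.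
rewrite -kap0 /kap (_ : 2 * b0 - b0 = b0); last by ring.
rewrite (_ : 2 * b0 - b1 = b0 + e); last by rewrite /b1; ring.
have X0 : 0 < X by apply: divr_gt0 => //; exact: hardy_const_gt0.
apply: beta_gain_arith => //; first exact: expR_gt0.
by apply: Beta_strict_logconvex => //; rewrite e0.
Qed.

(** The Schur condition at squared frequency [rho]: after division by [H], the image of the weight
    is at most |xi|^(2s), minus the gain of order [s - e], plus an error that does not depend on the
    frequency. *)
Lemma radial_gain : exists eps B : R, [/\ 0 < eps, 0 < B & forall l rho, 0 < rho ->
  exists H J, [/\ weight_heat N s e l rho = H%:E, riesz_heat N s rho (weight N s e l) = J%:E, 0 < H &
    hardy_const d s / Gamma s * J + eps * expR (e * l) * expR ((s - e) * ln rho) * H <=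
    expR (s * ln rho) * H + B * expR (s * l) * H]].
Proof.
have [n1 n2 n3 n4] := exponent_bounds s0 e0 b0_gt0.
have X0 : 0 < X by apply: divr_gt0 => //; exact: hardy_const_gt0.
have G0 : 0 < Gamma (N / 2 - b0) by apply: Gamma_gt0; rewrite subr_gt0.
have G1 : 0 < Gamma (N / 2 - b1) by apply: Gamma_gt0; rewrite subr_gt0.
have B1 : 0 < Beta s b1 by exact: Beta_gt0.
have B2 : 0 < Beta s (b1 / 2) by apply: Beta_gt0 => //; apply: divr_gt0.
pose c3 := expR (e * ln 4) * Gamma (N / 2 - b1) / Gamma (N / 2 - b0).
have c30 : 0 < c3 by apply: divr_gt0 G0; apply: mulr_gt0 G1; exact: expR_gt0.
have [eps [B [eps0 B0 h]]] := radial_constants e s b1_gt0 X0 kap1 c30 B1 B2.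
exists eps, B; split => // l rho r0.
have [kp hkp] := h l (ln rho).
have [H HE [H1 H2 H3]] := weight_heat_bounds s0 e0 eb l r0.
have [J JE hJ] := riesz_heat_weight s0 e0 eb es l kp r0.
have p00 : 0 < heat_power N b0 rho by exact: heat_power_gt0.
have p10 : 0 < heat_power N b1 rho by exact: heat_power_gt0.
exists H, J; split; [exact: HE|exact: JE| |].
  by apply: lt_le_trans H1; apply: divr_gt0.
have bb0 : b0 < 2 * b0 by rewrite ltr_pMl// ltr1n.
have bb1 : b1 < 2 * b0 by apply: lt_trans bb0; rewrite /b1 ltrBlDr ltrDl.
have E0 := kapE b0_gt0 bb0 r0; rewrite kap0 mul1r in E0.
have E1 := kapE b1_gt0 bb1 r0.
apply: hkp p00 p10 E0 E1 _ hJ H1 H2 H3.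
rewrite /heat_power /c3.
have -> : expR ((b1 - N / 2) * ln (rho / 4)) =
   expR (e * ln 4) * expR (- (e * ln rho)) * expR ((b0 - N / 2) * ln (rho / 4)).
  by rewrite -!expRD ln_div ?posrE//; congr expR; rewrite /b1; ring.
have -> : expR ((s - e) * ln rho) = expR (s * ln rho) * expR (- (e * ln rho)).
  by rewrite -expRD; congr expR; ring.
move: (Gamma (N / 2 - b0)) (Gamma (N / 2 - b1)) G0 => g0 g1 g00.
by field; rewrite gt_eqF.
Qed.

End radial_hardy.

(** * The Schur test *)

Section schur.
Context d0 (T : measurableType d0) (R : realType) (mu : {sigma_finite_measure set T -> \bar R}).
Variables (f h : T -> R) (k : T * T -> R).
Hypotheses (mf : measT f) (mh : measT h) (mk : measT k).
Hypotheses (f0 : forall x, 0 <= f x) (h0 : forall x, 0 < h x) (k0 : forall z, 0 <= k z).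
Hypothesis ksym : forall x y, k (x, y) = k (y, x).

(** Rests on [f x * f y <= (f x ^+ 2 * h y / h x + f y ^+ 2 * h x / h y) / 2]; since [k] is
    symmetric, both halves have the same integral. *)
Lemma schur_test :
  (\int[mu]_x \int[mu]_y (f x * f y * k (x, y))%:E <=
   \int[mu]_x ((f x ^+ 2 / h x)%:E * \int[mu]_y (k (x, y) * h y)%:E))%E.
Proof.
have m1 (g : T -> R) : measT g ->
    measT (fun z : T * T => g z.1) by move=> mg; apply: measurableT_comp.
have m2 (g : T -> R) : measT g ->
    measT (fun z : T * T => g z.2) by move=> mg; apply: measurableT_comp.
have [mf1 mf2 mh1 mh2] := And4 (m1 _ mf) (m2 _ mf) (m1 _ mh) (m2 _ mh).
pose g (z : T * T) := (f z.1 ^+ 2 / h z.1 * (k z * h z.2)).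
have g0 z : 0 <= g z by rewrite !mulr_ge0 ?sqr_ge0 ?invr_ge0 ?(ltW (h0 _)).
have mg : measT g.
  apply: mf_mul; last exact: mf_mul.
  by apply: mf_mul; [exact: mf_exp|exact: mf_inv].
pose X := (\int[mu \x mu]_z (g z)%:E)%E.
have X0 : (0 <= X)%E by apply: integral_ge0 => z _; rewrite lee_fin.
have gE0 (z : T * T) : (0 <= (g z)%:E)%E by rewrite lee_fin.
have mgE : measT (fun z : T * T => (g z)%:E) by exact: mf_EFin.
have -> : (\int[mu]_x ((f x ^+ 2 / h x)%:E * \int[mu]_y (k (x, y) * h y)%:E) = X)%E.
  rewrite /X (fubini_tonelli1 _ mgE gE0); apply: eq_integral => x _.
  rewrite -ge0_integralZlT.
  - by apply: eq_integral => y _; rewrite -EFinM.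
  - by move=> y; rewrite lee_fin mulr_ge0// ltW.
  - by apply: mf_EFin; apply: mf_mul => //; exact: measurable_fun_pair2 mk.
  - by rewrite divr_ge0 ?sqr_ge0// ltW.
pose gT (z : T * T) := (g (z.2, z.1))%:E.
have mgT : measT gT.
  by apply: (measurableT_comp mgE); exact: (measurable_fun_pair measurable_snd measurable_fst).
have gT0 z : (0 <= gT z)%E by exact: gE0.
have XT : (\int[mu \x mu]_z gT z = X)%E.
  by rewrite (fubini_tonelli1 _ mgT gT0) /X (fubini_tonelli2 _ mgE gE0).
have mffk : measT (fun z : T * T => (f z.1 * f z.2 * k z)%:E).
  by apply: mf_EFin; apply: mf_mul => //; exact: mf_mul.
have ffk0 (z : T * T) : (0 <= (f z.1 * f z.2 * k z)%:E)%E by rewrite lee_fin !mulr_ge0.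
have -> : (\int[mu]_x \int[mu]_y (f x * f y * k (x, y))%:E =
    \int[mu \x mu]_z (f z.1 * f z.2 * k z)%:E)%E.
  by rewrite (fubini_tonelli1 _ mffk ffk0).
have half0 : 0 <= 2^-1 :> R by rewrite invr_ge0.
have -> : X = ((2^-1)%:E * X + (2^-1)%:E * X)%E.
  by rewrite -ge0_muleDl ?lee_fin// -EFinD (_ : 2^-1 + 2^-1 = 1) ?mul1e//; field.
rewrite -{2}XT /X -(ge0_integralZlT _ gE0 mgE half0) -(ge0_integralZlT _ gT0 mgT half0).
have mc (u : T * T -> \bar R) : measT u -> measT (fun z => (2^-1)%:E * u z)%E.
  by move=> mu_; apply: emeasurable_funM => //; exact: measurable_cst.
rewrite -ge0_integralDT.
- apply: le_integralT => //; first by apply: emeasurable_funD; exact: mc.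
  move=> [x y]; rewrite /gT /g/= -!EFinM -EFinD lee_fin (ksym y x).
  have [hx hy] := (h0 x, h0 y).
  have -> : 2^-1 * (f x ^+ 2 / h x * (k (x, y) * h y)) + 2^-1 * (f y ^+ 2 / h y * (k (x, y) * h x)) =
     (f x * f y + 2^-1 * ((f x * h y - f y * h x) ^+ 2 / (h x * h y))) * k (x, y).
    by field; rewrite !gt_eqF.
  by rewrite ler_wpM2r// lerDl mulr_ge0// divr_ge0 ?sqr_ge0// ltW// mulr_gt0.
- by move=> z; rewrite mule_ge0// lee_fin.
- exact: mc.
- by move=> z; rewrite mule_ge0// lee_fin.
- exact: mc.
Qed.

End schur.

(** * The power weight as a superposition of Gaussians *)

Section null_origin.
Context {R : realType} (n : nat).

Lemma sqn_eq0 (x : 'rV[R]_n) : (sqn x == 0) = (x == 0).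
Proof.
apply/eqP/eqP => [h|->]; last by rewrite /sqn big1// => i _; rewrite mxE expr0n.
apply/rowP => i; rewrite mxE; apply/eqP; rewrite -sqrf_eq0.
by move: h => /eqP; rewrite psumr_eq0 => [/allP/(_ i)|j _]; rewrite ?mem_index_enum ?sqr_ge0//; apply.
Qed.

Lemma sqn_gt0 (x : 'rV[R]_n) : (0 < sqn x) = (x != 0).
Proof. by rewrite lt0r sqn_eq0 sqn_ge0 andbT. Qed.

(** The origin is a box with sides of length 0. In dimension 0 the measure is the Dirac mass at the
    origin, hence the condition on [n]. *)
Lemma ae_sqn_gt0 : (0 < n)%N -> {ae @lebesgue_rV R n, forall x, 0 < sqn x}.
Proof.
move=> n0; pose A : set 'rV[R]_n := [set x | forall i, [set (0 : R)] (x 0 i)].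
have mA : measurable A by apply: (@measurable_box R n (fun=> [set 0])).
exists A; split => //.
- rewrite /A (@lebesgue_rV_box R n (fun=> [set 0]))//.
  case: n n0 => // m _; rewrite big_ord_recl lebesgue_measure_set1 mul0e//.
- move=> x /= /negP; rewrite sqn_gt0 negbK => /eqP -> i.
  by rewrite mxE.
Qed.

Lemma enorm_powR (x : 'rV[R]_n) (t : R) : 0 < sqn x -> enorm x `^ (2 * t) = expR (t * ln (sqn x)).
Proof.
move=> x0; rewrite enormE -powR12_sqrt ?ltW// -powRrM mulrA mulVf// mul1r.
by rewrite /powR gt_eqF.
Qed.

Lemma mf_enorm_powR t : measT (fun x : 'rV[R]_n => enorm x `^ t).
Proof. by apply: mf_powR; apply: mf_sqrt; measv. Qed.

Lemma hkE (t : R) (z : 'rV[R]_n) : 0 < t -> hk t z = heat_scale n%:R (sqn z) t.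
Proof.
move=> t0; have p0 := @pi_gt0 R.
rewrite /hk /heat_scale /powR gt_eqF ?mulr_gt0//= -expRD mulNr; congr expR.
by rewrite expRN lnK ?posrE//; field; rewrite gt_eqF.
Qed.

End null_origin.

Section riesz_weight.
Context {R : realType} (n : nat).
Local Notation leb := (@lebesgue_measure R).
Local Notation mu := (@lebesgue_rV R n).

Lemma integral_gamma_scale (s X : R) : 0 < X ->
  (\int[leb]_y (expR (s * y - expR y * X))%:E = (expR (- (s * ln X)))%:E * gamma_int s)%E.
Proof.
move=> X0; rewrite -[LHS](@ge0_integral_shift _ _ (- ln X)); last 2 first.
- by meas.
- by move=> y; rewrite lee_fin expR_ge0.
rewrite /gamma_int -ge0_integralZlT; last 3 first.
- by move=> y; rewrite lee_fin expR_ge0.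
- by meas.
- exact: expR_ge0.
apply: eq_integral => y _; rewrite -EFinM -expRD; congr (expR _)%:E.
by rewrite expRD expRN lnK ?posrE// divfK ?gt_eqF//; ring.
Qed.

(** Off the origin the two integrands agree, by the scaling of Euler's integral. At the origin the
    left one is 0 by convention, so the comparison holds at every point. *)
Lemma riesz_weight_le (s : R) (F : 'rV[R]_n -> R) : 0 < s -> measT F ->
  (forall x, 0 <= F x) ->
  ((Gamma s)%:E * \int[mu]_x (enorm x `^ (- (2 * s)) * F x)%:E <=
   \int[leb]_y ((expR (s * y))%:E * \int[mu]_x (expR (- (expR y * sqn x)) * F x)%:E))%E.
Proof.
move=> s0 mF F0.
pose f (z : measurableTypeR R * 'rV[R]_n) := (expR (s * z.1 - expR z.1 * sqn z.2) * F z.2)%:E.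
have mF2 : measT (fun z : measurableTypeR R * 'rV[R]_n => F z.2) by apply: measurableT_comp.
have mf : measT f by rewrite /f; measv.
have f0 z : (0 <= f z)%E by rewrite lee_fin mulr_ge0 ?expR_ge0.
have -> : (\int[leb]_y ((expR (s * y))%:E * \int[mu]_x (expR (- (expR y * sqn x)) * F x)%:E) =
   \int[mu]_x \int[leb]_y f (y, x))%E.
  rewrite -(@fubini_tonelli _ _ _ _ _ leb mu f mf f0); apply: eq_integral => y _.
  rewrite -ge0_integralZlT; last 3 first.
  - by move=> x; rewrite lee_fin mulr_ge0 ?expR_ge0.
  - by measv.
  - exact: expR_ge0.
  by apply: eq_integral => x _; rewrite /f/= -EFinM mulrA -expRD.
have G0 : 0 < Gamma s by exact: Gamma_gt0.
rewrite -ge0_integralZlT; last 3 first.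
- by move=> x; rewrite lee_fin mulr_ge0 ?powR_ge0.
- by apply: mf_EFin; apply: mf_mul => //; exact: mf_enorm_powR.
- exact: ltW.
apply: le_integralT.
- by move=> x; rewrite mule_ge0 ?lee_fin ?(ltW G0)// mulr_ge0 ?powR_ge0.
- apply: emeasurable_funM; first exact: measurable_cst.
  by apply: mf_EFin; apply: mf_mul => //; exact: mf_enorm_powR.
- exact: (measurable_fun_fubini_tonelli_G (m1 := leb) f mf f0).
move=> x; have [x0|x0] := ltP 0 (sqn x); last first.
  rewrite [X in (X <= _)%E](_ : _ = 0%E); first by apply: integral_ge0 => y _; exact: f0.
  have -> : enorm x = 0.
    by rewrite enormE; apply/eqP; rewrite sqrtr_eq0.
  by rewrite powR0 ?mul0r ?mule0// oppr_eq0 mulf_neq0// gt_eqF.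
rewrite /f/=; under eq_integral do rewrite EFinM.
rewrite ge0_integralZrT//; [|by meas].
rewrite integral_gamma_scale// GammaE// -!EFinM -mulrN enorm_powR// mulNr.
by rewrite lee_fin; apply: eq_lee; ring.
Qed.

End riesz_weight.

(** * Hardy inequality with remainder for the heat flow *)

Section hardy_gain.
Context {R : realType} (d : nat) (s e : R).
Local Notation leb := (@lebesgue_measure R).
Local Notation mu := (@lebesgue_rV R d).
Local Notation int f := (mu.-integrable setT (fun x => (f x)%:E)).
Hypothesis d0 : (0 < d)%N.
Hypothesis s0 : 0 < s.
Let N : R := d%:R.
Let b0 := (N - 2 * s) / 4.
Hypothesis e0 : 0 < e.
Hypothesis eb : e < b0.
Hypothesis es : e < s.

(* Changed at the origin, where the heat potential of the weight is infinite. *)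
Let hw l (eta : 'rV[R]_d) : R := fine (weight_heat N s e l (if 0 < sqn eta then sqn eta else 1)).

Let Hw_fin l rho : 0 < rho -> 0 < fine (weight_heat N s e l rho) /\ weight_heat N s e l rho = (fine (weight_heat N s e l rho))%:E.
Proof.
move=> r0; have [H -> [h1 _ _]] := weight_heat_bounds s0 e0 eb l r0.
split => //=; apply: lt_le_trans h1.
have [n1 _ _ _] := exponent_bounds s0 e0 (lt_trans e0 eb).
by apply: divr_gt0 => //; apply: heat_power_gt0.
Qed.

Let hw_gt0 l eta : 0 < hw l eta.
Proof. by rewrite /hw; case: ifPn => h; [have [] := Hw_fin l h|have [] := Hw_fin l ltr01]. Qed.

Let wtk l (z : 'rV[R]_d * measurableTypeR R) : \bar R :=
  (weight N s e l z.2 * heat_scale N (sqn z.1) (expR z.2))%:E.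

Let mf_hkT2 d' (T : measurableType d') (f g : T -> R) : measT f ->
  measT g -> measT (fun x => heat_scale N (f x) (g x)).
Proof. by move=> mf mg; rewrite /heat_scale; meas. Qed.

Let mwt2 d' (T : measurableType d') (g : T -> measurableTypeR R) l : measT g ->
  measT (fun x => weight N s e l (g x)).
Proof. by move=> mg; apply: (measurableT_comp (mf_weight _ _ _ _)). Qed.

Let mwtk l : measT (wtk l).
Proof. by apply: mf_EFin; apply: mf_mul; [apply: mwt2|apply: mf_hkT2; measv]. Qed.

Let wtk_ge0 l z : (0 <= wtk l z)%E.
Proof. by rewrite lee_fin mulr_ge0 ?expR_ge0// weight_ge0. Qed.

Let mHw l : measT (fun eta : 'rV[R]_d => weight_heat N s e l (sqn eta)).
Proof. exact: (measurable_fun_fubini_tonelli_F (m2 := leb) (wtk l) (mwtk l) (wtk_ge0 l)). Qed.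

Let mhw l : measT (hw l).
Proof.
have mP : measurable [set eta : 'rV[R]_d | 0 < sqn eta].
  have mq : measT (fun x : 'rV[R]_d => sqn x) by measv.
  rewrite (_ : mkset _ = (fun x : 'rV[R]_d => sqn x) @^-1` `]0, +oo[%classic); last first.
    by apply/seteqP; split => x /=; rewrite in_itv/= andbT.
  by rewrite -[X in measurable X]setTI; apply: mq.
rewrite (_ : hw l = fun eta => (if 0 < sqn eta then fine (weight_heat N s e l (sqn eta)) else 0) +
    (if ~~ (0 < sqn eta) then fine (weight_heat N s e l 1) else 0)); last first.
  by apply/funext => x; rewrite /hw; case: ifPn => _ /=; rewrite ?addr0 ?add0r.
apply: mf_add; apply: mf_if => //.
  by apply: measurableT_comp => //; exact: mHw.
rewrite (_ : mkset _ = ~` [set eta : 'rV[R]_d | 0 < sqn eta]); first exact: measurableC.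
by apply/seteqP; split => x /= /negP.
Qed.

(** [heat_scale] decreases in the squared distance, so the value taken at distance 1 can only be
    below the one at the origin. *)
Let hw_le l eta : ((hw l eta)%:E <= weight_heat N s e l (sqn eta))%E.
Proof.
rewrite /hw; case: ifPn => h; first by rewrite -(proj2 (Hw_fin l h)).
rewrite -(proj2 (Hw_fin l ltr01)).
have m1 rho : measT (fun z => (weight N s e l z * heat_scale N rho (expR z))%:E).
  by apply: mf_EFin; apply: mf_mul; [apply: mwt2|apply: mf_hkT2; meas].
rewrite /weight_heat; apply: le_integralT; [|exact: m1|exact: m1|].
  by move=> z; rewrite lee_fin mulr_ge0 ?expR_ge0// weight_ge0.
move=> z; rewrite lee_fin ler_wpM2l ?weight_ge0// ler_expR lerD2l lerN2 ler_wpM2r ?expR_ge0//.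
by rewrite ler_pM2r ?invr_gt0//; rewrite -leNgt in h; apply: (le_trans h).
Qed.

(* The semigroup property collapses the heat flow of the weight to a double integral over scales. *)
Let heat_weight l y xi : (\int[mu]_eta (hk (expR y) (xi - eta) * hw l eta)%:E <=
  \int[leb]_z (weight N s e l z * heat_scale N (sqn xi) (expR y + expR z))%:E)%E.
Proof.
have mhk : measT (fun eta : 'rV[R]_d => hk (expR y) (xi - eta)) by rewrite /hk; measv.
apply: (@le_trans _ _ (\int[mu]_eta ((hk (expR y) (xi - eta))%:E * weight_heat N s e l (sqn eta)))%E).
  apply: le_integralT.
  - by move=> eta; rewrite lee_fin mulr_ge0 ?hk_ge0// ltW.
  - by apply: mf_EFin; exact: mf_mul.
  - by apply: emeasurable_funM; [exact: mf_EFin|exact: mHw].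
  by move=> eta; rewrite EFinM lee_wpmul2l ?lee_fin ?hk_ge0.
pose f (z : 'rV[R]_d * measurableTypeR R) := (hk (expR y) (xi - z.1) * (weight N s e l z.2 * heat_scale N (sqn z.1) (expR z.2)))%:E.
have mf : measT f.
  apply: mf_EFin; apply: mf_mul; first by rewrite /hk; measv.
  by apply: mf_mul; [apply: mwt2|apply: mf_hkT2; measv].
have f0 z : (0 <= f z)%E by rewrite lee_fin mulr_ge0 ?hk_ge0// mulr_ge0 ?expR_ge0// weight_ge0.
have -> : (\int[mu]_eta ((hk (expR y) (xi - eta))%:E * weight_heat N s e l (sqn eta)) = \int[mu]_eta \int[leb]_z f (eta, z))%E.
  apply: eq_integral => eta _; rewrite /weight_heat -ge0_integralZlT; last 3 first.
  - by move=> z; rewrite lee_fin mulr_ge0 ?expR_ge0// weight_ge0.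
  - by apply: mf_EFin; apply: mf_mul; [apply: mwt2|apply: mf_hkT2; meas].
  - exact: hk_ge0.
  by apply: eq_integral => z _; rewrite -EFinM.
rewrite (@fubini_tonelli _ _ _ _ _ mu leb f mf f0); apply: eq_lee.
apply: eq_integral => z _.
transitivity (\int[mu]_eta ((weight N s e l z)%:E * (hk (expR y) (xi - eta) * hk (expR z) eta)%:E))%E.
  apply: eq_integral => eta _; rewrite /f/= -EFinM; congr EFin.
  by rewrite (hkE eta) ?expR_gt0// mulrCA.
rewrite ge0_integralZlT; last 3 first.
- by move=> eta; rewrite lee_fin mulr_ge0 ?hk_ge0.
- by apply: mf_EFin; rewrite /hk; measv.
- exact: weight_ge0.
by rewrite integral_hkM ?expR_gt0// -EFinM hkE// addr_gt0 ?expR_gt0.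
Qed.

Let DIE l rho : (\int[leb]_y ((expR (s * y))%:E * \int[leb]_z (weight N s e l z * heat_scale N rho (expR y + expR z))%:E) =
  riesz_heat N s rho (weight N s e l))%E.
Proof.
rewrite riesz_heat_iter; [|exact: mf_weight|by move=> z; exact: weight_ge0].
apply: eq_integral => y _; rewrite -ge0_integralZlT; last 3 first.
- by move=> z; rewrite lee_fin mulr_ge0 ?expR_ge0// weight_ge0.
- by apply: mf_EFin; apply: mf_mul; [exact: mwt2|apply: mf_hkT2; meas].
- exact: expR_ge0.
by apply: eq_integral => z _; rewrite -EFinM mulrCA mulrA.
Qed.

Let mDIz l : measT (fun z : measurableTypeR R * 'rV[R]_d => \int[leb]_w (weight N s e l w * heat_scale N (sqn z.2) (expR z.1 + expR w))%:E)%E.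
Proof.
  apply: (measurable_fun_fubini_tonelli_F (m2 := leb)
    (fun u : (measurableTypeR R * 'rV[R]_d) * measurableTypeR R => (weight N s e l u.2 * heat_scale N (sqn u.1.2) (expR u.1.1 + expR u.2))%:E)).
    apply: mf_EFin; apply: mf_mul; first by apply: mwt2.
    have m1 : measT (fun u : (measurableTypeR R * 'rV[R]_d) * measurableTypeR R => u.1.2) by apply: measurableT_comp.
    have m2 : measT (fun u : (measurableTypeR R * 'rV[R]_d) * measurableTypeR R => u.1.1) by apply: measurableT_comp.
    by apply: mf_hkT2; measv.
  by move=> u; rewrite lee_fin mulr_ge0 ?expR_ge0// weight_ge0.
Qed.

Let DI_ge0 l rho : (0 <= riesz_heat N s rho (weight N s e l))%E.
Proof. by apply: integral_ge0 => u _; rewrite lee_fin !mulr_ge0 ?expR_ge0// weight_ge0. Qed.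

Let mDI l : measT (fun xi : 'rV[R]_d => riesz_heat N s (sqn xi) (weight N s e l)).
Proof.
under eq_fun do rewrite -DIE.
apply: (measurable_fun_fubini_tonelli_G (m1 := leb) (fun z : measurableTypeR R * 'rV[R]_d =>
  ((expR (s * z.1))%:E * \int[leb]_w (weight N s e l w * heat_scale N (sqn z.2) (expR z.1 + expR w))%:E)%E)).
  by apply: emeasurable_funM; [measv|exact: mDIz].
move=> z; apply: mule_ge0; first by rewrite lee_fin expR_ge0.
by apply: integral_ge0 => w _; rewrite lee_fin mulr_ge0 ?expR_ge0// weight_ge0.
Qed.

(** At each scale [y], [gauss_gconv_le] is followed by the Schur test with weight [hw l]. Adding up
    the scales with the factor [expR (s * y)] and exchanging the integrals rebuilds [riesz_heat] at
    each frequency. *)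
Lemma hardy_schur (a b : 'rV[R]_d -> R) l dl : int a -> int b -> 0 < dl ->
  ((Gamma s)%:E * \int[mu]_x (enorm x `^ (- (2 * s)) * (gconv dl a x ^+ 2 + gconv dl b x ^+ 2))%:E <=
   ((2 * pi) ^+ d)%:E * \int[mu]_xi ((ftphi dl a b xi ^+ 2 / hw l xi)%:E * riesz_heat N s (sqn xi) (weight N s e l)))%E.
Proof.
move=> ia ib dl0; have mph := mf_ftphi dl ia ib; have ph0 := ftphi_ge0 dl a b.
set phi := ftphi dl a b in mph ph0 *.
have mg (c : 'rV[R]_d -> R) : int c -> measT (gconv dl c) by move=> ic; exact: mf_gconv.
apply: (le_trans (riesz_weight_le s0 _ _)).
- by apply: mf_add; apply: mf_exp; exact: mg.
- by move=> x; rewrite addr_ge0 ?sqr_ge0.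
have p0 : 0 <= (2 * pi) ^+ d :> R by rewrite exprn_ge0// mulr_ge0 ?pi_ge0.
pose f (z : measurableTypeR R * 'rV[R]_d) :=
  ((expR (s * z.1))%:E * ((phi z.2 ^+ 2 / hw l z.2)%:E * \int[leb]_w (weight N s e l w * heat_scale N (sqn z.2) (expR z.1 + expR w))%:E))%E.
have q0 xi : 0 <= phi xi ^+ 2 / hw l xi by rewrite divr_ge0 ?sqr_ge0// ltW.
have mq : measT (fun xi => phi xi ^+ 2 / hw l xi).
  by apply: mf_mul; [exact: mf_exp|apply: mf_inv => // x; exact: hw_gt0].
have I0 y xi : (0 <= \int[leb]_w (weight N s e l w * heat_scale N (sqn xi) (expR y + expR w))%:E)%E.
  by apply: integral_ge0 => w _; rewrite lee_fin mulr_ge0 ?expR_ge0// weight_ge0.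
have mI := mDIz l.
have mf : measT f.
  apply: emeasurable_funM; first by measv.
  apply: emeasurable_funM => //; apply: mf_EFin.
  by apply: (measurableT_comp mq).
have f0 z : (0 <= f z)%E by rewrite !mule_ge0 ?lee_fin ?expR_ge0.
have mqI y : measT (fun xi => (phi xi ^+ 2 / hw l xi)%:E * \int[leb]_w (weight N s e l w * heat_scale N (sqn xi) (expR y + expR w))%:E)%E.
  apply: emeasurable_funM; first exact: mf_EFin.
  exact: (measurableT_comp mI (pair1_measurable y)).
apply: (@le_trans _ _ (((2 * pi) ^+ d)%:E * \int[leb]_y \int[mu]_xi f (y, xi))%E).
  rewrite -ge0_integralZlT; last 3 first.
  - by move=> y; apply: integral_ge0 => xi _; exact: f0.
  - exact: (measurable_fun_fubini_tonelli_F (m2 := mu) f mf f0).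
  - exact: p0.
  apply: le_integralT.
  - by move=> y; rewrite mule_ge0 ?lee_fin ?expR_ge0// integral_ge0// => x _; rewrite lee_fin mulr_ge0 ?expR_ge0// addr_ge0 ?sqr_ge0.
  - apply: emeasurable_funM; first by meas.
    apply: (measurable_fun_fubini_tonelli_F (m2 := mu)
      (fun z : measurableTypeR R * 'rV[R]_d => (expR (- (expR z.1 * sqn z.2)) * (gconv dl a z.2 ^+ 2 + gconv dl b z.2 ^+ 2))%:E)).
      apply: mf_EFin; apply: mf_mul; first by measv.
      by apply: mf_add; apply: mf_exp; apply: (measurableT_comp (mg _ _)).
    by move=> z; rewrite lee_fin mulr_ge0 ?expR_ge0// addr_ge0 ?sqr_ge0.
  - apply: emeasurable_funM; first exact: measurable_cst.
    exact: (measurable_fun_fubini_tonelli_F (m2 := mu) f mf f0).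
  move=> y; rewrite /f/= ge0_integralZlT; last 3 first.
  - by move=> xi; rewrite mule_ge0 ?lee_fin.
  - exact: mqI.
  - exact: expR_ge0.
  rewrite muleCA lee_wpmul2l ?lee_fin ?expR_ge0//.
  apply: (le_trans (gauss_gconv_le (expR_gt0 y) dl0 ia ib)); rewrite -/phi.
  have mhk2 : measT (fun z : 'rV[R]_d * 'rV[R]_d => hk (expR y) (z.1 - z.2)) by rewrite /hk; measv.
  have -> : (\int[mu]_xi \int[mu]_eta (phi xi * phi eta * gk (expR y) (xi - eta))%:E =
     ((2 * pi) ^+ d)%:E * \int[mu]_xi \int[mu]_eta (phi xi * phi eta * hk (expR y) (xi - eta))%:E)%E.
    pose g (z : 'rV[R]_d * 'rV[R]_d) := (phi z.1 * phi z.2 * hk (expR y) (z.1 - z.2))%:E.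
    have mgg : measT g.
      apply: mf_EFin; apply: mf_mul => //.
      by apply: mf_mul; apply: (measurableT_comp mph).
    have g0 z : (0 <= g z)%E by rewrite lee_fin; apply: mulr_ge0 (hk_ge0 _ _); apply: mulr_ge0; exact: ph0.
    rewrite -ge0_integralZlT; last 3 first.
    - by move=> xi; apply: integral_ge0 => eta _; exact: (g0 (xi, eta)).
    - exact: (measurable_fun_fubini_tonelli_F (m2 := mu) g mgg g0).
    - exact: p0.
    apply: eq_integral => xi _; rewrite -ge0_integralZlT; last 3 first.
    - by move=> eta; exact: (g0 (xi, eta)).
    - exact: (measurableT_comp mgg (pair1_measurable xi)).
    - exact: p0.
    by apply: eq_integral => eta _; rewrite -EFinM gkE ?expR_gt0// mulrCA.
  rewrite lee_wpmul2l ?lee_fin//.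
  apply: (le_trans (@schur_test _ _ _ mu phi (hw l) (fun z => hk (expR y) (z.1 - z.2)) mph (mhw l) mhk2 ph0 (hw_gt0 l) _ _)).
  - by move=> z; exact: hk_ge0.
  - by move=> x x'; rewrite /= hkB.
  apply: le_integralT.
  - by move=> xi; rewrite mule_ge0 ?lee_fin// integral_ge0// => eta _; rewrite lee_fin mulr_ge0 ?hk_ge0// ltW.
  - apply: emeasurable_funM; first exact: mf_EFin.
    apply: (measurable_fun_fubini_tonelli_F (m2 := mu) (fun z : 'rV[R]_d * 'rV[R]_d => (hk (expR y) (z.1 - z.2) * hw l z.2)%:E)).
      by apply: mf_EFin; apply: mf_mul => //; apply: (measurableT_comp (mhw l)).
    by move=> z; rewrite lee_fin mulr_ge0 ?hk_ge0// ltW.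
  - exact: mqI.
  by move=> xi; apply: lee_wpmul2l; [rewrite lee_fin; exact: q0|exact: heat_weight].
rewrite (@fubini_tonelli _ _ _ _ _ leb mu f mf f0) lee_wpmul2l ?lee_fin//.
apply: eq_lee; apply: eq_integral => xi _.
rewrite -DIE -ge0_integralZlT; last 3 first.
- by move=> y; rewrite mule_ge0 ?lee_fin ?expR_ge0.
- apply: emeasurable_funM; first by meas.
  exact: (measurableT_comp mI (pair2_measurable xi)).
- exact: q0.
by apply: eq_integral => y _; rewrite /f/= muleCA.
Qed.

(** [hardy_schur] combined with [radial_gain] at [rho = sqn xi], multiplied by [phi xi ^+ 2 / H].
    The integrals may be infinite, so every term is placed on the side where it is added. *)
Lemma hardy_gain_gconv : exists eps B : R, [/\ 0 < eps, 0 < B &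
  forall (a b : 'rV[R]_d -> R) l dl, int a -> int b -> 0 < dl ->
  ((hardy_const d s)%:E * \int[mu]_x (enorm x `^ (- (2 * s)) * (gconv dl a x ^+ 2 + gconv dl b x ^+ 2))%:E +
   ((2 * pi) ^+ d)%:E * ((eps * expR (e * l))%:E * \int[mu]_xi (enorm xi `^ (2 * (s - e)) * ftphi dl a b xi ^+ 2)%:E) <=
   ((2 * pi) ^+ d)%:E * (\int[mu]_xi (enorm xi `^ (2 * s) * ftphi dl a b xi ^+ 2)%:E +
     (B * expR (s * l))%:E * \int[mu]_xi (ftphi dl a b xi ^+ 2)%:E))%E].
Proof.
have [eps [B [eps0 B0 h]]] := radial_gain s0 e0 eb es.
exists eps, B; split => // a b l dl ia ib dl0.
have hs := hardy_schur l ia ib dl0.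
have mph := mf_ftphi dl ia ib.
set phi := ftphi dl a b in hs mph *.
have G0 : 0 < Gamma s by exact: Gamma_gt0.
have hc0 : 0 < hardy_const d s by exact: (hardy_const_gt0 s0 e0 eb).
set F := (\int[mu]_x _)%E in hs *.
have C0 : 0 <= hardy_const d s / Gamma s by apply: divr_ge0; exact: ltW.
have p0 : 0 <= (2 * pi) ^+ d :> R by rewrite exprn_ge0// mulr_ge0 ?pi_ge0.
have -> : ((hardy_const d s)%:E * F = (hardy_const d s / Gamma s)%:E * ((Gamma s)%:E * F))%E.
  by rewrite muleA -EFinM; congr (_%:E * _)%E; rewrite mulfVK// gt_eqF.
apply: (le_trans (leeD (lee_wpmul2l _ hs) (lexx _))); first by rewrite lee_fin.
rewrite muleCA -ge0_muleDr; last 2 first.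
- apply: mule_ge0; first by rewrite lee_fin.
  apply: integral_ge0 => xi _; apply: mule_ge0 => //.
  by rewrite lee_fin; apply: divr_ge0; [exact: sqr_ge0|exact: ltW].
- apply: mule_ge0; first by rewrite lee_fin; apply: mulr_ge0; [exact: ltW|exact: expR_ge0].
  by apply: integral_ge0 => xi _; rewrite lee_fin; apply: mulr_ge0; [exact: powR_ge0|exact: sqr_ge0].
apply: lee_wpmul2l; first by rewrite lee_fin.
have m2 : measT (fun xi => phi xi ^+ 2) by exact: mf_exp.
have mE t : measT (fun xi => (enorm xi `^ t * phi xi ^+ 2)%:E).
  by apply: mf_EFin; apply: mf_mul => //; exact: mf_enorm_powR.
have E0 t xi : (0 <= (enorm xi `^ t * phi xi ^+ 2)%:E)%E.
  by rewrite lee_fin; apply: mulr_ge0; [exact: powR_ge0|exact: sqr_ge0].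
have m2E : measT (fun xi => (phi xi ^+ 2)%:E) by exact: mf_EFin.
have p2 xi : (0 <= (phi xi ^+ 2)%:E)%E by rewrite lee_fin sqr_ge0.
have k1 : 0 <= eps * expR (e * l) by apply: mulr_ge0; [exact: ltW|exact: expR_ge0].
have k2 : 0 <= B * expR (s * l) by apply: mulr_ge0; [exact: ltW|exact: expR_ge0].
have q0 xi : 0 <= phi xi ^+ 2 / hw l xi by apply: divr_ge0; [exact: sqr_ge0|exact: ltW].
have mq : measT (fun xi => phi xi ^+ 2 / hw l xi).
  by apply: mf_mul => //; apply: mf_inv => // x; exact: hw_gt0.
pose qD xi := ((phi xi ^+ 2 / hw l xi)%:E * riesz_heat N s (sqn xi) (weight N s e l))%E.
have mqD : measT qD by apply: emeasurable_funM; [exact: mf_EFin|exact: mDI].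
have qD0 xi : (0 <= qD xi)%E by apply: mule_ge0; [rewrite lee_fin; exact: q0|exact: DI_ge0].
have mZ r (u : 'rV[R]_d -> \bar R) : measT u -> measT (fun xi => r%:E * u xi)%E.
  by move=> mu_; apply: emeasurable_funM => //; exact: measurable_cst.
have Z0 (r : R) (u : 'rV[R]_d -> \bar R) : 0 <= r -> (forall xi, 0 <= u xi)%E -> (forall xi, 0 <= r%:E * u xi)%E.
  by move=> r0 u0 xi; apply: mule_ge0 => //; rewrite lee_fin.
rewrite -(ge0_integralZlT _ qD0 mqD C0) -(ge0_integralZlT _ (E0 _) (mE _) k1) -(ge0_integralZlT _ p2 m2E k2).
rewrite -(ge0_integralDT _ (Z0 _ _ C0 qD0) (mZ _ _ mqD) (Z0 _ _ k1 (E0 _)) (mZ _ _ (mE _))).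
rewrite -(ge0_integralDT _ (E0 _) (mE _) (Z0 _ _ k2 p2) (mZ _ _ m2E)).
apply: ae_ge0_le_integral => //.
- by move=> xi _; apply: adde_ge0; [exact: (Z0 _ _ C0 qD0)|exact: (Z0 _ _ k1 (E0 _))].
- by apply: emeasurable_funD; [exact: (mZ _ _ mqD)|exact: (mZ _ _ (mE _))].
- by move=> xi _; apply: adde_ge0; [exact: E0|exact: (Z0 _ _ k2 p2)].
- by apply: emeasurable_funD; [exact: mE|exact: (mZ _ _ m2E)].
(* [radial_gain] needs a positive [rho], so the integrands are compared away from the origin
   only. *)
have [A [mA A0 hA]] := ae_sqn_gt0 (R := R) d0.
exists A; split => //; apply: subset_trans hA => xi /= hn hx; apply: hn => _.
have [H [J [HE JE H0 hJ]]] := h l _ hx.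
have hwE : hw l xi = H by rewrite /hw hx HE.
rewrite /qD JE hwE !enorm_powR// -!EFinM -!EFinD lee_fin.
have P0 : 0 <= phi xi ^+ 2 / H by apply: divr_ge0; [exact: sqr_ge0|exact: ltW].
have := ler_wpM2r P0 hJ; rewrite -subr_ge0 => hJ2; rewrite -subr_ge0; apply: (le_trans hJ2).
apply: eq_lee.
move: (hardy_const d s / Gamma s) => X; field.
by rewrite gt_eqF.
Qed.

End hardy_gain.

(** * The heat flow at small times *)

Section heat_approx.
Context {R : realType} (n : nat).
Local Notation mu := (@lebesgue_rV R n).
Local Notation int f := (mu.-integrable setT (fun x => (f x)%:E)).

Definition hconv (t : R) (a : 'rV[R]_n -> R) (x : 'rV[R]_n) : R :=
  \int[mu]_y (a y * hk t (x - y)).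

Lemma mf_hk t (x : 'rV[R]_n) : measT (fun y : 'rV[R]_n => hk t (x - y)).
Proof. by rewrite /hk; measv. Qed.

Lemma integrable_hk t (x : 'rV[R]_n) : 0 < t -> int (fun y : 'rV[R]_n => hk t (x - y)).
Proof.
move=> t0; apply/integrableP; split; first by apply: mf_EFin; exact: mf_hk.
under eq_integral => y _ do rewrite /= ger0_norm ?hk_ge0// hkB.
by rewrite integral_hk// ltry.
Qed.

Lemma Rintegral_hk t (x : 'rV[R]_n) : 0 < t -> \int[mu]_y hk t (x - y) = 1.
Proof.
move=> t0; rewrite /Rintegral; under eq_integral => y _ do rewrite hkB.
by rewrite integral_hk.
Qed.

Lemma integrable_hconv t a x : 0 < t -> int a -> int (fun y => a y * hk t (x - y)).
Proof.
move=> t0 ia; have p0 : 0 < (2 * pi) ^+ n :> R by exact: exp2pi_gt0.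
apply: eq_integrable (integrableRZ ((2 * pi) ^+ n)^-1 (integrable_gconv x t0 ia)) => // y _; congr EFin.
by rewrite gkE// mulrCA mulKf// gt_eqF.
Qed.

Lemma gconv_hconv t a x : 0 < t -> int a -> gconv t a x = (2 * pi) ^+ n * hconv t a x.
Proof.
move=> t0 ia; rewrite /hconv -RintegralZl//; last exact: integrable_hconv.
by apply: eq_Rintegral => y _; rewrite gkE// mulrCA.
Qed.

Lemma mf_hconv t a : 0 < t -> int a -> measT (hconv t a).
Proof.
move=> t0 ia; have p0 : 0 < (2 * pi) ^+ n :> R by exact: exp2pi_gt0.
rewrite (_ : hconv t a = fun x => ((2 * pi) ^+ n)^-1 * gconv t a x).
  by apply: mf_mul => //; exact: mf_gconv.
by apply/funext => x; rewrite gconv_hconv// mulKf// gt_eqF.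
Qed.

Lemma hconv_le t a x K : 0 < t -> int a -> (forall y, `|a y| <= K) -> `|hconv t a x| <= K.
Proof.
move=> t0 ia aK; rewrite (le_trans (le_normr_Rintegral _ _))//; first exact: integrable_hconv.
rewrite -[leRHS]mulr1 -(Rintegral_hk x t0) -RintegralZl//; last exact: integrable_hk.
apply: le_Rintegral => //.
- by apply: integrable_abs; exact: integrable_hconv.
- by apply: integrableRZ; exact: integrable_hk.
by move=> y _; rewrite normrM (ger0_norm (hk_ge0 _ _)) ler_wpM2r ?hk_ge0.
Qed.

(** Half of the exponent pays for the distance; the other half is the heat kernel at the doubled
    time, again of integral 1, up to a power of 2 from the normalization. *)
Lemma hk_tail t r (z : 'rV[R]_n) : 0 < t -> r <= sqn z ->
  hk t z <= 2 `^ (n%:R / 2) * expR (- (r / (8 * t))) * hk (2 * t) z.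
Proof.
move=> t0 rz; rewrite /hk.
have p0 := @pi_gt0 R.
have -> : (4 * pi * (2 * t)) `^ (- (n%:R / 2)) = 2 `^ (- (n%:R / 2)) * (4 * pi * t) `^ (- (n%:R / 2)).
  by rewrite -powRM ?mulr_ge0 ?(ltW p0) ?(ltW t0)//; congr (_ `^ _); ring.
have -> : 2 `^ (n%:R / 2) * expR (- (r / (8 * t))) *
   (2 `^ (- (n%:R / 2)) * (4 * pi * t) `^ (- (n%:R / 2)) * expR (- (sqn z / (4 * (2 * t))))) =
  (2 `^ (n%:R / 2) * 2 `^ (- (n%:R / 2))) * ((4 * pi * t) `^ (- (n%:R / 2)) * (expR (- (r / (8 * t))) * expR (- (sqn z / (4 * (2 * t)))))) by ring.
rewrite -powRD ?pnatr_eq0 ?implybT// subrr powRr0 mul1r ler_wpM2l ?powR_ge0//.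
rewrite -expRD ler_expR -opprD lerN2.
have -> : sqn z / (4 * t) = sqn z / (8 * t) + sqn z / (4 * (2 * t)) by field; rewrite gt_eqF.
by rewrite lerD2r ler_wpM2r// invr_ge0 mulr_ge0// ltW.
Qed.

Lemma sqn_ball (x y : 'rV[R]_n) r : 0 < r -> sqn (x - y) < r ^+ 2 -> ball x r y.
Proof.
move=> r0 h; split => // i j; rewrite (ord1 i) /ball/=.
have : (x 0 j - y 0 j) ^+ 2 < r ^+ 2.
  apply: le_lt_trans h; rewrite /sqn (bigD1 j)//= !mxE lerDl.
  by apply: sumr_ge0 => k _; exact: sqr_ge0.
by rewrite -(real_normK (num_real (x 0 j - y 0 j))) ltr_pXn2r ?nnegrE// ltW.
Qed.

(** Split at a radius [r] of continuity: inside, [a] varies by at most [eps / 2]; outside, [hk_tail]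
    leaves an error of order [t / r ^+ 2]. *)
Lemma cvg_hconv (a : 'rV[R]_n -> R) K x : int a -> (forall y, `|a y| <= K) ->
  {for x, continuous a} -> hconv m.+1%:R^-1 a x @[m --> \oo] --> a x.
Proof.
move=> ia aK ca.
apply/cvgrPdist_le => eps eps0.
have e20 : 0 < eps / 2 by rewrite divr_gt0.
have : nbhs x [set y | `|a x - a y| <= eps / 2].
  by have /cvgrPdist_le/(_ _ e20) := ca.
move=> /nbhs_ballP[r /= r0 hr].
have K0 : 0 <= K by rewrite (le_trans _ (aK 0)).
(* [2 * K] bounds the oscillation of [a], the power of 2 comes from [hk_tail], and the last factor
   from [expR (- X) <= X^-1] at [X = r ^+ 2 / (8 * t)]. *)
pose C := 2 * K * 2 `^ (n%:R / 2) * (8 / r ^+ 2).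
have C0 : 0 <= C by rewrite !mulr_ge0 ?powR_ge0// ?invr_ge0 ?sqr_ge0.
have hC : (C * harmonic m) @[m --> \oo] --> (0 : R).
  by rewrite -[X in _ --> X](mulr0 C); apply: cvgM; [exact: cvg_cst|exact: cvg_harmonic].
near=> m.
have t0 : 0 < m.+1%:R^-1 :> R by rewrite invr_gt0.
set t := m.+1%:R^-1 in t0 *.
have t20 : 0 < 2 * t by rewrite mulr_gt0.
pose c := 2 * K * (2 `^ (n%:R / 2) * expR (- (r ^+ 2 / (8 * t)))).
have c0 : 0 <= c by rewrite !mulr_ge0 ?powR_ge0 ?expR_ge0.
have cC : c <= C * t.
  have hx : expR (- (r ^+ 2 / (8 * t))) <= 8 / r ^+ 2 * t.
    have X0 : 0 < r ^+ 2 / (8 * t) by rewrite divr_gt0 ?exprn_gt0// mulr_gt0.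
    have -> : 8 / r ^+ 2 * t = (r ^+ 2 / (8 * t))^-1 by rewrite invf_div mulrAC.
    move: (r ^+ 2 / (8 * t)) X0 => X X0; rewrite expRN lef_pV2 ?posrE ?expR_gt0//.
    by have := expR_ge1Dx X; lra.
  rewrite /c /C -[leRHS]mulrA -[leRHS]mulrA ler_wpM2l ?mulr_ge0//.
  by rewrite ler_wpM2l ?powR_ge0.
have ih := integrable_hk x t0; have ih2 := integrable_hk x t20.
have -> : a x - hconv t a x = \int[mu]_y ((a x - a y) * hk t (x - y)).
  rewrite -[X in X - _]mulr1 -(Rintegral_hk x t0) -RintegralZl// /hconv -RintegralB//; last 2 first.
  - exact: integrableRZ.
  - exact: integrable_hconv.
  by apply: eq_Rintegral => y _; rewrite mulrBl.
have i1 : int (fun y => (a x - a y) * hk t (x - y)).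
  apply: eq_integrable (integrableRB (integrableRZ (a x) ih) (integrable_hconv x t0 ia)) => // y _.
  by rewrite mulrBl.
rewrite (le_trans (le_normr_Rintegral _ _))//.
apply: (@le_trans _ _ (\int[mu]_y (eps / 2 * hk t (x - y) + c * hk (2 * t) (x - y)))).
  apply: le_Rintegral => //; first exact: integrable_abs.
    by apply: integrableRD; exact: integrableRZ.
  move=> y _; rewrite normrM (ger0_norm (hk_ge0 _ _)).
  have [h|h] := ltP (sqn (x - y)) (r ^+ 2).
    have /hr /= hh := sqn_ball r0 h.
    apply: (@le_trans _ _ (eps / 2 * hk t (x - y))); first by rewrite ler_wpM2r ?hk_ge0.
    by rewrite lerDl mulr_ge0 ?hk_ge0.
  apply: (@le_trans _ _ (c * hk (2 * t) (x - y))); last by rewrite lerDr mulr_ge0 ?hk_ge0// ltW.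
  rewrite /c -[leRHS]mulrA; apply: ler_pM => //; first exact: hk_ge0.
    by rewrite (le_trans (ler_normB _ _))// (_ : 2 * K = K + K) ?lerD//; ring.
  exact: hk_tail.
rewrite RintegralD//; [|exact: (integrableRZ _ ih)|exact: (integrableRZ _ ih2)].
rewrite (RintegralZl _ measurableT ih) (RintegralZl _ measurableT ih2) (Rintegral_hk x t0) (Rintegral_hk x t20) !mulr1.
rewrite [leRHS](splitr eps) lerD2l (le_trans cC)//.
rewrite (_ : C * t = C * harmonic m)//.
near: m.
have /cvgrPdist_le/(_ _ e20) := hC.
apply: filterS => m /=; rewrite sub0r normrN; apply: le_trans; exact: ler_norm.
Unshelve. all: by end_near.
Qed.

End heat_approx.

Lemma EFin_Rintegral d (T : measurableType d) (R : realType) (mu : {measure set T -> \bar R}) (f : T -> R) :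
  mu.-integrable setT (fun x => (f x)%:E) -> ((\int[mu]_x f x)%:E = \int[mu]_x (f x)%:E)%E.
Proof. by move=> i; rewrite /Rintegral fineK// integrable_fin_num. Qed.

(** * Continuous functions with Gaussian decay *)

Section gauss_bounded.
Context {R : realType} (d : nat).
Local Notation mu := (@lebesgue_rV R d).
Local Notation int f := (mu.-integrable setT (fun x => (f x)%:E)).

Lemma mf_continuous (f : 'rV[R]_d -> R) : continuous f -> measT f.
Proof.
move=> cf; apply: (measurability _ (RGenOpens.measurableE R)).
move=> _ [_ [u [v ->] <-]]; rewrite setTI; apply: open_measurable_rV.
by move/continuousP : cf; apply; exact: interval_open.
Qed.

(** Replaces test functions in all the estimates: it makes [a], its square and its products with
    bounded functions integrable, and the Hardy integral finite. *)
Definition gauss_bounded (K : R) (a : 'rV[R]_d -> R) : Prop :=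
  continuous a /\ forall x, `|a x| <= K * expR (- (1 * sqn x)).

Variables (K : R) (a : 'rV[R]_d -> R).
Hypothesis ha : gauss_bounded K a.

Lemma gauss_bounded_mf : measT a.
Proof. by apply: mf_continuous; case: ha. Qed.

Lemma gauss_bounded_K : 0 <= K.
Proof.
have [_ /(_ 0)] := ha; move/(le_trans (normr_ge0 _)).
by rewrite pmulr_lge0 ?expR_gt0.
Qed.

Lemma gauss_bounded_le x : `|a x| <= K.
Proof.
have [_ /(_ x)/le_trans] := ha; apply.
by rewrite ler_piMr ?gauss_bounded_K// expR_le1 oppr_le0 mul1r sqn_ge0.
Qed.

Lemma gauss_bounded_int : int a.
Proof.
have [_ aK] := ha; apply: integrable_dom aK; first exact: (integrableRZ K (integrable_gauss_rV0 d ltr01)).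
exact: gauss_bounded_mf.
Qed.

Lemma integrable_bounded_mul (f : 'rV[R]_d -> R) C : measT f ->
  (forall x, `|f x| <= C) -> int (fun x => a x * f x).
Proof.
move=> mf fC; apply: (integrable_dom (integrableRZ C (integrable_abs gauss_bounded_int))).
  exact: mf_mul gauss_bounded_mf mf.
by move=> x; rewrite normrM mulrC ler_wpM2r.
Qed.

Lemma integrable_sqr_gauss_bounded : int (fun x => a x ^+ 2).
Proof.
apply: eq_integrable (integrable_bounded_mul gauss_bounded_mf gauss_bounded_le) => // x _.
Qed.

Lemma integrable_mul_hconv t : 0 < t -> int (fun x => a x * hconv t a x).
Proof.
move=> t0; apply: (@integrable_bounded_mul _ K); first exact: (mf_hconv t0 gauss_bounded_int).
by move=> x; apply: (hconv_le x t0 gauss_bounded_int) => y; exact: gauss_bounded_le.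
Qed.

Lemma cvg_hconv_gauss_bounded x : hconv m.+1%:R^-1 a x @[m --> \oo] --> a x.
Proof.
by apply: (cvg_hconv gauss_bounded_int gauss_bounded_le); have [ca _] := ha; exact: ca.
Qed.

(** Jensen's inequality for the probability density [hk t (x - y)], in the form of a nonnegative
    variance around the mean [c]. *)
Lemma sqr_hconv_le t x : 0 < t -> hconv t a x ^+ 2 <= hconv t (fun y => a y ^+ 2) x.
Proof.
move=> t0; pose c := hconv t a x.
have i2 := integrable_hconv x t0 integrable_sqr_gauss_bounded.
have i1 := integrable_hconv x t0 gauss_bounded_int.
have i0 := integrable_hk x t0.
have : 0 <= \int[mu]_y ((a y - c) ^+ 2 * hk t (x - y)).
  by apply: Rintegral_ge0 => y _; rewrite mulr_ge0 ?sqr_ge0 ?hk_ge0.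
have -> : \int[mu]_y ((a y - c) ^+ 2 * hk t (x - y)) =
   \int[mu]_y ((a y ^+ 2 * hk t (x - y) - 2 * c * (a y * hk t (x - y))) + c ^+ 2 * hk t (x - y)).
  by apply: eq_Rintegral => y _; ring.
rewrite (RintegralD measurableT (integrableRB i2 (integrableRZ (2 * c) i1)) (integrableRZ (c ^+ 2) i0)).
rewrite (RintegralB measurableT i2 (integrableRZ (2 * c) i1)).
rewrite (RintegralZl _ measurableT i1) (RintegralZl _ measurableT i0) (Rintegral_hk x t0).
rewrite -/(hconv t a x) -/(hconv t (fun y => a y ^+ 2) x) -/c; move: (hconv _ _ _) => A.
by move=> h; rewrite -subr_ge0; move: h; congr (0 <= _); ring.
Qed.

Lemma hconv_sqr_contraction t : 0 < t ->
  (\int[mu]_x (hconv t a x ^+ 2)%:E <= \int[mu]_x (a x ^+ 2)%:E)%E.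
Proof.
move=> t0; have i2 := integrable_sqr_gauss_bounded.
apply: (@le_trans _ _ (\int[mu]_x (hconv t (fun y => a y ^+ 2) x)%:E)%E).
  apply: le_integralT.
  - by move=> x; rewrite lee_fin sqr_ge0.
  - by apply: mf_EFin; apply: mf_exp; exact: (mf_hconv t0 gauss_bounded_int).
  - by apply: mf_EFin; exact: (mf_hconv t0 i2).
  - by move=> x; rewrite lee_fin sqr_hconv_le.
pose f (p : 'rV[R]_d * 'rV[R]_d) := (a p.2 ^+ 2 * hk t (p.1 - p.2))%:E.
have mf : measT f.
  apply: mf_EFin; apply: mf_mul; last by rewrite /hk; measv.
  by apply: mf_exp; exact: (measurableT_comp gauss_bounded_mf measurable_snd).
have f0 p : (0 <= f p)%E by rewrite lee_fin mulr_ge0 ?sqr_ge0 ?hk_ge0.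
under eq_integral => x _ do rewrite /hconv (EFin_Rintegral (integrable_hconv x t0 i2)).
rewrite (@fubini_tonelli _ _ _ _ _ mu mu f mf f0) /f/=.
apply: le_integralT.
- by move=> x; apply: integral_ge0 => y _; exact: (f0 (y, x)).
- exact: (measurable_fun_fubini_tonelli_G (m1 := mu) f mf f0).
- by apply: mf_EFin; apply: mf_exp; exact: gauss_bounded_mf.
move=> y; under eq_integral => x _ do rewrite EFinM.
rewrite ge0_integralZlT; last 3 first.
- by move=> x; rewrite lee_fin hk_ge0.
- by apply: mf_EFin; rewrite /hk; measv.
- exact: sqr_ge0.
by rewrite integral_hk// mule1.
Qed.

(** Expand the square and bound its last term by the contraction property. What remains is the
    defect [mass - heat_mass], which has a formula in terms of the transform. *)
Lemma dist_hconv_le t : 0 < t ->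
  int (fun x => (a x - hconv t a x) ^+ 2) /\
  \int[mu]_x ((a x - hconv t a x) ^+ 2) <= 2 * (\int[mu]_x (a x ^+ 2) - \int[mu]_x (a x * hconv t a x)).
Proof.
move=> t0; have i2 := integrable_sqr_gauss_bounded; have i1 := integrable_mul_hconv t0.
have mh := mf_hconv t0 gauss_bounded_int.
have ih : int (fun x => hconv t a x ^+ 2).
  apply/integrableP; split; first by apply: mf_EFin; exact: mf_exp.
  under eq_integral => x _ do rewrite /= ger0_norm ?sqr_ge0//.
  apply: (le_lt_trans (hconv_sqr_contraction t0)).
  by rewrite -(EFin_Rintegral i2) ltry.
have E x : (a x - hconv t a x) ^+ 2 = (a x ^+ 2 - 2 * (a x * hconv t a x)) + hconv t a x ^+ 2 by ring.
have iE := integrableRD (integrableRB i2 (integrableRZ 2 i1)) ih.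
split; first by apply: eq_integrable iE => // x _; rewrite E.
under eq_Rintegral => x _ do rewrite E.
rewrite (RintegralD measurableT (integrableRB i2 (integrableRZ 2 i1)) ih) (RintegralB measurableT i2 (integrableRZ 2 i1)) (RintegralZl _ measurableT i1).
have : \int[mu]_x (hconv t a x ^+ 2) <= \int[mu]_x (a x ^+ 2).
  by rewrite -lee_fin !EFin_Rintegral//; exact: hconv_sqr_contraction.
lra.
Qed.

End gauss_bounded.

(** * Plancherel's identity and the Sobolev norms *)

Section plancherel.
Context {R : realType} (d : nat).
Local Notation mu := (@lebesgue_rV R d).
Local Notation int f := (mu.-integrable setT (fun x => (f x)%:E)).
Variables (K : R) (a b : 'rV[R]_d -> R).
Hypotheses (ha : gauss_bounded K a) (hb : gauss_bounded K b).

Let ia := gauss_bounded_int ha.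
Let ib := gauss_bounded_int hb.

Definition mass : R := \int[mu]_x (a x ^+ 2 + b x ^+ 2).
Definition heat_mass (t : R) : R := \int[mu]_x (a x * hconv t a x + b x * hconv t b x).

Lemma integrable_mass : int (fun x => a x ^+ 2 + b x ^+ 2).
Proof. exact: integrableRD (integrable_sqr_gauss_bounded ha) (integrable_sqr_gauss_bounded hb). Qed.

Lemma massE : mass = \int[mu]_x (a x ^+ 2) + \int[mu]_x (b x ^+ 2).
Proof. exact: RintegralD (integrable_sqr_gauss_bounded ha) (integrable_sqr_gauss_bounded hb). Qed.

Lemma integrable_heat_mass t : 0 < t -> int (fun x => a x * hconv t a x + b x * hconv t b x).
Proof. by move=> t0; exact: integrableRD (integrable_mul_hconv ha t0) (integrable_mul_hconv hb t0). Qed.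

Lemma heat_massE t : 0 < t ->
  heat_mass t = \int[mu]_x (a x * hconv t a x) + \int[mu]_x (b x * hconv t b x).
Proof. by move=> t0; exact: RintegralD (integrable_mul_hconv ha t0) (integrable_mul_hconv hb t0). Qed.

Lemma integral_gauss_ftsq t : 0 < t ->
  (\int[mu]_xi (expR (- (t * sqn xi)) * ftsq a b xi)%:E = ((2 * pi) ^+ d * heat_mass t)%:E)%E.
Proof.
move=> t0; rewrite -(EFin_Rintegral (integrable_gauss_ftsq t0 ia ib)) gauss_ftsq//.
rewrite /heat_mass -RintegralZl//; last exact: integrable_heat_mass.
by congr EFin; apply: eq_Rintegral => x _; rewrite !gconv_hconv//; ring.
Qed.

Lemma cvg_heat_mass : ((heat_mass m.+1%:R^-1)%:E @[m --> \oo] --> mass%:E)%E.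
Proof.
have t0 m : 0 < m.+1%:R^-1 :> R by rewrite invr_gt0.
rewrite /mass (EFin_Rintegral integrable_mass).
under eq_fun do rewrite /heat_mass (EFin_Rintegral (integrable_heat_mass (t0 _))).
pose g x := (K * `|a x| + K * `|b x|)%:E.
apply: (@dominated_cvg _ _ _ mu setT measurableT _ _ g).
- by move=> m; exact: measurable_int (integrable_heat_mass (t0 m)).
- move=> x _; apply: cvg_EFin; first by apply: nearW.
  apply: cvgD; rewrite expr2; apply: cvgM; (try exact: cvg_cst).
    exact: (cvg_hconv_gauss_bounded ha).
  exact: (cvg_hconv_gauss_bounded hb).
- by [].
- by apply: integrableRD; apply: integrableRZ; exact: integrable_abs.
- move=> m x _; rewrite lee_fin (le_trans (ler_normD _ _))// !normrM.
  rewrite ![K * _]mulrC; apply: lerD; rewrite ler_wpM2l//.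
    exact: (hconv_le x (t0 m) ia (gauss_bounded_le ha)).
  exact: (hconv_le x (t0 m) ib (gauss_bounded_le hb)).
Qed.

Lemma cvg_gauss_factor (X : R) : expR (- (m.+1%:R^-1 * X)) @[m --> \oo] --> (1 : R).
Proof.
have E : 1 = expR (- (0 * X)) by rewrite mul0r oppr0 expR0.
rewrite [X in _ --> X]E; apply: continuous_cvg; first exact: continuous_expR.
apply: cvgN; apply: cvgM; last exact: cvg_cst.
exact: cvg_harmonic.
Qed.

(** [integral_gauss_ftsq] at the times [1 / (m + 1)]: the left side increases to the integral by
    monotone convergence, the right side converges by [cvg_heat_mass]. *)
Lemma plancherel : (\int[mu]_xi (ftsq a b xi)%:E = ((2 * pi) ^+ d * mass)%:E)%E.
Proof.
have t0 m : 0 < m.+1%:R^-1 :> R by rewrite invr_gt0.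
pose f m xi := (expR (- (m.+1%:R^-1 * sqn xi)) * ftsq a b xi)%:E.
have mf m : measT (f m).
  by apply: mf_EFin; apply: mf_mul; [measv|exact: mf_ftsq].
have f0 m xi : setT xi -> (0 <= f m xi)%E.
  by move=> _; rewrite lee_fin mulr_ge0 ?expR_ge0 ?ftsq_ge0.
have nf xi : setT xi -> nondecreasing_seq (f ^~ xi).
  move=> _ n m nm; rewrite lee_fin ler_wpM2r ?ftsq_ge0// ler_expR lerN2 ler_wpM2r ?sqn_ge0//.
  by rewrite lef_pV2 ?posrE// ler_nat.
have := @cvg_monotone_convergence _ _ _ mu setT measurableT f mf f0 nf.
under [X in X @ \oo]eq_fun do rewrite /f (integral_gauss_ftsq (t0 _)).
have -> : (\int[mu]_xi limn (f ^~ xi) = \int[mu]_xi (ftsq a b xi)%:E)%E.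
  apply: eq_integral => xi _; apply: cvg_lim => //; rewrite /f.
  apply: cvg_EFin; first by apply: nearW.
  rewrite -[X in _ --> X]mul1r; apply: cvgM; last exact: cvg_cst.
  exact: cvg_gauss_factor.
move=> h; have h2 : ((2 * pi) ^+ d * heat_mass m.+1%:R^-1)%:E @[m --> \oo] --> ((2 * pi) ^+ d * mass)%:E.
  under eq_fun do rewrite EFinM.
  rewrite EFinM; apply: cvgeZl => //; exact: cvg_heat_mass.
by rewrite -(cvg_lim _ h)// (cvg_lim _ h2).
Qed.

(** Carries the factor [(2 * pi) ^+ d] of the unnormalized transform. It is extended-valued:
    finiteness at order [s - e] will follow from the Hardy inequality, and an infinite value at
    order [s] makes the theorem trivial. *)
Definition sobsq (t : R) : \bar R := (\int[mu]_xi (enorm xi `^ (2 * t) * ftsq a b xi)%:E)%E.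

Lemma sobsq_ge0 t : (0 <= sobsq t)%E.
Proof. by apply: integral_ge0 => x _; rewrite lee_fin mulr_ge0 ?powR_ge0 ?ftsq_ge0. Qed.

(** [1 - expR (- X)] is at most 1 and at most [X], hence at most [X^r]. *)
Lemma one_sub_expR_le (X r : R) : 0 < X -> 0 <= r <= 1 -> 1 <= expR (- X) + expR (r * ln X).
Proof.
move=> X0 /andP[r0 r1]; have [X1|X1] := leP 1 X.
  have y0 : 0 <= r * ln X by rewrite mulr_ge0// ln_ge0.
  by have := expR_ge1Dx (r * ln X); have := expR_ge0 (- X); move: (expR _) (expR _) y0 => e1 e2; lra.
have : X <= expR (r * ln X).
  rewrite -[leLHS](lnK (_ : X \in Num.pos))// ler_expR.
  by have : ln X <= 0 by [rewrite ln_le0// ltW]; nra.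
by have := expR_ge1Dx (- X); lra.
Qed.

(** [one_sub_expR_le] at [X = t * sqn xi], integrated against |u^|^2: the mass lost by time [t] is
    controlled by the norm of order [r]. *)
Lemma mass_le_heat_mass t r : (0 < d)%N -> 0 < t -> 0 <= r <= 1 ->
  (((2 * pi) ^+ d * mass)%:E <= ((2 * pi) ^+ d * heat_mass t)%:E + (expR (r * ln t))%:E * sobsq r)%E.
Proof.
move=> d0 t0 r01; rewrite -plancherel -(integral_gauss_ftsq t0) /sobsq.
have mE := mf_ftsq ia ib.
have m2 : measT (fun xi : 'rV[R]_d => (enorm xi `^ (2 * r) * ftsq a b xi)%:E).
  by apply: mf_EFin; apply: mf_mul => //; exact: mf_enorm_powR.
have p2 xi : (0 <= (enorm xi `^ (2 * r) * ftsq a b xi)%:E)%E.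
  by rewrite lee_fin mulr_ge0 ?powR_ge0 ?ftsq_ge0.
rewrite -ge0_integralZlT; last 3 first.
- exact: p2.
- exact: m2.
- exact: expR_ge0.
have m1 : measT (fun xi : 'rV[R]_d => (expR (- (t * sqn xi)) * ftsq a b xi)%:E).
  by apply: mf_EFin; apply: mf_mul => //; measv.
have p1 (xi : 'rV[R]_d) : (0 <= (expR (- (t * sqn xi)) * ftsq a b xi)%:E)%E.
  by rewrite lee_fin mulr_ge0 ?expR_ge0 ?ftsq_ge0.
have m3 : measT (fun xi : 'rV[R]_d => (expR (r * ln t))%:E * (enorm xi `^ (2 * r) * ftsq a b xi)%:E)%E.
  by apply: emeasurable_funM => //; exact: measurable_cst.
have p3 (xi : 'rV[R]_d) : (0 <= (expR (r * ln t))%:E * (enorm xi `^ (2 * r) * ftsq a b xi)%:E)%E.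
  by apply: mule_ge0 => //; rewrite lee_fin expR_ge0.
rewrite -(ge0_integralDT mu p1 m1 p3 m3).
apply: ae_ge0_le_integral => //.
- by move=> xi _; rewrite lee_fin ftsq_ge0.
- exact: mf_EFin.
- by move=> xi _; exact: adde_ge0.
- exact: emeasurable_funD.
have [A [mA A0 hA]] := ae_sqn_gt0 (R := R) d0; exists A; split => //.
apply: subset_trans hA => xi /= hn hx; apply: hn => _.
rewrite -EFinM -EFinD lee_fin enorm_powR// mulrA -expRD -mulrDr -lnM ?posrE//.
rewrite -mulrDl ler_peMl ?ftsq_ge0// one_sub_expR_le// mulr_gt0//.
Qed.

End plancherel.

(** * Pointwise bound on the heat flow by a Sobolev norm *)

Section riesz_gauss.
Context {R : realType} (d : nat).
Local Notation mu := (@lebesgue_rV R d).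
Local Notation leb := (@lebesgue_measure R).
Local Notation int f := (mu.-integrable setT (fun x => (f x)%:E)).

(** Equal to [pi^(d/2) Gamma(d/2 - r) / Gamma(d/2)], the integral of [|x|^(-2r)] against
    [expR (- |x|^2)], written as [riesz_weight_le] produces it. *)
Definition riesz_const (r : R) : R := pi `^ (d%:R / 2) * Beta (d%:R / 2 - r) r / Gamma r.

Lemma riesz_const_gt0 r : 0 < r -> r < d%:R / 2 -> 0 < riesz_const r.
Proof.
move=> r0 rd; rewrite divr_gt0 ?Gamma_gt0// mulr_gt0 ?powR_gt0 ?pi_gt0//.
by apply: Beta_gt0 => //; rewrite subr_gt0.
Qed.

(** In [riesz_weight_le] the inner integral is Gaussian with parameter [expR y + expR l];
    translating [y] by [l] extracts the power of [expR l] and leaves a Beta integral. *)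
Lemma riesz_gauss_le (r l : R) : 0 < r -> r < d%:R / 2 ->
  (\int[mu]_x (enorm x `^ (- (2 * r)) * expR (- (expR l * sqn x)))%:E
   <= (riesz_const r * expR (- ((d%:R / 2 - r) * l)))%:E)%E.
Proof.
move=> r0 rd; have G0 := Gamma_gt0 r0.
have rd0 : 0 < d%:R / 2 - r by rewrite subr_gt0.
have mF : measT (fun x : 'rV[R]_d => expR (- (expR l * sqn x))) by measv.
have := riesz_weight_le r0 mF (fun x => expR_ge0 _).
set I := (\int[mu]_x _)%E.
pose f (y : R) := (expR (r * y) * (pi / (expR y + expR l)) `^ (d%:R / 2))%:E.
under eq_integral => y _.
  under eq_integral => x _.
    rewrite -expRD -opprD -mulrDl; over.
  rewrite (integral_gauss_rV0 d (addr_gt0 (expR_gt0 y) (expR_gt0 l))) -EFinM -/(f y); over.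
have mf : measT f.
  rewrite /f; apply: mf_EFin; apply: mf_mul; first by meas.
  apply: mf_powR; apply: mf_mul; first exact: measurable_cst.
  by apply: mf_inv; [move=> y; rewrite addr_gt0 ?expR_gt0|meas].
have f0 y : (0 <= f y)%E by rewrite lee_fin mulr_ge0 ?expR_ge0 ?powR_ge0.
rewrite -(ge0_integral_shift l mf f0).
have E y : f (y + l) = ((pi `^ (d%:R / 2) * expR (- ((d%:R / 2 - r) * l)))%:E *
   (expR (r * y - (d%:R / 2 - r + r) * ln (1 + expR y)))%:E)%E.
  have e0 : 0 < 1 + expR y by rewrite addr_gt0 ?expR_gt0.
  rewrite /f -EFinM; congr EFin.
  rewrite (_ : expR (y + l) + expR l = expR l * (1 + expR y)); last by rewrite expRD; ring.
  rewrite powRM ?pi_ge0 ?invr_ge0 ?mulr_ge0 ?expR_ge0 ?(ltW e0)//.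
  rewrite {2}/powR gt_eqF ?invr_gt0 ?mulr_gt0 ?expR_gt0// lnV ?posrE ?mulr_gt0 ?expR_gt0//.
  rewrite lnM ?posrE ?expR_gt0// expRK mulrCA -[RHS]mulrA -!expRD; congr (_ * expR _); ring.
under eq_integral => y _ do rewrite E.
rewrite ge0_integralZlT; last 3 first.
- by move=> y; rewrite lee_fin expR_ge0.
- by apply: mf_EFin; meas; move=> y; rewrite addr_gt0 ?expR_gt0.
- by rewrite mulr_ge0 ?powR_ge0 ?expR_ge0.
rewrite -/(beta_int (d%:R / 2 - r) r) beta_intE// -EFinM => h.
rewrite -(@lee_pmul2l _ (Gamma r)%:E)//.
apply: (le_trans h); rewrite -EFinM lee_fin /riesz_const; apply: eq_lee.
by field; rewrite gt_eqF.
Qed.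

Variables (K : R) (a b : 'rV[R]_d -> R).
Hypotheses (ha : gauss_bounded K a) (hb : gauss_bounded K b).
Let ia := gauss_bounded_int ha.
Let ib := gauss_bounded_int hb.

Lemma hardy_integral_fin r : 0 < r -> r < d%:R / 2 ->
  (\int[mu]_x (enorm x `^ (- (2 * r)) * (a x ^+ 2 + b x ^+ 2))%:E < +oo)%E.
Proof.
move=> r0 rd; have K0 := gauss_bounded_K ha.
apply: (@le_lt_trans _ _ ((2 * K ^+ 2)%:E * \int[mu]_x (enorm x `^ (- (2 * r)) * expR (- (expR 0 * sqn x)))%:E)%E); last first.
  apply: (@le_lt_trans _ _ ((2 * K ^+ 2)%:E * (riesz_const r * expR (- ((d%:R / 2 - r) * 0)))%:E)%E).
    by apply: lee_wpmul2l; [rewrite lee_fin mulr_ge0 ?sqr_ge0|exact: riesz_gauss_le].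
  by rewrite -EFinM ltry.
have mW : measT (fun x : 'rV[R]_d => enorm x `^ (- (2 * r))) by exact: mf_enorm_powR.
rewrite -ge0_integralZlT; last 3 first.
- by move=> x; rewrite lee_fin mulr_ge0 ?powR_ge0 ?expR_ge0.
- by apply: mf_EFin; apply: mf_mul => //; measv.
- by rewrite mulr_ge0 ?sqr_ge0.
apply: le_integralT.
- by move=> x; rewrite lee_fin mulr_ge0 ?powR_ge0 ?addr_ge0 ?sqr_ge0.
- apply: mf_EFin; apply: mf_mul => //; apply: mf_add; apply: mf_exp.
    exact: (gauss_bounded_mf ha).
  exact: (gauss_bounded_mf hb).
- apply: emeasurable_funM; first exact: measurable_cst.
  by apply: mf_EFin; apply: mf_mul => //; measv.
move=> x; rewrite -EFinM lee_fin mulrCA ler_wpM2l ?powR_ge0// expR0.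
have H (f : 'rV[R]_d -> R) : gauss_bounded K f -> f x ^+ 2 <= K ^+ 2 * expR (- (1 * sqn x)).
  move=> hf; have [_ /(_ x) h1] := hf; have h2 := gauss_bounded_le hf x.
  have : `|f x| * `|f x| <= K * expR (- (1 * sqn x)) * K by exact: ler_pM.
  by rewrite -(real_normK (num_real (f x))) [_ ^+ 2]expr2; congr (_ <= _); ring.
by have := H _ ha; have := H _ hb; move: (expR _) => e; lra.
Qed.

(** Inversion bounds the heat flow by the integral of the damped modulus of the transform, and
    Cauchy-Schwarz splits it with the weight |xi|^(2r). Squaring the Gaussian doubles the time,
    whence [ln 2 + l]. *)
Lemma gconv_sup_bound r l N (z : 'rV[R]_d) : (0 < d)%N -> 0 < r -> r < d%:R / 2 -> 0 < N ->
  (sobsq a b r <= N%:E)%E ->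
  gconv (expR l) a z ^+ 2 <= riesz_const r * expR (- ((d%:R / 2 - r) * (ln 2 + l))) * N /\
  gconv (expR l) b z ^+ 2 <= riesz_const r * expR (- ((d%:R / 2 - r) * (ln 2 + l))) * N.
Proof.
move=> d0 r0 rd N0 hN; set G := riesz_const r * _.
have G0 : 0 < G by rewrite mulr_gt0 ?expR_gt0 ?riesz_const_gt0.
have mS : measT (fun xi => Num.sqrt (ftsq a b xi)) by apply: mf_sqrt; exact: mf_ftsq.
have [C hC] := ftsq_bounded ia ib.
have iS : int (fun xi => expR (- (expR l * sqn xi)) * Num.sqrt (ftsq a b xi)).
  apply: (@integrable_gauss_mul _ _ _ _ (Num.sqrt C) (expR_gt0 l) mS) => xi.
  by rewrite ger0_norm ?sqrtr_ge0// ler_wsqrtr.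
pose S := \int[mu]_xi (expR (- (expR l * sqn xi)) * Num.sqrt (ftsq a b xi)).
have S0 : 0 <= S by apply: Rintegral_ge0 => xi _; rewrite mulr_ge0 ?expR_ge0 ?sqrtr_ge0.
(* Cauchy-Schwarz as a family of linear bounds, optimal at [al = Num.sqrt (N / G)]. *)
have SE al : 0 < al -> 2 * S <= al * G + al^-1 * N.
  move=> al0; rewrite -lee_fin /S EFinM (EFin_Rintegral iS).
  have mW p : measT (fun x : 'rV[R]_d => enorm x `^ p) by exact: mf_enorm_powR.
  have mE := mf_ftsq ia ib.
  pose f1 (x : 'rV[R]_d) := (enorm x `^ (- (2 * r)) * expR (- (expR (ln 2 + l) * sqn x)))%:E.
  pose f2 (x : 'rV[R]_d) := (enorm x `^ (2 * r) * ftsq a b x)%:E.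
  have mf1 : measT f1 by apply: mf_EFin; apply: mf_mul => //; measv.
  have mf2 : measT f2 by apply: mf_EFin; apply: mf_mul.
  have f10 x : (0 <= f1 x)%E by rewrite lee_fin mulr_ge0 ?powR_ge0 ?expR_ge0.
  have f20 x : (0 <= f2 x)%E by rewrite lee_fin mulr_ge0 ?powR_ge0 ?ftsq_ge0.
  apply: (@le_trans _ _ (al%:E * \int[mu]_x f1 x + al^-1%:E * \int[mu]_x f2 x)%E); last first.
    rewrite EFinD !EFinM; apply: leeD.
      apply: lee_wpmul2l; first by rewrite lee_fin ltW.
      by rewrite -EFinM; exact: riesz_gauss_le.
    by apply: lee_wpmul2l; first by rewrite lee_fin invr_ge0 ltW.
  rewrite -(ge0_integralZlT mu f10 mf1 (ltW al0)) -(ge0_integralZlT mu f20 mf2 _); last by rewrite invr_ge0 ltW.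
  rewrite -ge0_integralZlT; last 3 first.
  - by move=> x; rewrite lee_fin mulr_ge0 ?expR_ge0 ?sqrtr_ge0.
  - by apply: mf_EFin; apply: mf_mul => //; measv.
  - by [].
  have p1 x : (0 <= al%:E * f1 x)%E by apply: mule_ge0 => //; rewrite lee_fin ltW.
  have p2 x : (0 <= al^-1%:E * f2 x)%E by apply: mule_ge0 => //; rewrite lee_fin invr_ge0 ltW.
  have m1 : measT (fun x => al%:E * f1 x)%E by apply: emeasurable_funM => //; exact: measurable_cst.
  have m2 : measT (fun x => al^-1%:E * f2 x)%E by apply: emeasurable_funM => //; exact: measurable_cst.
  rewrite -(ge0_integralDT mu p1 m1 p2 m2).
  apply: ae_ge0_le_integral => //.
  - apply: emeasurable_funM; first exact: measurable_cst.
    by apply: mf_EFin; apply: mf_mul => //; measv.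
  - by move=> xi _; exact: adde_ge0.
  - exact: emeasurable_funD.
  have [A [mA A0 hA]] := ae_sqn_gt0 (R := R) d0; exists A; split => //.
  apply: subset_trans hA => xi /= hn hx; apply: hn => _.
  rewrite /f1 /f2 -!EFinM -EFinD lee_fin -(mulrN 2 r) !enorm_powR//.
  have F0 := ftsq_ge0 a b xi; rewrite -{2}(sqr_sqrtr F0) expRD lnK ?posrE//.
  have := sqrtr_ge0 (ftsq a b xi); move: (Num.sqrt _) => F F1.
  have -> : expR (- (2 * expR l * sqn xi)) = expR (- (expR l * sqn xi)) ^+ 2.
    by rewrite expr2 -expRD; congr expR; ring.
  rewrite mulNr (expRN (r * ln (sqn xi))); have := expR_gt0 (r * ln (sqn xi)); move: (expR (r * _)) => V V0; move: (expR (- _)) => E.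
  have av0 : 0 < al / V by rewrite divr_gt0.
  rewrite -subr_ge0 (_ : _ - _ = (al / V) * (E - V / al * F) ^+ 2); first by rewrite mulr_ge0 ?sqr_ge0// ltW.
  by field; rewrite !gt_eqF.
have SG : S ^+ 2 <= G * N.
  have q0 : 0 < Num.sqrt (N / G) by rewrite sqrtr_gt0 divr_gt0.
  have := SE _ q0.
  have : Num.sqrt (N / G) ^+ 2 = N / G by rewrite sqr_sqrtr// ltW// divr_gt0.
  move: (Num.sqrt _) q0 => al al0 E; have -> : N = al ^+ 2 * G by rewrite E divfK// gt_eqF.
  rewrite (_ : al * G + al^-1 * (al ^+ 2 * G) = 2 * (al * G)); last by field; rewrite gt_eqF.
  rewrite ler_pM2l// => h; rewrite (_ : G * _ = (al * G) ^+ 2); last by ring.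
  by rewrite ler_pXn2r ?nnegrE// mulr_ge0// ltW.
have key (h : 'rV[R]_d -> R) : measT h -> (forall xi, h xi ^+ 2 <= ftsq a b xi) ->
    (\int[mu]_xi (expR (- (expR l * sqn xi)) * h xi)) ^+ 2 <= G * N.
  move=> mh hh.
  have hS xi : `|h xi| <= Num.sqrt (ftsq a b xi) by rewrite -sqrtr_sqr ler_wsqrtr.
  have ih : int (fun xi => expR (- (expR l * sqn xi)) * h xi).
    apply: (integrable_dom iS); first by apply: mf_mul => //; measv.
    by move=> xi; rewrite normrM ger0_norm ?expR_ge0// ler_wpM2l ?expR_ge0.
  apply: le_trans SG; rewrite -(real_normK (num_real _)) ler_pXn2r ?nnegrE//.
  rewrite (le_trans (le_normr_Rintegral _ _))//; apply: le_Rintegral => //; first exact: integrable_abs.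
  by move=> xi _; rewrite normrM ger0_norm ?expR_ge0// ler_wpM2l ?expR_ge0.
have m1 := mf_ftc ia ib; have m2 := mf_ftc ib (integrableRN ia).
rewrite -/(gconv _ _ _) -(ftc_gauss_inversion2 z (expR_gt0 l) ia ib).
rewrite {1}/gconv -(ftc_gauss_inversion z (expR_gt0 l) ia ib).
have cs xi : cos (edot xi z) ^+ 2 + sin (edot xi z) ^+ 2 = 1 by exact: cos2Dsin2.
split; apply: key.
- by measv.
- move=> xi; rewrite -[leRHS]mulr1 -(cs xi) /ftsq.
  move: (cos _) (sin _) (ftc a b _) (ftc b _ _) => c s' P Q.
  by rewrite -subr_ge0 (_ : _ - _ = (P * s' + Q * c) ^+ 2) ?sqr_ge0//; ring.
- by measv.
- move=> xi; rewrite -[leRHS]mulr1 -(cs xi) /ftsq.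
  move: (cos _) (sin _) (ftc a b _) (ftc b _ _) => c s' P Q.
  by rewrite -subr_ge0 (_ : _ - _ = (P * c - Q * s') ^+ 2) ?sqr_ge0//; ring.
Qed.

End riesz_gauss.

(** * Hardy inequality with remainder, without regularization *)

Section hardy_gain.
Context {R : realType} (d : nat).
Local Notation mu := (@lebesgue_rV R d).
Local Notation int f := (mu.-integrable setT (fun x => (f x)%:E)).
Variables (s e : R).
Hypotheses (d0 : (0 < d)%N) (s0 : 0 < s) (e0 : 0 < e) (eb : e < (d%:R - 2 * s) / 4) (es : e < s).

Lemma ftphi_sqr dl (a b : 'rV[R]_d -> R) xi :
  ftphi dl a b xi ^+ 2 = expR (- (dl * (2 * sqn xi))) * ftsq a b xi.
Proof.
rewrite /ftphi exprMn sqr_sqrtr ?ftsq_ge0//; congr (_ * _).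
by rewrite expr2 -expRD; congr expR; ring.
Qed.

(** [hardy_gain_gconv] as [dl] tends to 0. Fatou's lemma handles the nonnegative left side; on the
    right, damping only decreases the integrands, and Plancherel identifies the last one. *)
Lemma hardy_gain : exists eps B : R, [/\ 0 < eps, 0 < B &
  forall K (a b : 'rV[R]_d -> R) l, gauss_bounded K a -> gauss_bounded K b ->
  (((2 * pi) ^+ d)%:E * ((hardy_const d s)%:E * \int[mu]_x (enorm x `^ (- (2 * s)) * (a x ^+ 2 + b x ^+ 2))%:E) +
   (eps * expR (e * l))%:E * sobsq a b (s - e) <=
   sobsq a b s + (B * expR (s * l) * ((2 * pi) ^+ d * mass a b))%:E)%E].
Proof.
have [eps [B [eps0 B0 hgain]]] := hardy_gain_gconv d0 s0 e0 eb es.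
exists eps, B; split => // K a b l ha hb.
have ia := gauss_bounded_int ha; have ib := gauss_bounded_int hb.
have hc0 := hardy_const_gt0 s0 e0 eb.
have p0 : 0 < (2 * pi) ^+ d :> R by exact: exp2pi_gt0.
set c := (2 * pi) ^+ d in hgain p0 *.
set hc := hardy_const d s in hgain hc0 *.
have k10 : 0 < eps * expR (e * l) by rewrite mulr_gt0 ?expR_gt0.
have k20 : 0 < B * expR (s * l) by rewrite mulr_gt0 ?expR_gt0.
have hg dl (h : 0 < dl) := hgain a b l dl ia ib h.
move: {hgain} hg; set k1 := eps * _ in k10 *; set k2 := B * _ in k20 * => hg.
have mE := mf_ftsq ia ib.
have ma := gauss_bounded_mf ha; have mb := gauss_bounded_mf hb.
have mW p : measT (fun x : 'rV[R]_d => enorm x `^ p) by exact: mf_enorm_powR.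
pose W (x : 'rV[R]_d) := enorm x `^ (- (2 * s)).
pose V (x : 'rV[R]_d) := enorm x `^ (2 * (s - e)).
have W0 x : 0 <= W x by exact: powR_ge0.
have V0 x : 0 <= V x by exact: powR_ge0.
pose mk (A B F : 'rV[R]_d -> R) x := (hc * (W x * (A x ^+ 2 + B x ^+ 2)) + c * (k1 * (V x * F x)))%:E.
have mkint (A B' F : 'rV[R]_d -> R) : measT A -> measT B' ->
    measT F -> (forall x, 0 <= F x) ->
    [/\ measT (mk A B' F), (forall x, 0 <= mk A B' F x)%E &
    (\int[mu]_x mk A B' F x = hc%:E * \int[mu]_x (W x * (A x ^+ 2 + B' x ^+ 2))%:E +
       c%:E * (k1%:E * \int[mu]_x (V x * F x)%:E))%E].
  move=> mA mB mF F0.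
  have m1 : measT (fun x => W x * (A x ^+ 2 + B' x ^+ 2)).
    by apply: mf_mul; [exact: mW|apply: mf_add; exact: mf_exp].
  have m2 : measT (fun x => V x * F x) by apply: mf_mul; [exact: mW|].
  have p1 x : 0 <= W x * (A x ^+ 2 + B' x ^+ 2) by rewrite mulr_ge0 ?addr_ge0 ?sqr_ge0.
  have p2 x : 0 <= V x * F x by rewrite mulr_ge0.
  have q1 x : 0 <= hc * (W x * (A x ^+ 2 + B' x ^+ 2)) by rewrite mulr_ge0// ltW.
  have q2 x : 0 <= c * (k1 * (V x * F x)) by rewrite mulr_ge0 ?(ltW p0)// mulr_ge0// ltW.
  have n1 : measT (fun x => hc * (W x * (A x ^+ 2 + B' x ^+ 2))).
    by apply: mf_mul => //; exact: measurable_cst.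
  have n2 : measT (fun x => c * (k1 * (V x * F x))).
    by apply: mf_mul; [exact: measurable_cst|apply: mf_mul => //; exact: measurable_cst].
  split.
  - by apply: mf_EFin; exact: mf_add.
  - by move=> x; rewrite lee_fin addr_ge0.
  rewrite /mk; under eq_integral => x _ do rewrite EFinD.
  rewrite ge0_integralDT; last 4 first.
  - by move=> x; rewrite lee_fin.
  - exact: mf_EFin.
  - by move=> x; rewrite lee_fin.
  - exact: mf_EFin.
  congr (_ + _)%E.
    under eq_integral => x _ do rewrite EFinM.
    by rewrite ge0_integralZlT//; [exact: mf_EFin|exact: ltW].
  under eq_integral => x _ do rewrite mulrA EFinM.
  rewrite ge0_integralZlT; last 3 first.
  - by move=> x; rewrite lee_fin.
  - exact: mf_EFin.
  - by rewrite mulr_ge0// ltW.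
  by rewrite EFinM muleA.
have t0 m : 0 < m.+1%:R^-1 :> R by rewrite invr_gt0.
pose h m := mk (gconv m.+1%:R^-1 a) (gconv m.+1%:R^-1 b) (fun x => ftphi m.+1%:R^-1 a b x ^+ 2).
have hP m := mkint _ _ _ (mf_gconv (t0 m) ia) (mf_gconv (t0 m) ib)
   (mf_exp 2 (mf_ftphi m.+1%:R^-1 ia ib)) (fun x => sqr_ge0 _).
pose Cst : \bar R := (c%:E * (sobsq a b s + (k2 * (c * mass a b))%:E))%E.
have hC m : (\int[mu]_x h m x <= Cst)%E.
  have [_ _ ->] := hP m; apply: (le_trans (hg _ (t0 m))).
  have fle xi : ftphi m.+1%:R^-1 a b xi ^+ 2 <= ftsq a b xi.
    rewrite ftphi_sqr ler_piMl ?ftsq_ge0// expR_le1 oppr_le0.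
    by rewrite !mulr_ge0 ?sqn_ge0// ltW.
  have mf2 := mf_exp 2 (mf_ftphi m.+1%:R^-1 ia ib).
  apply: lee_wpmul2l; first by rewrite lee_fin ltW.
  apply: leeD.
    apply: le_integralT.
    - by move=> x; rewrite lee_fin mulr_ge0 ?powR_ge0 ?sqr_ge0.
    - by apply: mf_EFin; apply: mf_mul.
    - by apply: mf_EFin; apply: mf_mul.
    - by move=> x; rewrite lee_fin ler_wpM2l ?powR_ge0.
  rewrite (EFinM k2); apply: lee_wpmul2l; first by rewrite lee_fin ltW.
  rewrite -(plancherel ha hb); apply: le_integralT.
  - by move=> x; rewrite lee_fin sqr_ge0.
  - exact: mf_EFin.
  - exact: mf_EFin.
  - by move=> x; rewrite lee_fin.
have [mh0 hh0 hI] := mkint (fun x => c * a x) (fun x => c * b x) (ftsq a b)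
   (mf_mul (measurable_cst _) ma) (mf_mul (measurable_cst _) mb) mE (ftsq_ge0 a b).
have hle : (\int[mu]_x mk (fun x => (c * a x)%R) (fun x => (c * b x)%R) (ftsq a b) x <= Cst)%E.
  apply: (@le_trans _ _ (limn_einf (fun m => \int[mu]_x h m x)%E)); last first.
    rewrite limn_einf_lim; apply: lime_le; first exact: is_cvg_einfs.
    apply: nearW => m; apply: (le_trans _ (hC m)); apply: ereal_inf_lbound => /=.
    by exists m => //=.
  apply: le_trans (fatou mu measurableT _ _); last 2 first.
  - by move=> m; have [] := hP m.
  - by move=> m x _; have [_ + _] := hP m; apply.
  apply: eq_lee; apply: eq_integral => x _.
  apply/esym/(cvg_limn_einf_sup _).1; apply: cvg_EFin; first by apply: nearW.
  have gc (f : 'rV[R]_d -> R) : gauss_bounded K f -> gconv m.+1%:R^-1 f x @[m --> \oo] --> c * f x.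
    move=> hf; under eq_fun do rewrite (gconv_hconv x (t0 _) (gauss_bounded_int hf)).
    by apply: cvgM; [exact: cvg_cst|exact: (cvg_hconv_gauss_bounded hf)].
  have ft : ftphi m.+1%:R^-1 a b x ^+ 2 @[m --> \oo] --> ftsq a b x.
    have -> : (fun m : nat => ftphi m.+1%:R^-1 a b x ^+ 2) =
        (fun m : nat => expR (- (m.+1%:R^-1 * (2 * sqn x))) * ftsq a b x).
      by apply/funext => m; rewrite ftphi_sqr.
    rewrite -[X in _ --> X]mul1r; apply: cvgM; last exact: cvg_cst.
    exact: cvg_gauss_factor.
  apply: cvgD; (apply: cvgM; first exact: cvg_cst); (apply: cvgM; first exact: cvg_cst).
    by apply: cvgD; rewrite expr2; under eq_fun do rewrite expr2; apply: cvgM; exact: gc.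
  by apply: cvgM; first exact: cvg_cst.
(* [gconv] converges to [c] times the function, so the limit inequality is the claim multiplied by
   [c]. *)
rewrite -(@lee_pmul2l _ c%:E)// -/Cst; apply: le_trans hle.
rewrite hI /sobsq ge0_muleDr; last 2 first.
- apply: mule_ge0; first by rewrite lee_fin ltW.
  apply: mule_ge0; first by rewrite lee_fin ltW.
  by apply: integral_ge0 => x _; rewrite lee_fin mulr_ge0 ?powR_ge0 ?addr_ge0 ?sqr_ge0.
- apply: mule_ge0; first by rewrite lee_fin ltW.
  by apply: integral_ge0 => x _; rewrite lee_fin mulr_ge0 ?powR_ge0 ?ftsq_ge0.
apply: leeD => //.
have -> : (\int[mu]_x (W x * ((c * a x) ^+ 2 + (c * b x) ^+ 2))%:E =
   (c ^+ 2)%:E * \int[mu]_x (enorm x `^ (- (2 * s)) * (a x ^+ 2 + b x ^+ 2))%:E)%E.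
  rewrite -ge0_integralZlT; last 3 first.
  - by move=> x; rewrite lee_fin mulr_ge0 ?powR_ge0 ?addr_ge0 ?sqr_ge0.
  - by apply: mf_EFin; apply: mf_mul; [exact: mW|apply: mf_add; exact: mf_exp].
  - exact: sqr_ge0.
  by apply: eq_integral => x _; rewrite -EFinM /W; congr EFin; ring.
by rewrite !muleA -!EFinM; apply: eq_lee; congr (_%:E * _)%E; ring.
Qed.

End hardy_gain.

(** * From a weak-type bound to an integral bound *)

Section weak_type.
Context d (T : measurableType d) (R : realType) (mu : {measure set T -> \bar R}).
Variables (F : T -> R) (Omega : set T) (V C N rho r Fm : R).
Hypotheses (mF : measT F) (F0 : forall x, 0 <= F x) (FM : forall x, F x <= Fm)
  (FO : forall x, ~ Omega x -> F x = 0) (mO : measurable Omega) (muO : mu Omega = V%:E)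
  (V0 : 0 < V) (C0 : 0 <= C) (r0 : 0 < r) (rrho : r < rho).
Hypothesis weakF : forall L, 0 < L ->
  (mu [set x | (L < F x)%R] <= (C * expR (rho * (ln N - ln L)))%:E)%E.

(** Logarithm of the level [N * V^(-1/rho)] at which the weak bound equals [C * V]: below it the
    measure of [Omega] is used, above it dyadic levels. *)
Let lam := ln N - ln V / rho.
Let Lam (n : nat) := expR (lam + n%:R * ln 2).
Let x := expR (- ((rho - r) * ln 2)).
Let rho0 : 0 < rho := lt_trans r0 rrho.

Let mm n : measT (fun y => Num.min (F y) (Lam n) `^ r).
Proof. by apply: mf_powR; apply: measurable_minr => //; exact: measurable_cst. Qed.

(** Raising the truncation from [Lam n] to [Lam n.+1] changes the integrand only where [F > Lam n],
    a set of measure at most [C * V * 2^(- rho n)]. The increments form a geometric series of ratio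
    [x]. *)
Lemma integral_min_le n : (\int[mu]_y (Num.min (F y) (Lam n) `^ r)%:E <=
  (expR (r * lam) * V * (1 + C * 2 `^ r * ((1 - x ^+ n) / (1 - x))))%:E)%E.
Proof.
have x1 : 0 < 1 - x.
  by rewrite subr_gt0 /x expR_lt1 oppr_lt0 mulr_gt0 ?subr_gt0 ?ln_gt0// ltr1n.
have stepI (A : set T) (k : R) : measurable A -> 0 <= k ->
   (\int[mu]_y (k * \1_A y)%:E = k%:E * mu A)%E.
  move=> mA k0; under eq_integral => y _ do rewrite EFinM.
  by rewrite ge0_integralZlT// ?integral_indic ?setIT//; apply: mf_EFin; exact: measurable_indic.
elim: n => [|n IH].
  rewrite expr0 subrr mul0r mulr0 addr0 mulr1.
  have L0 : expR (r * lam) = Lam 0 `^ r.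
    by rewrite /Lam mul0r addr0 /powR gt_eqF ?expR_gt0// expRK.
  rewrite L0 EFinM -muO -stepI ?powR_ge0//; apply: le_integralT.
  - by move=> y; rewrite lee_fin powR_ge0.
  - by apply: mf_EFin; exact: mm.
  - by apply: mf_EFin; apply: mf_mul; [exact: measurable_cst|exact: measurable_indic].
  move=> y; rewrite lee_fin indicE; have [yO|yO] := boolP (y \in Omega).
    by rewrite mulr1 ge0_ler_powR ?(ltW r0) ?nnegrE ?le_min ?F0 ?expR_ge0// ge_min lexx orbT.
  rewrite mulr0 FO; last by move: yO; rewrite notin_setE.
  by rewrite min_l ?expR_ge0// powR0// gt_eqF.
pose A := [set y | (Lam n < F y)%R].
have mA : measurable A.
  have := mF measurableT (measurable_itv `]Lam n, +oo[); rewrite setTI; congr measurable.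
  by apply/seteqP; split=> y; rewrite /A/= in_itv/= andbT.
apply: (@le_trans _ _ (\int[mu]_y ((Num.min (F y) (Lam n) `^ r)%:E + (Lam n.+1 `^ r * \1_A y)%:E))%E).
  apply: le_integralT.
  - by move=> y; rewrite lee_fin powR_ge0.
  - by apply: mf_EFin; exact: mm.
  - by apply: emeasurable_funD; apply: mf_EFin; [exact: mm|apply: mf_mul; [exact: measurable_cst|exact: measurable_indic]].
  move=> y; rewrite -EFinD lee_fin indicE; have [yA|yA] := boolP (y \in A).
    rewrite mulr1 ler_wpDl ?powR_ge0//.
    by rewrite ge0_ler_powR ?(ltW r0) ?nnegrE ?le_min ?F0 ?expR_ge0// ge_min lexx orbT.
  rewrite mulr0 addr0; move: yA; rewrite notin_setE /A /= => /negP; rewrite -leNgt => yA.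
  rewrite (min_l yA) ge0_ler_powR ?(ltW r0) ?nnegrE ?le_min ?F0 ?expR_ge0// ge_min lexx//.
rewrite ge0_integralDT; last 4 first.
- by move=> y; rewrite lee_fin powR_ge0.
- by apply: mf_EFin; exact: mm.
- by move=> y; rewrite lee_fin mulr_ge0 ?powR_ge0.
- by apply: mf_EFin; apply: mf_mul; [exact: measurable_cst|exact: measurable_indic].
rewrite stepI ?powR_ge0//.
have hw : (mu A <= (C * (V * expR (- (rho * n%:R * ln 2))))%:E)%E.
  apply: (le_trans (weakF (expR_gt0 _))); rewrite lee_fin ler_wpM2l//.
  rewrite expRK -(lnK (_ : V \in Num.pos))// -expRD ler_expR /lam.
  by apply: eq_lee; field; rewrite gt_eqF.
apply: (le_trans (leeD IH (lee_wpmul2l _ hw))); first by rewrite lee_fin powR_ge0.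
rewrite -EFinM -EFinD lee_fin.
have -> : Lam n.+1 `^ r = expR (r * lam) * 2 `^ r * expR (r * n%:R * ln 2).
  rewrite /Lam {1 2}/powR (gt_eqF (expR_gt0 _)) expRK pnatr_eq0 /= -!expRD; congr expR.
  by rewrite -natr1; ring.
have -> : expR (r * lam) * 2 `^ r * expR (r * n%:R * ln 2) * (C * (V * expR (- (rho * n%:R * ln 2)))) =
   expR (r * lam) * V * (C * 2 `^ r * x ^+ n).
  rewrite /x -expRM_natl.
  rewrite (_ : expR (n%:R * - ((rho - r) * ln 2)) = expR (r * n%:R * ln 2) * expR (- (rho * n%:R * ln 2))); first by ring.
  by rewrite -expRD; congr expR; ring.
rewrite -mulrDr -addrA -mulrDr exprS.
have -> : (1 - x ^+ n) / (1 - x) + x ^+ n = (1 - x * x ^+ n) / (1 - x) => //.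
by field; rewrite gt_eqF.
Qed.

(** As [F] is bounded, a high truncation leaves it unchanged, and the geometric sum is bounded
    independently of the level, so [Fm] drops out of the estimate. *)
Lemma weak_type_integral : (\int[mu]_y (F y `^ r)%:E <=
  ((1 + C * 2 `^ r / (1 - 2 `^ (- (rho - r)))) * expR (r * ln N + (1 - r / rho) * ln V))%:E)%E.
Proof.
have ln20 : 0 < ln 2 :> R by rewrite ln_gt0// ltr1n.
have x1 : 0 < 1 - x.
  by rewrite subr_gt0 /x expR_lt1 oppr_lt0 mulr_gt0 ?subr_gt0.
have [n hn] : exists n, Fm <= Lam n.
  have [n hn] : exists n : nat, (Fm - 1 - lam) / ln 2 <= n%:R.
    by exists (Num.bound `|(Fm - 1 - lam) / ln 2|); rewrite (le_trans (ler_norm _))// ltW// archi_boundP.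
  exists n; apply: le_trans (expR_ge1Dx _).
  by move: hn; rewrite ler_pdivrMr//; lra.
under eq_integral => y _ do rewrite -(min_l (le_trans (FM y) hn)).
apply: (le_trans (integral_min_le n)); rewrite lee_fin.
rewrite -{1}(lnK (_ : V \in Num.pos))// -expRD mulrC.
rewrite (_ : r * lam + ln V = r * ln N + (1 - r / rho) * ln V); last first.
  by rewrite /lam; field; rewrite gt_eqF.
rewrite ler_wpM2r ?expR_ge0// lerD2l ler_wpM2l ?mulr_ge0 ?powR_ge0//.
have -> : 2 `^ (- (rho - r)) = x by rewrite /powR pnatr_eq0 /= /x mulNr.
by rewrite ler_piMl ?invr_ge0 ?(ltW x1)// gerBl exprn_ge0 ?expR_ge0.
Qed.

End weak_type.

(** * Faber-Krahn and weak-type Sobolev inequalities *)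

Section faber_krahn.
Context {R : realType} (d : nat).
Local Notation mu := (@lebesgue_rV R d).
Local Notation int f := (mu.-integrable setT (fun x => (f x)%:E)).
Variables (K : R) (a b : 'rV[R]_d -> R) (Omega : set 'rV[R]_d) (V : R).
Hypotheses (ha : gauss_bounded K a) (hb : gauss_bounded K b).
Hypotheses (d0 : (0 < d)%N) (mO : measurable Omega) (muO : mu Omega = V%:E) (V0 : 0 < V).
Hypotheses (aO : forall x, ~ Omega x -> a x = 0) (bO : forall x, ~ Omega x -> b x = 0).

Lemma sqr_integral_norm_le f : gauss_bounded K f -> (forall x, ~ Omega x -> f x = 0) ->
  (\int[mu]_x `|f x|) ^+ 2 <= V * \int[mu]_x (f x ^+ 2).
Proof.
move=> hf fO; have i2 := integrable_sqr_gauss_bounded hf.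
have i1 := integrable_abs (gauss_bounded_int hf).
have iO : int (fun x => \1_Omega x : R).
  apply/integrableP; split; first by apply: mf_EFin; exact: measurable_indic.
  under eq_integral => x _ do rewrite /= ger0_norm//.
  by rewrite integral_indic// setIT [ltLHS]muO ltry.
have IO : \int[mu]_x (\1_Omega x : R) = V.
  by rewrite /Rintegral integral_indic// setIT [X in fine X]muO.
(* [m] is the best constant approximation of [|f|] on [Omega] in mean square; the sign of the
   expanded square is Cauchy-Schwarz. *)
set I := \int[mu]_x `|f x|; pose m := I / V.
have : 0 <= \int[mu]_x ((`|f x| - m * \1_Omega x) ^+ 2).
  by apply: Rintegral_ge0 => x _; exact: sqr_ge0.
have -> : \int[mu]_x ((`|f x| - m * \1_Omega x) ^+ 2) =
    \int[mu]_x (f x ^+ 2 - (2 * m) * `|f x| + m ^+ 2 * \1_Omega x).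
  apply: eq_Rintegral => x _; rewrite indicE.
  rewrite -(real_normK (num_real (f x))).
  have [xO|xO] := boolP (x \in Omega); first by rewrite /=; ring.
  by rewrite fO ?normr0; [rewrite /=; ring|move: xO; rewrite notin_setE].
rewrite (RintegralD measurableT (integrableRB i2 (integrableRZ (2 * m) i1)) (integrableRZ (m ^+ 2) iO)).
rewrite (RintegralB measurableT i2 (integrableRZ (2 * m) i1)).
rewrite (RintegralZl _ measurableT i1) (RintegralZl _ measurableT iO) IO -/I.
move: (\int[mu]_x (f x ^+ 2)) => A h.
rewrite -ler_pdivrMl// -subr_ge0; move: h; congr (0 <= _).
by rewrite /m; field; rewrite gt_eqF.
Qed.

(** The supremum of the heat kernel times the squared L^1 norm, which the finite measure of [Omega]
    converts into an L^2 norm. *)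
Lemma integral_mul_hconv_le f t : gauss_bounded K f -> (forall x, ~ Omega x -> f x = 0) -> 0 < t ->
  \int[mu]_x (f x * hconv t f x) <= (4 * pi * t) `^ (- (d%:R / 2)) * V * \int[mu]_x (f x ^+ 2).
Proof.
move=> hf fO t0; have i0 := gauss_bounded_int hf; have i1 := integrable_abs i0.
set k := (4 * pi * t) `^ _; have k0 : 0 <= k by exact: powR_ge0.
apply: (@le_trans _ _ (\int[mu]_x (k * (\int[mu]_y `|f y|) * `|f x|))).
  apply: le_Rintegral => //; [exact: (integrable_mul_hconv hf t0)|exact: integrableRZ|].
  move=> x _; rewrite (le_trans (ler_norm _))// normrM mulrC ler_wpM2r//.
  rewrite (le_trans (le_normr_Rintegral _ _))//; first exact: integrable_hconv.
  rewrite -RintegralZl//; apply: le_Rintegral => //; [apply: integrable_abs; exact: integrable_hconv|exact: integrableRZ|].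
  move=> y _; rewrite normrM mulrC ler_wpM2r// ger0_norm ?hk_ge0// /hk -/k.
  by rewrite ler_piMr// expR_le1 oppr_le0 divr_ge0 ?sqn_ge0// mulr_ge0// ltW.
rewrite RintegralZl// -mulrA -expr2 -mulrA ler_wpM2l//.
exact: sqr_integral_norm_le.
Qed.

Lemma heat_mass_le t : 0 < t ->
  heat_mass a b t <= (4 * pi * t) `^ (- (d%:R / 2)) * V * mass a b.
Proof.
move=> t0; rewrite (heat_massE ha hb t0) (massE ha hb) mulrDr.
by rewrite lerD// integral_mul_hconv_le.
Qed.

(* The logarithm of the time at which the heat kernel is bounded by [1 / (2 V)]. *)
Definition fk_time : R := (ln (2 * V) - d%:R / 2 * ln (4 * pi)) * (2 / d%:R).

(** At [fk_time] the flow keeps at most half of the mass, by [heat_mass_le]; absorbing that half on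
    the left gives the factor 2. *)
Lemma faber_krahn r N : 0 <= r <= 1 -> (sobsq a b r <= N%:E)%E ->
  (2 * pi) ^+ d * mass a b <= 2 * (expR (r * fk_time) * N).
Proof.
move=> r01 hN; have t0 := expR_gt0 fk_time.
have := mass_le_heat_mass ha hb d0 t0 r01; rewrite expRK => h.
have : (((2 * pi) ^+ d * mass a b)%:E <= ((2 * pi) ^+ d * heat_mass a b (expR fk_time) + expR (r * fk_time) * N)%:E)%E.
  rewrite EFinD (EFinM (expR _)); apply: (le_trans h); apply: leeD => //.
  by apply: lee_wpmul2l => //; rewrite lee_fin expR_ge0.
rewrite lee_fin; have := heat_mass_le t0.
have -> : (4 * pi * expR fk_time) `^ (- (d%:R / 2)) = (2 * V)^-1.
  have p4 : 0 < 4 * pi :> R by rewrite mulr_gt0 ?pi_gt0.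
  rewrite /powR gt_eqF ?mulr_gt0 ?pi_gt0// lnM ?posrE// expRK.
  rewrite -[RHS](lnK (_ : (2 * V)^-1 \in Num.pos)) ?posrE ?invr_gt0 ?mulr_gt0//.
  rewrite lnV ?posrE ?mulr_gt0//; congr expR; rewrite /fk_time.
  by field; rewrite pnatr_eq0 -lt0n.
rewrite (_ : (2 * V)^-1 * V = 2^-1); last by field; rewrite gt_eqF.
have p0 : 0 < (2 * pi) ^+ d :> R by exact: exp2pi_gt0.
move: (heat_mass _ _ _) (mass _ _) (expR _ * N) p0 => H M Y; move: ((2 * pi) ^+ d) => c c0 h1 h2.
have : c * H <= c * (2^-1 * M) by rewrite ler_pM2l.
lra.
Qed.

(* The logarithm of the time at which [gconv_sup_bound] bounds the square of the
   heat flow by [L / 8]. *)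
Definition weak_time (r N L : R) : R :=
  (ln (8 * riesz_const d r * N / (((2 * pi) ^+ d) ^+ 2 * L))) / (d%:R / 2 - r) - ln 2.

(** The 8 is 4 from Chebyshev's inequality at height [L / 4] times 2 from [dist_hconv_le]; the
    exponential is the part of [expR (r * weak_time r N L)] free of [N] and [L]. *)
Definition weak_const (r : R) : R :=
  8 / (2 * pi) ^+ d * expR (r / (d%:R / 2 - r) * ln (8 * riesz_const d r / ((2 * pi) ^+ d) ^+ 2) - r * ln 2).

Lemma weak_const_gt0 r : 0 < weak_const r.
Proof. by rewrite mulr_gt0 ?expR_gt0// divr_gt0 ?exprn_gt0// mulr_gt0 ?pi_gt0. Qed.

(** At [weak_time] the squared modulus of the heat flow is at most [L / 4], so u lies far from its
    flow wherever |u|^2 exceeds [L], and Chebyshev's inequality applies to the difference. The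
    exponents of [N / L] add up to [r / (d/2 - r) + 1 = (d/2) / (d/2 - r)]. *)
Lemma weak_type_bound r N L : 0 < r -> r <= 1 -> r < d%:R / 2 -> 0 < N -> 0 < L ->
  (sobsq a b r <= N%:E)%E ->
  (mu [set x | (L < a x ^+ 2 + b x ^+ 2)%R] <=
   (weak_const r * expR (d%:R / 2 / (d%:R / 2 - r) * (ln N - ln L)))%:E)%E.
Proof.
move=> r0 r1 rd N0 L0 hN.
have dr0 : 0 < d%:R / 2 - r by rewrite subr_gt0.
have p0 : 0 < (2 * pi) ^+ d :> R by exact: exp2pi_gt0.
have Rz0 := riesz_const_gt0 r0 rd.
have ia := gauss_bounded_int ha; have ib := gauss_bounded_int hb.
set l := weak_time r N L; have t0 := expR_gt0 l; set t := expR l in t0 *.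
have Q0 : 0 < 8 * riesz_const d r * N / (((2 * pi) ^+ d) ^+ 2 * L).
  move: (riesz_const d r) Rz0 ((2 * pi) ^+ d) p0 => z z0 c c0.
  by rewrite divr_gt0// mulr_gt0// ?mulr_gt0// exprn_gt0.
have sup x : hconv t a x ^+ 2 <= L / 8 /\ hconv t b x ^+ 2 <= L / 8.
  have := gconv_sup_bound ha hb l x d0 r0 rd N0 hN.
  rewrite !(gconv_hconv x t0)// ![(_ * hconv _ _ _) ^+ 2]exprMn.
  have -> : riesz_const d r * expR (- ((d%:R / 2 - r) * (ln 2 + l))) * N =
      ((2 * pi) ^+ d) ^+ 2 * (L / 8).
    have -> : (d%:R / 2 - r) * (ln 2 + l) = ln (8 * riesz_const d r * N / (((2 * pi) ^+ d) ^+ 2 * L)).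
      rewrite /l /weak_time; move: (ln _) (ln _) (d%:R / 2) dr0 => y1 y2 D dr0.
      by field; rewrite gt_eqF.
    rewrite expRN lnK ?posrE// invf_div.
    move: ((2 * pi) ^+ d) p0 => c c0.
    by field; rewrite !gt_eqF.
  have c2 := exprn_gt0 2 p0; by rewrite !(ler_pM2l c2).
have [Da hDa] := dist_hconv_le ha t0; have [Db hDb] := dist_hconv_le hb t0.
have hM : (2 * pi) ^+ d * (mass a b - heat_mass a b t) <= expR (r * l) * N.
  have r01 : 0 <= r <= 1 by rewrite r1 ltW.
  have := mass_le_heat_mass ha hb d0 t0 r01; rewrite expRK => h.
  have : (((2 * pi) ^+ d * mass a b)%:E <= ((2 * pi) ^+ d * heat_mass a b t + expR (r * l) * N)%:E)%E.
    rewrite EFinD (EFinM (expR _)); apply: (le_trans h); apply: leeD => //.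
    by apply: lee_wpmul2l => //; rewrite lee_fin expR_ge0.
  rewrite lee_fin [in X in _ -> X]mulrBr => h1; rewrite lerBlDl; exact: h1.
pose A := [set x | L < a x ^+ 2 + b x ^+ 2].
have mF : measT (fun x => a x ^+ 2 + b x ^+ 2).
  by apply: mf_add; apply: mf_exp; [exact: (gauss_bounded_mf ha)|exact: (gauss_bounded_mf hb)].
have mA : measurable A.
  have := mF measurableT _ (measurable_itv `]L, +oo[); rewrite setTI; congr measurable.
  by apply/seteqP; split=> y; rewrite /A/= in_itv/= andbT.
pose D x := (a x - hconv t a x) ^+ 2 + (b x - hconv t b x) ^+ 2.
have iD2 : int D by exact: integrableRD.
have hD : \int[mu]_x D x <= 2 / (2 * pi) ^+ d * (expR (r * l) * N).
  rewrite /D RintegralD//.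
  have h1 : \int[mu]_x ((a x - hconv t a x) ^+ 2) + \int[mu]_x ((b x - hconv t b x) ^+ 2) <=
      2 * (mass a b - heat_mass a b t).
    apply: (le_trans (lerD hDa hDb)); rewrite (massE ha hb) (heat_massE ha hb t0).
    by apply: eq_lee; ring.
  apply: (le_trans h1); rewrite -mulrA ler_pM2l// mulrC ler_pdivlMr// mulrC.
  exact: hM.
apply: (@le_trans _ _ ((4 / L)%:E * \int[mu]_x (D x)%:E)%E).
  have D0 x : 0 <= D x by rewrite addr_ge0 ?sqr_ge0.
  have mD : measT D by exact: (integrable_mf iD2).
  rewrite -lee_pdivrMl ?divr_gt0// invf_div -(integral_cst mu mA) integral_mkcond.
  apply: le_integralT.
  - by move=> x; rewrite patchE; case: ifP => // _; rewrite lee_fin divr_ge0// ltW.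
  - by apply/(measurable_restrictT _ _).1 => //; exact: measurable_cst.
  - exact: mf_EFin.
  move=> x; rewrite patchE; case: ifPn => xA; last by rewrite lee_fin.
  rewrite lee_fin /D; move: xA; rewrite inE /A /= => xA.
  have [sa sb] := sup x; move: (a x) (b x) (hconv t a x) (hconv t b x) xA sa sb => x1 x2 y1 y2 h1 h2 h3.
  (* These squares give [(x - y) ^+ 2 >= x ^+ 2 / 2 - y ^+ 2] in each component, in total at least
     [L / 2 - L / 4]. *)
  have := sqr_ge0 (x1 - 2 * y1); have := sqr_ge0 (x2 - 2 * y2); rewrite !expr2 in h1 h2 h3 *; lra.
rewrite -(EFin_Rintegral iD2) -EFinM lee_fin.
have L40 : 0 <= 4 / L by rewrite divr_ge0// ltW.
apply: (le_trans (ler_wpM2l L40 hD)).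
apply: eq_lee.
have -> : expR (r * l) = expR (r / (d%:R / 2 - r) * ln (8 * riesz_const d r / ((2 * pi) ^+ d) ^+ 2) - r * ln 2) *
    expR (r / (d%:R / 2 - r) * (ln N - ln L)).
  have -> : l = (ln (8 * riesz_const d r / ((2 * pi) ^+ d) ^+ 2) + (ln N - ln L)) / (d%:R / 2 - r) - ln 2.
    have q2 : 0 < N / L by rewrite divr_gt0.
    rewrite /l /weak_time; move: (riesz_const d r) Rz0 ((2 * pi) ^+ d) p0 => z z0 c c0.
    have q1 : 0 < 8 * z / c ^+ 2 by rewrite divr_gt0 ?exprn_gt0// mulr_gt0.
    rewrite -ln_div ?posrE// -lnM ?posrE//; congr (ln _ / _ - _).
    by field; rewrite !gt_eqF.
  rewrite -expRD; congr expR; move: (ln _) (ln N - _) (ln 2) (d%:R / 2) dr0 => y1 y2 y3 d2 dr0.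
  by field; rewrite gt_eqF.
have -> : expR (d%:R / 2 / (d%:R / 2 - r) * (ln N - ln L)) = expR (r / (d%:R / 2 - r) * (ln N - ln L)) * (N / L).
  rewrite -[N / L](lnK (_ : _ \in Num.pos)) ?posrE ?divr_gt0// ln_div ?posrE// -expRD; congr expR.
  move: (ln N - _) (d%:R / 2) dr0 => y1 d2 dr0.
  by field; rewrite gt_eqF.
rewrite /weak_const; move: ((2 * pi) ^+ d) p0 => c c0; move: (expR _) (expR _) => e1 e2.
by field; rewrite !gt_eqF.
Qed.

End faber_krahn.

(** * Choice of the constants and conclusion for pairs of real functions *)

Section hardy_sobolev.
Context {R : realType} (d : nat).
Local Notation mu := (@lebesgue_rV R d).
Variables (s q : R).
Hypotheses (d0 : (0 < d)%N) (s0 : 0 < s) (s1 : s < 1) (sd : s < d%:R / 2).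
Hypotheses (q1 : 1 <= q) (qs : q < sobolev_exponent d s).

(** The last condition amounts to [e < d / q - (d / 2 - s)], whose right side is positive because
    [q] is subcritical; half of a minimum meets all the strict bounds. It involves [q / 2] because
    the weak-type estimate concerns |u|^2. *)
Lemma exponent_choice : exists e, [/\ 0 < e, e < (d%:R - 2 * s) / 4, e < s &
  q / 2 < d%:R / 2 / (d%:R / 2 - (s - e))].
Proof.
have q0 : 0 < q by exact: lt_le_trans q1.
have d0' : 0 < d%:R :> R by rewrite ltr0n.
have ds0 : 0 < d%:R - 2 * s by move: sd; lra.
have dl0 : 0 < d%:R / q - (d%:R / 2 - s).
  move: qs; rewrite /sobolev_exponent ltr_pdivlMr// => h.
  by rewrite subr_gt0 ltr_pdivlMr//; lra.
exists (Num.min (Num.min ((d%:R - 2 * s) / 4) s) (d%:R / q - (d%:R / 2 - s)) / 2).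
set m := Num.min _ _.
have m0 : 0 < m by rewrite !lt_min s0 dl0 andbT divr_gt0.
have m1 : m <= (d%:R - 2 * s) / 4 by rewrite !ge_min lexx.
have m2 : m <= s by rewrite !ge_min lexx !orbT.
have m3 : m <= d%:R / q - (d%:R / 2 - s) by rewrite !ge_min lexx !orbT.
split; [lra|lra|lra|].
have h0 : 0 < d%:R / 2 - (s - m / 2) by move: sd; lra.
rewrite ltr_pdivlMr//.
have : d%:R / 2 - (s - m / 2) < d%:R / q by lra.
by rewrite ltr_pdivlMr//; lra.
Qed.

Lemma hardy_sobolev_real : exists C : R, 0 < C /\
  forall K (a b : 'rV[R]_d -> R) Omega V H h, gauss_bounded K a -> gauss_bounded K b ->
  measurable Omega -> mu Omega = V%:E -> 0 < V ->
  (forall x, ~ Omega x -> a x = 0) -> (forall x, ~ Omega x -> b x = 0) ->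
  (\int[mu]_x (enorm x `^ (- (2 * s)) * (a x ^+ 2 + b x ^+ 2))%:E = H%:E)%E ->
  sobsq a b s = ((2 * pi) ^+ d * (h + hardy_const d s * H))%:E ->
  exists2 J, (\int[mu]_x ((a x ^+ 2 + b x ^+ 2) `^ (q / 2))%:E = J%:E)%E &
    J `^ (2 / q) <= C * V `^ (2 * (q^-1 - (sobolev_exponent d s)^-1)) * h.
Proof.
have q0 : 0 < q by exact: lt_le_trans q1.
have d0' : 0 < d%:R :> R by rewrite ltr0n.
have ds0 : 0 < d%:R - 2 * s by move: sd; lra.
have [e [e0 eb es rrho]] := exponent_choice.
have [eps [B [eps0 B0 gain]]] := hardy_gain d0 s0 e0 eb es.
have c0 : 0 < (2 * pi) ^+ d :> R by exact: exp2pi_gt0.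
set c := (2 * pi) ^+ d in gain c0 *.
have ts : 0 < s - e by rewrite subr_gt0.
have td : s - e < d%:R / 2 by lra.
have t1 : s - e <= 1 by move: s1; lra.
set t := s - e in gain rrho ts td t1 *.
set rho := d%:R / 2 / (d%:R / 2 - t) in rrho *.
have r0 : 0 < q / 2 by rewrite divr_gt0.
have rho0 : 0 < rho by exact: lt_trans rrho.
(* Chosen so that [B * expR (t * l0) = eps / 4]: at [l = l0 - f] the mass term is then at most half
   of the gain. *)
pose l0 := ln (eps / (4 * B)) / t.
(* [fk_time] for [V = 1]; in general [2 / d * ln V] is added, which isolates the power of the
   volume. *)
pose f0 : R := (ln 2 - d%:R / 2 * ln (4 * pi)) * (2 / d%:R).
pose A1 := 2 * c / eps * expR (- (e * l0) + e * f0).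
have A10 : 0 < A1 by rewrite mulr_gt0 ?expR_gt0// divr_gt0// mulr_gt0.
pose C6 := 1 + weak_const d t * 2 `^ (q / 2) / (1 - 2 `^ (- (rho - q / 2))).
have C60 : 0 < C6.
  rewrite /C6; move: (weak_const d t) (weak_const_gt0 d t) => w w0.
  have x1 : 2 `^ (- (rho - q / 2)) <= 1 :> R.
    rewrite /powR pnatr_eq0 /= -[leRHS]expR0 ler_expR mulNr oppr_le0 mulr_ge0//.
      by rewrite subr_ge0 ltW.
    by rewrite ln_ge0// ler1n.
  rewrite ltr_pwDl// divr_ge0 ?subr_ge0//.
  by rewrite mulr_ge0 ?powR_ge0// ltW.
exists (C6 `^ (2 / q) * A1); split; first by rewrite mulr_gt0 ?powR_gt0.
move=> K a b Omega V H h ha hb mO muO V0 aO bO hH hN.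
have hg l : ((eps * expR (e * l))%:E * sobsq a b t <=
    (c * h + B * expR (s * l) * (c * mass a b))%:E)%E.
  have := gain K a b l ha hb; rewrite hH hN -!EFinM -EFinD.
  move: (sobsq a b t) (sobsq_ge0 a b t) => [x| |] //.
    move=> x0; rewrite -EFinM -EFinD !lee_fin -/c; lra.
  by move=> _; rewrite gt0_muley ?lte_fin ?mulr_gt0 ?expR_gt0//=.
(* In [hg] the right side is finite and the coefficient on the left positive, so the norm of order
   [t] is finite. *)
have [n hn] : exists n, sobsq a b t = n%:E.
  have := hg 0; move: (sobsq a b t) (sobsq_ge0 a b t) => [x| |] //.
    by move=> _ _; exists x.
  by move=> _; rewrite gt0_muley ?lte_fin ?mulr_gt0 ?expR_gt0//=.
have n0 : 0 <= n by rewrite -lee_fin -hn sobsq_ge0.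
pose f := @fk_time R d V.
have hFK : c * mass a b <= 2 * (expR (t * f) * n).
  by apply: (faber_krahn ha hb d0 mO muO V0 aO bO); [rewrite (ltW ts)|rewrite hn].
have hn2 : n <= A1 * expR (2 * e / d%:R * ln V) * h.
  pose l := l0 - f.
  have := hg l; rewrite hn -EFinM lee_fin => h1.
  have h2 : B * expR (s * l) * (c * mass a b) <= eps / 2 * expR (e * l) * n.
    apply: (@le_trans _ _ (B * expR (s * l) * (2 * (expR (t * f) * n)))).
      by rewrite ler_wpM2l// mulr_ge0 ?expR_ge0// ltW.
    rewrite (_ : s * l = e * l + (t * l0 - t * f)); last by rewrite /t /l; ring.
    rewrite !expRD expRN /l0 [t * (_ / _)]mulrC divfK ?gt_eqF// lnK ?posrE ?divr_gt0 ?mulr_gt0//.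
    apply: eq_lee.
    by field; rewrite !gt_eqF ?expR_gt0.
  have h3 : eps / 2 * expR (e * l) * n <= c * h by lra.
  have k0 : 0 < eps / 2 * expR (e * l) by rewrite mulr_gt0 ?expR_gt0// divr_gt0.
  rewrite -(ler_pM2l k0); apply: (le_trans h3); apply: eq_lee.
  have -> : A1 * expR (2 * e / d%:R * ln V) = 2 * c / eps * expR (- (e * l)).
    rewrite /A1 -mulrA -expRD; congr (_ * expR _).
    rewrite /l /f /fk_time lnM ?posrE// /f0; move: (ln _) (ln _) (ln _) => y1 y2 y3.
    by field; rewrite gt_eqF.
  rewrite expRN; have := expR_gt0 (e * l); move: (expR _) => E E0.
  by field; rewrite !gt_eqF.
have h0 : 0 <= h.
  have : 0 <= A1 * expR (2 * e / d%:R * ln V) * h by exact: le_trans hn2.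
  by rewrite pmulr_rge0// mulr_gt0 ?expR_gt0.
pose F x := a x ^+ 2 + b x ^+ 2.
have mF : measT F.
  by apply: mf_add; apply: mf_exp; [exact: (gauss_bounded_mf ha)|exact: (gauss_bounded_mf hb)].
have F0 x : 0 <= F x by rewrite addr_ge0 ?sqr_ge0.
have FK x : F x <= 2 * K ^+ 2.
  have sqK g : gauss_bounded K g -> g x ^+ 2 <= K ^+ 2.
    move=> hgb; rewrite -(real_normK (num_real _)) ler_pXn2r ?nnegrE ?(gauss_bounded_K hgb)//.
    exact: gauss_bounded_le.
  by have := sqK _ ha; have := sqK _ hb; rewrite /F; lra.
have FO x : ~ Omega x -> F x = 0 by move=> xO; rewrite /F aO// bO// expr0n addr0.
pose ex : R := 2 * (q^-1 - (sobolev_exponent d s)^-1).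
(* The volume enters with the power [2 * e / d] from the absorption and [2 / q - rho^-1] from the
   weak-type sum; [e] cancels. *)
have exE : 2 * e / d%:R + 2 / q - rho^-1 = ex.
  rewrite /ex /rho /sobolev_exponent invf_div /t.
  by field; rewrite !gt_eqF.
(* [h] may be 0 whereas the weak-type bound takes the logarithm of [N]; [h + eta] is used instead,
   and [eta] tends to 0 at the end. *)
have key eta : 0 < eta -> (\int[mu]_x (F x `^ (q / 2))%:E <=
    (C6 * expR (q / 2 * (ln (A1 * (h + eta)) + ex * ln V)))%:E)%E.
  move=> eta0; pose N := A1 * expR (2 * e / d%:R * ln V) * (h + eta).
  have he0 : 0 < h + eta by rewrite ltr_wpDl.
  have N0 : 0 < N by rewrite mulr_gt0// mulr_gt0 ?expR_gt0.
  have hnN : (sobsq a b t <= N%:E)%E.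
    by rewrite hn lee_fin (le_trans hn2)// ler_wpM2l ?lerDl ?(ltW eta0)// mulr_ge0 ?expR_ge0// ltW.
  have hw L : 0 < L -> (mu [set x | (L < F x)%R] <= (weak_const d t * expR (rho * (ln N - ln L)))%:E)%E.
    by move=> L0; exact: (weak_type_bound ha hb d0 ts t1 td N0 L0 hnN).
  have := weak_type_integral mF F0 FK FO mO muO V0 (ltW (weak_const_gt0 d t)) r0 rrho hw.
  rewrite -/C6 => /le_trans; apply; rewrite lee_fin ler_wpM2l ?(ltW C60)// ler_expR.
  apply: eq_lee.
  have -> : ln N = ln (A1 * (h + eta)) + 2 * e / d%:R * ln V.
    have Q0 : 0 < A1 * (h + eta) by rewrite mulr_gt0.
    by rewrite /N mulrAC [LHS]lnM ?posrE ?expR_gt0// expRK.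
  rewrite -exE.
  move: (ln _) (ln _) => y1 y2; clearbody rho.
  by field; rewrite !gt_eqF.
have J0 : (0 <= \int[mu]_x (F x `^ (q / 2))%:E)%E.
  by apply: integral_ge0 => x _; rewrite lee_fin powR_ge0.
have [J hJ] : exists J, (\int[mu]_x (F x `^ (q / 2))%:E = J%:E)%E.
  by move: J0 (key _ ltr01); case: (\int[mu]_x _)%E => [J| |] // _ _; exists J.
exists J => //; rewrite hJ lee_fin in J0.
have keyJ eta : 0 < eta -> J `^ (2 / q) <= C6 `^ (2 / q) * A1 * V `^ ex * (h + eta).
  move=> eta0; have he0 : 0 < h + eta by rewrite ltr_wpDl.
  have := key _ eta0; clearbody ex C6 A1; rewrite hJ lee_fin => hj.
  have q20 : 0 <= 2 / q by rewrite divr_ge0// ltW.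
  apply: (le_trans (ge0_ler_powR q20 _ _ hj)); rewrite ?nnegrE ?mulr_ge0 ?expR_ge0 ?(ltW C60)//.
  rewrite powRM ?expR_ge0 ?(ltW C60)//.
  rewrite (_ : C6 `^ (2 / q) * A1 * V `^ ex * (h + eta) = C6 `^ (2 / q) * (A1 * (h + eta) * V `^ ex)); last by ring.
  rewrite ler_wpM2l ?powR_ge0// {1}/powR gt_eqF ?expR_gt0// expRK.
  rewrite mulrA (_ : 2 / q * (q / 2) = 1); last by field; rewrite gt_eqF.
  rewrite mul1r expRD lnK ?posrE ?mulr_gt0// /powR gt_eqF//.
have Y0 : 0 < C6 `^ (2 / q) * A1 * V `^ ex by rewrite mulr_gt0 ?powR_gt0// mulr_gt0 ?powR_gt0.
rewrite -ler_pdivrMl//; apply/ler_addgt0Pr => eta eta0.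
by rewrite ler_pdivrMl// keyJ.
Qed.

End hardy_sobolev.

(** * Test functions, and the Hardy form in real terms *)

Section test_functions.
Context {R : realType} (d : nat).
Local Notation mu := (@lebesgue_rV R d).

Lemma continuous_sqn : continuous (@sqn R d).
Proof.
rewrite /sqn; elim: (index_enum _) => [|i l IH].
  rewrite (_ : (fun x => _) = cst 0); first exact: cst_continuous.
  by apply/funext => x; rewrite big_nil.
have -> : (fun x : 'rV[R]_d => \sum_(j <- i :: l) x 0 j ^+ 2) =
    (fun x : 'rV[R]_d => x 0 i * x 0 i + \sum_(j <- l) x 0 j ^+ 2).
  by apply/funext => x; rewrite big_cons expr2.
move=> x; have h := @coord_continuous R 1 d 0 i x.
exact: (cvgD (cvgM h h) (IH x)).
Qed.

(** On the compact set [expR (- sqn x)] is at least [expR (- M2)], which turns the bound [M1] of [a]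
    into a Gaussian one. *)
Lemma compact_gauss_bounded (A : set 'rV[R]_d) (a : 'rV[R]_d -> R) :
  compact A -> continuous a -> (forall x, ~ A x -> a x = 0) ->
  exists2 K, 0 < K & gauss_bounded K a.
Proof.
move=> cA ca aA.
have bnd (g : 'rV[R]_d -> R) : continuous g -> exists2 M, 0 < M & forall x, A x -> `|g x| <= M.
  move=> cg; have : compact (g @` A) by apply: continuous_compact => //; exact: continuous_subspaceT.
  move=> /compact_bounded/pinfty_ex_gt0[M M0 hM]; exists M => // x Ax.
  exact: hM (ex_intro2 _ _ x Ax erefl).
have [M1 M10 h1] := bnd _ ca; have [M2 M20 h2] := bnd _ continuous_sqn.
exists (M1 * expR M2); first by rewrite mulr_gt0 ?expR_gt0.
split => // x; have [xA|xA] := pselect (A x); last first.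
  by rewrite aA// normr0 !mulr_ge0 ?expR_ge0// ltW.
apply: (le_trans (h1 _ xA)); rewrite -mulrA -expRD ler_peMr ?(ltW M10)//.
rewrite -[leLHS]expR0 ler_expR mul1r subr_ge0.
by rewrite (le_trans (ler_norm _)) ?h2.
Qed.

Lemma gauss_boundedW K K' (a : 'rV[R]_d -> R) : K <= K' -> gauss_bounded K a -> gauss_bounded K' a.
Proof.
by move=> KK [ca h]; split => // x; rewrite (le_trans (h x))// ler_wpM2r ?expR_ge0.
Qed.

Lemma test_function_gauss_bounded Omega (u : 'rV[R]_d -> R[i]) : test_function Omega u ->
  exists K, [/\ gauss_bounded K (fun x => complex.Re (u x)),
    gauss_bounded K (fun x => complex.Im (u x)) & forall x, ~ Omega x -> u x = 0].
Proof.
move=> [sRe sIm cu uO].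
have u0 x : ~ tsupport u x -> u x = 0.
  by move=> h; apply/eqP; apply: contrapT => /negP ux; apply: h; exact: subset_closure.
have [cRe _] := sRe [::]; have [cIm _] := sIm [::].
have [|K1 K10 h1] := compact_gauss_bounded cu cRe; first by move=> x /u0 /= ->.
have [|K2 K20 h2] := compact_gauss_bounded cu cIm; first by move=> x /u0 /= ->.
exists (K1 + K2); split.
- by apply: gauss_boundedW h1; rewrite lerDl ltW.
- by apply: gauss_boundedW h2; rewrite lerDr ltW.
- by move=> x xO; apply: u0 => /uO.
Qed.

(** A nonempty open set contains a cube. Positivity of the volume allows its logarithm to be
    taken. *)
Lemma open_lebesgue_rV_gt0 (Omega : set 'rV[R]_d) : open Omega -> Omega !=set0 -> (0 < mu Omega)%E.
Proof.
move=> oO [x Ox]; have /nbhs_ballP[e /= e0 xeO] : nbhs x Omega by exact: open_nbhs_nbhs.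
pose B := [set y : 'rV[R]_d | forall i, ball (x 0 i) e (y 0 i)].
have mb (i : 'I_d) : measurable (ball (x 0 i) e) by exact: measurable_ball.
have mB : measurable B by exact: (measurable_box mb).
apply: (@lt_le_trans _ _ (mu B)).
  rewrite /B (lebesgue_rV_box mb); elim/big_ind: _ => //.
  - by move=> p q p0 q0; exact: mule_gt0.
  - by move=> i _; rewrite lebesgue_measure_ball ?(ltW e0)// lte_fin mulrn_wgt0.
apply: le_measure; rewrite ?inE//; first exact: open_measurable_rV.
by move=> y By; apply: xeO; split => // i j; rewrite (ord1 i); exact: By.
Qed.

Lemma normc_sqr (z : R[i]) : Normc.normc z ^+ 2 = complex.Re z ^+ 2 + complex.Im z ^+ 2.
Proof. by case: z => x y; rewrite /= sqr_sqrtr// addr_ge0 ?sqr_ge0. Qed.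

Lemma normc_fourier (u : 'rV[R]_d -> R[i]) xi :
  Normc.normc (fourier u xi) ^+ 2 =
  ((2 * pi) ^+ d)^-1 * ftsq (fun x => complex.Re (u x)) (fun x => complex.Im (u x)) xi.
Proof.
rewrite normc_sqr /fourier /Cintegral /ftsq /ftc.
set P := \int[mu]_x _; set Q := \int[mu]_x _.
have -> : P = \int[mu]_x (complex.Re (u x) * cos (edot xi x) + complex.Im (u x) * sin (edot xi x)).
  by apply: eq_Rintegral => x _; case: (u x) => p q /=; ring.
have -> : Q = \int[mu]_x (complex.Im (u x) * cos (edot xi x) + - complex.Re (u x) * sin (edot xi x)).
  by apply: eq_Rintegral => x _; case: (u x) => p q /=; ring.
rewrite /= !mul0r subr0 addr0 !exprMn -mulrDr; congr (_ * _).
have p0 : 0 < 2 * pi :> R by rewrite mulr_gt0 ?pi_gt0.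
by rewrite expr2 -powRD ?(gt_eqF p0) ?implybT// -opprD -splitr powRN powR_mulrn ?(ltW p0)// exprMn.
Qed.

End test_functions.

Theorem theorem2p3 (R : realType) (d : nat) (s q : R)
    (d_ge1 : (1 <= d)%N) (s_gt0 : 0 < s) (s_lt : s < Num.min 1 (d%:R / 2))
    (q_ge1 : 1 <= q) (q_lt : q < sobolev_exponent d s) :
  exists C : R, 0 < C /\
    forall Omega : set 'rV[R]_d,
      is_domain Omega -> (lebesgue_rV d Omega < +oo)%E ->
      forall u : 'rV[R]_d -> R[i], test_function Omega u ->
        (Lnorm (lebesgue_rV d) q%:E (fun x => (Normc.normc (u x))%:E) ^+ 2 <=
         C%:E * (lebesgue_rV d Omega) `^ (2 * (q^-1 - (sobolev_exponent d s)^-1)) *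
         hardy_form s u)%E.
Proof.
have := s_lt; rewrite lt_min => /andP[s1 sd].
have [C [C0 hC]] := hardy_sobolev_real d_ge1 s_gt0 s1 sd q_ge1 q_lt.
exists C; split => // Omega [ne oO _] Ofin u tu.
have [K [ha hb uO]] := test_function_gauss_bounded tu.
set a := fun x => complex.Re (u x) in ha *; set b := fun x => complex.Im (u x) in hb *.
have mO := open_measurable_rV oO.
have q0 : 0 < q by exact: lt_le_trans q_ge1.
have c0 : 0 < (2 * pi) ^+ d :> R by exact: exp2pi_gt0.
have Opos := open_lebesgue_rV_gt0 oO ne.
have [V muO] : exists V, lebesgue_rV d Omega = V%:E.
  by exists (fine (lebesgue_rV d Omega)); rewrite fineK// ge0_fin_numE// ltW.
have V0 : 0 < V by rewrite -lte_fin -muO.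
have [H hH] : exists H, (\int[lebesgue_rV d]_x (enorm x `^ (- (2 * s)) * (a x ^+ 2 + b x ^+ 2))%:E = H%:E)%E.
  have : (0 <= \int[lebesgue_rV d]_x (enorm x `^ (- (2 * s)) * (a x ^+ 2 + b x ^+ 2))%:E)%E.
    by apply: integral_ge0 => x _; rewrite lee_fin mulr_ge0 ?powR_ge0 ?addr_ge0 ?sqr_ge0.
  have := hardy_integral_fin ha hb s_gt0 sd.
  by case: (\int[_]_x _)%E => [H| |] // _ _; exists H.
have mS : measT (fun xi : 'rV[R]_d => (enorm xi `^ (2 * s) * ftsq a b xi)%:E).
  apply: mf_EFin; apply: mf_mul; first exact: mf_enorm_powR.
  exact: mf_ftsq (gauss_bounded_int ha) (gauss_bounded_int hb).
have -> : hardy_form s u = (((2 * pi) ^+ d)^-1%:E * sobsq a b s - (hardy_const d s * H)%:E)%E.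
  rewrite /hardy_form; congr (_ - _)%E.
    rewrite /sobsq -ge0_integralZlT; last 3 first.
    - by move=> x; rewrite lee_fin mulr_ge0 ?powR_ge0 ?ftsq_ge0.
    - exact: mS.
    - by rewrite invr_ge0 ltW.
    by apply: eq_integral => xi _; rewrite normc_fourier -EFinM mulrCA.
  rewrite (EFinM (hardy_const d s)) -hH; congr (_ * _)%E; apply: eq_integral => x _.
  by rewrite normc_sqr.
rewrite muO poweR_EFin -EFinM.
have CV0 : 0 < C * V `^ (2 * (q^-1 - (sobolev_exponent d s)^-1)) by rewrite mulr_gt0 ?powR_gt0.
have ic0 : 0 < ((2 * pi) ^+ d)^-1 :> R by rewrite invr_gt0.
(* If the norm of order [s] is infinite, so is the right side of the inequality, since the finite
   Hardy integral is subtracted and the constant is positive. *)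
have [hS|[S hS]] : sobsq a b s = +oo%E \/ exists S, sobsq a b s = S%:E.
- by move: (sobsq_ge0 a b s); case: (sobsq a b s) => [S| |] // _; [right; exists S|left].
- by rewrite hS gt0_muley ?lte_fin// addye// gt0_muley ?lte_fin// leey.
have aO x : ~ Omega x -> a x = 0 by move=> /uO; rewrite /a => ->.
have bO x : ~ Omega x -> b x = 0 by move=> /uO; rewrite /b => ->.
have [|J hJ hle] := hC K a b Omega V H (S / (2 * pi) ^+ d - hardy_const d s * H) ha hb mO muO V0 aO bO hH.
  by rewrite hS subrK mulrC divfK// gt_eqF.
rewrite unlock.
have -> : (\int[lebesgue_rV d]_x (`|(Normc.normc (u x))%:E| `^ q) = J%:E)%E.
  rewrite -hJ; apply: eq_integral => x _; rewrite -normc_sqr.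
  have n0 : 0 <= Normc.normc (u x) by case: (u x) => ? ?; exact: sqrtr_ge0.
  rewrite abse_EFin ger0_norm// poweR_EFin -powR_mulrn// -powRrM; congr (_ `^ _)%:E.
  by rewrite mulrC divfK.
rewrite hS.
have -> : (((2 * pi) ^+ d)^-1%:E * S%:E - (hardy_const d s * H)%:E = (S / (2 * pi) ^+ d - hardy_const d s * H)%:E)%E.
  by rewrite EFinB [X in (_ = X%:E - _)%E]mulrC.
rewrite -EFinM poweR_EFin -EFin_expe lee_fin.
rewrite -(@powR_mulrn _ (J `^ q^-1) 2) ?powR_ge0// -powRrM [q^-1 * 2]mulrC.
exact: hle.
Qed.
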